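(* Let $\pi:M\to B$ be a fiber bundle with $M$ a 5-dimensional manifold with volume form $\Omega$ and $B$ an oriented 2-manifold with area form $\omega$. Every almost coupling Poisson bivector field $\Pi=\Pi_{2,0}+\Pi_{0,2}$ on $M$ via a horizontal subbundle $\mathbb H$ is of the form $$\Pi=\kappa\,\mathrm{hor}^\gamma\psi+P_\beta,$$ where $(\gamma,\kappa,\beta)$ is the Poisson triple given by: $\gamma:TM\to\mathbb V$ the projection along $\mathbb H$, $$\kappa=-\mathbf i_{\Pi_{2,0}}\pi^*\omega,\qquad \beta=-\mathbf i_{\Pi_{0,2}}\Omega^{\mathrm V}.$$
   Context: All objects are smooth. A fiber bundle $\pi:M\to B$ is a surjective submersion; $\mathbb V=\ker d\pi\subset TM$ is the vertical subbundle (rank 3 here). An Ehresmann connection is a bundle morphism $\gamma:TM\to\mathbb V$ with $\gamma|_{\mathbb V}=\mathrm{id}$; $\mathbb H=\ker\gamma$ is the horizontal subbundle, so $TM=\mathbb H\oplus\mathbb V$ and $T^*M=\mathbb V^\circ\oplus\mathbb H^\circ$ (annihilators). These splittings bigrade multivector fields and forms: a multivector field has bidegree $(p,q)$ if it is a section of $\wedge^p\mathbb H\otimes\wedge^q\mathbb V$, and a form has bidegree $(p,q)$ if it is a section of $\wedge^p\mathbb V^\circ\otimes\wedge^q\mathbb H^\circ$. The exterior differential splits as $d=d_{1,0}+d_{0,1}+d_{2,-1}$, where for a $(p,q)$-form $\alpha$, $d_{i,j}\alpha$ is the bidegree $(p+i,q+j)$ component of $d\alpha$. For a multivector field $\psi$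 on $B$, $\mathrm{hor}^\gamma\psi$ is its $\gamma$-horizontal lift. A bivector field $\Pi$ is almost coupling via $\mathbb H$ if its $(1,1)$ component vanishes, i.e. $\Pi=\Pi_{2,0}+\Pi_{0,2}$ with $\Pi_{2,0}\in\Gamma\wedge^2\mathbb H$, $\Pi_{0,2}\in\Gamma\wedge^2\mathbb V$; it is Poisson if its Schouten bracket with itself vanishes. Interior products: $\mathbf i_{X\wedge Y}=\mathbf i_X\circ\mathbf i_Y$ for vector fields acting on forms; similarly $\mathbf i_{\alpha\wedge\alpha'}=\mathbf i_\alpha\circ\mathbf i_{\alpha'}$ for 1-forms acting on multivector fields, with $\mathbf i_\alpha$ inserting $\alpha$ in the first slot. Let $\Omega^{\mathrm H}=\pi^*\omega$ and let $\Omega^{\mathrm V}\in\Gamma\wedge^3\mathbb H^\circ$ be the unique form with $\Omega=\Omega^{\mathrm H}\wedge\Omega^{\mathrm V}$. Let $Q_{\mathrm H}\in\Gamma\wedge^2\mathbb H$, $Q_{\mathrm V}\in\Gamma\wedge^3\mathbb V$ be determined by $\mathbf i_{Q_{\mathrm H}}\Omega^{\mathrm H}=1$, $\mathbf i_{Q_{\mathrm V}}\Omega^{\mathrm V}=1$, and let $\psi\in\Gamma\wedge^2TB$ satisfy $\mathbf i_\psi\omega=-1$. Put $P_\beta=-\mathbf i_\beta Q_{\mathrm V}$, $\theta=-\mathbf i_{Q_{\mathrm V}}d_{1,0}\Omega^{\mathrm V}$, $\varrho=\mathbf i_{Q_{\mathrm H}}d_{2,-1}\Omega^{\mathrm V}$.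 A triple $(\gamma,\kappa,\beta)$, consisting of an Ehresmann connection $\gamma$, $\kappa\in C^\infty(M)$ and $\beta\in\Gamma\mathbb H^\circ$, is a Poisson triple (relative to $(\Omega,\omega)$) if $$d_{0,1}\beta\wedge\beta=0,\quad \kappa\,(d_{1,0}\beta-\theta\wedge\beta)=0,\quad d_{0,1}\kappa\wedge\beta-\kappa^2\varrho=0.$$ *)

(* Defs.v *)
From HB Require Import structures.
From mathcomp Require Import all_boot all_order all_algebra all_fingroup.
From mathcomp Require Import all_classical all_reals all_analysis.

Set Implicit Arguments.
Unset Strict Implicit.
Unset Printing Implicit Defensive.

Import Order.TTheory GRing.Theory Num.Theory.
Import numFieldNormedType.Exports.

Local Open Scope classical_set_scope.
Local Open Scope ring_scope.

(* Vectors are rows, so a linear map acts by right multiplication and the     *)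
(* matrix of the differential of f at x is the library's Jacobian 'J f x,     *)
(* with 'D_v f x = v *m 'J f x.  A covector is also a row, paired with        *)
(* vectors by <xi, v> = xi *m v^T; hence pulling xi back along v |-> v *m J   *)
(* gives xi *m J^T.                                                           *)

Section MultilinearAlgebra.
Variables (R : realType) (n : nat).

(* Functions of k (co)vectors are functions of the k x n matrix having these  *)
(* (co)vectors as rows; the multilinearity condition has the shape of         *)
(* determinant_multilinear.                                                   *)
Definition multilinear k (f : 'M[R]_(k, n) -> R) :=
  forall (A B C : 'M[R]_(k, n)) (i : 'I_k) (b c : R),
    row i A = b *: row i B + c *: row i C ->
    row' i B = row' i A -> row' i C = row' i A ->
    f A = b * f B + c * f C.

Definition alternating k (f : 'M[R]_(k, n) -> R) :=
  forall (A : 'M[R]_(k, n)) (i j : 'I_k), i != j -> row i A = row j A -> f A = 0.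

(* Normalised so that (e^1 /\ ... /\ e^k)(e_1, ..., e_k) = 1. *)
Definition wedge k l (f : 'M[R]_(k, n) -> R) (g : 'M[R]_(l, n) -> R)
    (A : 'M[R]_(k + l, n)) : R :=
  ((k`! * l`!)%N%:R)^-1 *
  \sum_(s : 'S_(k + l)) (-1) ^+ s *
     (f (usubmx (row_perm s A)) * g (dsubmx (row_perm s A))).

(* First-slot insertion of a covector in a multivector. *)
Definition insert_covec k (xi : 'rV[R]_n) (f : 'M[R]_(1 + k, n) -> R)
    (A : 'M[R]_(k, n)) : R := f (col_mx xi A).

(* i_Q alpha for a k-vector Q, with i_(X1 /\ ... /\ Xk) = i_X1 o ... o i_Xk.  *)
(* As Q = (k!)^-1 sum_s Q(e^s1, ..., e^sk) e_s1 /\ ... /\ e_sk, and the first *)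
(* factor to act is the last one, the vectors enter alpha in reverse order.   *)
Definition contract k l (Q : 'M[R]_(k, n) -> R) (alpha : 'M[R]_(k + l, n) -> R)
    (A : 'M[R]_(l, n)) : R :=
  (k`!%:R)^-1 *
  \sum_(s : {ffun 'I_k -> 'I_n})
     Q (rowsub s 1%:M) *
     alpha (col_mx (rowsub (fun i => s (rev_ord i)) 1%:M) A).

(* For h + v = 1 complementary projections: the component of f that sees r of *)
(* its arguments through h and the k - r others through v.                    *)
Definition part (h v : 'M[R]_n) (r k : nat) (f : 'M[R]_(k, n) -> R)
    (A : 'M[R]_(k, n)) : R :=
  \sum_(S : {set 'I_k} | #|S| == r)
    f (\matrix_(i < k) (row i A *m (if i \in S then h else v))).

End MultilinearAlgebra.

Section Smoothness.
Variables (R : realType) (V W : normedModType R).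

(* Meant for open U. *)
Fixpoint diff_upto (k : nat) (U : set V) (f : V -> W) : Prop :=
  match k with
  | 0 => forall x, U x -> {for x, continuous f}
  | k'.+1 => (forall x, U x -> differentiable f x) /\
             forall v : V, diff_upto k' U ('D_v f)
  end.

Definition smooth_on (U : set V) (f : V -> W) := forall k, diff_upto k U f.

End Smoothness.

(* The atlas is indexed by the points of the manifold: chart p is a chart     *)
(* around p (a choice that any atlas allows), with domain cdom p and inverse  *)
(* unchart p; the values of chart p and unchart p outside cdom p and its      *)
(* image are irrelevant.                                                      *)
Record manifold (R : realType) (n : nat) := Manifold {
  mspace :> topologicalType;
  mspace_hausdorff : hausdorff_space mspace;
  mspace_second_countable : @second_countable mspace;
  cdom : mspace -> set mspace;
  chart : mspace -> mspace -> 'rV[R]_n;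
  unchart : mspace -> 'rV[R]_n -> mspace;
  cdom_open : forall p, open (cdom p);
  mem_cdom : forall p, cdom p p;
  cimg_open : forall p, open (chart p @` cdom p);
  chartK : forall p q, cdom p q -> unchart p (chart p q) = q;
  chart_continuous : forall p q, cdom p q -> {for q, continuous (chart p)};
  unchart_continuous : forall p x, (chart p @` cdom p) x ->
    {for x, continuous (unchart p)};
  transition_smooth : forall p q,
    smooth_on (chart p @` (cdom p `&` cdom q)) (chart q \o unchart p)
}.

Section Fields.
Variables (R : realType) (n : nat) (M : manifold R n).
Implicit Types (p q r : M).

Definition cimg p : set 'rV[R]_n := chart p @` cdom p.

(* The tangent space at p is R^n, a tangent vector being given by its         *)
(* coordinates in chart p; accordingly a k-form (resp. a k-vector field)       *)
(* assigns to p a function of k vectors (resp. covectors) of R^n.             *)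
Definition tfield k := M -> 'M[R]_(k, n) -> R.

(* Turns the coordinates in chart p of vectors tangent at r into their        *)
(* coordinates in chart q.                                                    *)
Definition chart_change p q r : 'M[R]_n := 'J (chart q \o unchart p) (chart p r).

(* Expressions in chart p, at the point with coordinates x, of a form, of a   *)
(* multivector field, of a bundle endomorphism of the tangent bundle, and of   *)
(* m vector fields.                                                           *)
Definition form_loc k (a : tfield k) p (x : 'rV[R]_n) (A : 'M[R]_(k, n)) : R :=
  let r := unchart p x in a r (A *m chart_change p r r).
Definition mv_loc k (P : tfield k) p (x : 'rV[R]_n) (A : 'M[R]_(k, n)) : R :=
  let r := unchart p x in P r (A *m (chart_change r p r)^T).
Definition end_loc (g : M -> 'M[R]_n) p (x : 'rV[R]_n) : 'M[R]_n :=
  let r := unchart p x in chart_change p r r *m g r *m chart_change r p r.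
Definition vec_loc m (E : M -> 'M[R]_(m, n)) p (x : 'rV[R]_n) : 'M[R]_(m, n) :=
  let r := unchart p x in E r *m chart_change r p r.

Definition smooth_fun (f : M -> R) :=
  forall p, smooth_on (cimg p) (f \o unchart p : 'rV[R]_n -> R).

Definition is_form k (a : tfield k) :=
  (forall p, multilinear (a p) /\ alternating (a p)) /\
  (forall p A, smooth_on (cimg p) (fun x => form_loc a p x A : R)).

Definition is_multivector k (P : tfield k) :=
  (forall p, multilinear (P p) /\ alternating (P p)) /\
  (forall p A, smooth_on (cimg p) (fun x => mv_loc P p x A : R)).

Definition form0 (f : M -> R) : tfield 0 := fun p _ => f p.

(* It orients M; no orientation is carried separately. *)
Definition volume_form (Omega : tfield n) :=
  is_form Omega /\ forall p, exists A, Omega p A != 0.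

(* Coordinate formula in chart p, at p:                                       *)
(*   d a (v_0, ..., v_k) = sum_i (-1)^i D_(v_i) a(v_0, .., ^v_i, .., v_k).    *)
Definition ext_d k (a : tfield k) : tfield k.+1 := fun p A =>
  \sum_(i < k.+1) (-1) ^+ i *
     'D_(row i A) (fun x => form_loc a p x (row' i A) : R) (chart p p).

Definition grad (f : 'rV[R]_n -> R) (x : 'rV[R]_n) : 'rV[R]_n :=
  \row_i 'D_(delta_mx 0 i) f x.

(* In chart p, at p, viewing multivectors as multiderivations:                *)
(*   (P o Q)(x1, x2, x3) = sum_(shuffles s) sgn(s) P(d(Q(x_s1, x_s2)), x_s3), *)
(* and the Schouten bracket of bivector fields is P o Q + Q o P.              *)
Definition mv_comp (P Q : tfield 2) : tfield 3 := fun p A =>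
  2%:R^-1 * \sum_(s : 'S_3) (-1) ^+ s *
    let B : 'M[R]_(2 + 1, n) := row_perm s A in
    P p (col_mx (grad (fun x => mv_loc Q p x (usubmx B)) (chart p p))
                (dsubmx B)).

Definition schouten (P Q : tfield 2) : tfield 3 := fun p A =>
  mv_comp P Q p A + mv_comp Q P p A.

Definition poisson (P : tfield 2) :=
  is_multivector P /\ forall p A, schouten P P p A = 0.

(* H p represents a subspace of the tangent space at p by its row space. *)
Definition smooth_subbundle (m : nat) (H : M -> 'M[R]_n) :=
  forall p, exists (U : set M) (E : M -> 'M[R]_(m, n)),
    [/\ open U, U p, U `<=` cdom p,
        forall q, U q -> row_free (E q) /\ (E q :=: H q)%MS
      & smooth_on (chart p @` U) (vec_loc E p)].

(* In the next three definitions g is an Ehresmann connection, with           *)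
(* horizontal projection 1 - g.  Covectors are projected by the transposes,   *)
(* so an argument in the annihilator of the vertical bundle probes the        *)
(* horizontal directions of a multivector.                                    *)
Definition form_part (g : M -> 'M[R]_n) (i : nat) k (a : tfield k) : tfield k :=
  fun p => part (1%:M - g p) (g p) i (a p).
Definition mv_part (g : M -> 'M[R]_n) (i : nat) k (P : tfield k) : tfield k :=
  fun p => part (1%:M - g p)^T (g p)^T i (P p).

(* d_(i, 1 - i) on forms of bidegree (j, k - j). *)
Definition bigraded_d (g : M -> 'M[R]_n) (j i : nat) k (a : tfield k) :
    tfield k.+1 := form_part g (j + i) (ext_d a).

(* Bidegree (i, k - i). *)
Definition form_bidegree (g : M -> 'M[R]_n) (i : nat) k (a : tfield k) :=
  forall p A, form_part g i a p A = a p A.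
Definition mv_bidegree (g : M -> 'M[R]_n) (i : nat) k (P : tfield k) :=
  forall p A, mv_part g i P p A = P p A.

Definition almost_coupling (g : M -> 'M[R]_n) (P : tfield 2) :=
  forall p A, mv_part g 1 P p A = 0.

End Fields.

Section Bundles.
Variables (R : realType) (n m : nat) (M : manifold R n) (B : manifold R m).

Definition smooth_map (f : M -> B) :=
  continuous f /\
  forall p b, smooth_on (chart p @` (cdom p `&` f @^-1` cdom b))
                        (chart b \o f \o unchart p).

Definition dmap (f : M -> B) (p : M) : 'M[R]_(n, m) :=
  'J (chart (f p) \o f \o unchart p) (chart p p).

Definition pullback (f : M -> B) k (a : tfield B k) : tfield M k :=
  fun p A => a (f p) (A *m dmap f p).

Definition fiber_bundle (pi : M -> B) :=
  [/\ smooth_map pi, (forall b, exists p, pi p = b)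
    & forall p, row_full (dmap pi p)].

Definition vertical (pi : M -> B) (p : M) : 'M[R]_n := kermx (dmap pi p).

Definition ehresmann (pi : M -> B) (g : M -> 'M[R]_n) :=
  (forall p, smooth_on (cimg p) (end_loc g p)) /\
  (forall p, (g p <= vertical pi p)%MS /\
             vertical pi p *m g p = vertical pi p).

(* The rank of a complement of the vertical bundle is dim B. *)
Definition horizontal_subbundle (pi : M -> B) (H : M -> 'M[R]_n) :=
  smooth_subbundle m H /\
  forall p, (H p :&: vertical pi p = 0)%MS /\
            (H p + vertical pi p :=: 1%:M)%MS.

Definition connection_along (pi : M -> B) (H : M -> 'M[R]_n) : M -> 'M[R]_n :=
  fun p => proj_mx (vertical pi p) (H p).

(* pinvmx (dmap pi p) is some right inverse of the differential of pi; its    *)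
(* horizontal part is the horizontal lift of tangent vectors of B.            *)
Definition hor_lift (pi : M -> B) (g : M -> 'M[R]_n) (p : M) : 'M[R]_(m, n) :=
  pinvmx (dmap pi p) *m (1%:M - g p).

Definition hor (pi : M -> B) (g : M -> 'M[R]_n) k (psi : tfield B k) :
    tfield M k :=
  fun p A => psi (pi p) (A *m (hor_lift pi g p)^T).

End Bundles.

Section PoissonTriples.
Variables (R : realType) (M : manifold R 5) (B : manifold R 2) (pi : M -> B).
Variables (Omega : tfield M 5) (omega : tfield B 2).

Definition is_vertical_volume (g : M -> 'M[R]_5) (OmegaV : tfield M 3) :=
  [/\ is_form OmegaV, form_bidegree g 0 OmegaV
    & forall p A, Omega p A = @wedge R 5 2 3 (pullback pi omega p) (OmegaV p) A].

Definition is_QH (g : M -> 'M[R]_5) (QH : tfield M 2) :=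
  [/\ is_multivector QH, mv_bidegree g 2 QH
    & forall p A, @contract R 5 2 0 (QH p) (pullback pi omega p) A = 1].

Definition is_QV (g : M -> 'M[R]_5) (OmegaV QV : tfield M 3) :=
  [/\ is_multivector QV, mv_bidegree g 0 QV
    & forall p A, @contract R 5 3 0 (QV p) (OmegaV p) A = 1].

Definition is_psi (psi : tfield B 2) :=
  is_multivector psi /\
  forall b A, @contract R 2 2 0 (psi b) (omega b) A = -1.

Definition P_of (QV : tfield M 3) (beta : tfield M 1) : tfield M 2 := fun p A =>
  (* the covector whose pairing with v is beta p v *)
  let xi := \row_(i < 5) beta p (delta_mx 0 i) in
  - @insert_covec R 5 2 xi (QV p) A.

Definition theta_of (g : M -> 'M[R]_5) (OmegaV QV : tfield M 3) : tfield M 1 :=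
  fun p A => - @contract R 5 3 1 (QV p) (bigraded_d g 0 1 OmegaV p) A.

Definition rho_of (g : M -> 'M[R]_5) (OmegaV : tfield M 3) (QH : tfield M 2) :
    tfield M 2 :=
  fun p A => @contract R 5 2 2 (QH p) (bigraded_d g 0 2 OmegaV p) A.

(* Relative to (Omega, omega); OmegaV, QH and QV are unique. *)
Definition poisson_triple (g : M -> 'M[R]_5) (kappa : M -> R)
    (beta : tfield M 1) :=
  [/\ ehresmann pi g, smooth_fun kappa, is_form beta, form_bidegree g 0 beta
    & exists (OmegaV : tfield M 3) (QH : tfield M 2) (QV : tfield M 3),
      [/\ is_vertical_volume g OmegaV, is_QH g QH, is_QV g OmegaV QV
        & let theta := theta_of g OmegaV QV in
          let rho := rho_of g OmegaV QH in
          [/\ forall p A,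
                @wedge R 5 2 1 (bigraded_d g 0 0 beta p) (beta p) A = 0,
              forall p A,
                kappa p * (bigraded_d g 0 1 beta p A
                           - @wedge R 5 1 1 (theta p) (beta p) A) = 0
            & forall p A,
                @wedge R 5 1 1 (bigraded_d g 0 0 (form0 kappa) p) (beta p) A
                - kappa p ^+ 2 * rho p A = 0]]].

Definition kappa_of (P20 : tfield M 2) : M -> R := fun p =>
  - @contract R 5 2 0 (P20 p) (pullback pi omega p) 0.

Definition beta_of (OmegaV : tfield M 3) (P02 : tfield M 2) : tfield M 1 :=
  fun p A => - @contract R 5 2 1 (P02 p) (OmegaV p) A.

End PoissonTriples.

(* Main.v *)
(* At a point p let D be the matrix of the differential of pi, h the horizontal *)
(* lift, K a basis of the vertical space and N the coordinates along K of the   *)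
(* vertical projection, so that D h + N K = 1.  The formula for Pi is pointwise *)
(* linear algebra: Pi has no mixed part, its horizontal part lies in a line,    *)
(* and a bivector on a 3-space is the insertion of a covector in a volume.      *)
(*   The equations of a Poisson triple are the Jacobi identity of Pi in the     *)
(* frame (h, K) at p, evaluated on three vertical covectors, on one horizontal  *)
(* and two vertical ones, and on two horizontal and one vertical one.  The      *)
(* frame is kept constant in a chart, so it is adapted only at p; the           *)
(* derivatives of D and h at p enter through the identities h D = 1,            *)
(* i_h OmegaV = 0, Pi(D, -) = kappa h, and the symmetry of the derivative of D, *)
(* which is a Jacobian.                                                         *)

Require Import Defs.
From HB Require Import structures.
From mathcomp Require Import all_boot all_order all_algebra all_fingroup.
From mathcomp Require Import all_classical all_reals all_analysis.
From mathcomp Require Import ring.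

Set Implicit Arguments.
Unset Strict Implicit.
Unset Printing Implicit Defensive.

Import Order.TTheory GRing.Theory Num.Theory.
Import numFieldNormedType.Exports.

Local Open Scope classical_set_scope.
Local Open Scope ring_scope.

(** * Smooth maps *)

Section Germs.
Variables (R : realType) (V W : normedModType R).

(** The formula for [Pi] is linear algebra at each point; the three equations are components of the
    Jacobi identity; the rest is smoothness.

    Formula. At a point the tangent space is a horizontal plane plus a vertical 3-space. Having no
    mixed part, [Pi] is the sum of a bivector of the plane and a bivector of the 3-space
    ([coupling_split]). Bivectors of the plane form a line, and [kappa] is the coefficient with
    respect to the lift of [psi] ([kappa_point]). On the 3-space the volume [OmegaV] identifies
    bivectors with covectors: [beta] is the image of the vertical part, and insertion in [QV] is the
    inverse map up to sign ([beta_frame_vert], [coupling_formula]).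

    Equations. Around p everything is written in chart p and expanded in a constant frame, adapted
    to the splitting at p only, and in its dual coframe. Away from p the lift and the differential
    of [pi] therefore have variable components, whose derivatives at p enter the computation. They
    are controlled by identities valid near p: the lift is inverse to the differential of [pi] on
    horizontal vectors ([jet_hor_cov]), [OmegaV] kills lifted vectors ([jet_vol_hor]), [Pi] maps a
    base covector to a multiple of a lifted vector ([jet_bi_cov]), and the differential of [pi] is a
    Jacobian, so its derivative is symmetric ([jet_cov_sym], by [schwarz]). The vanishing Schouten
    bracket becomes a cyclic sum ([jet_jacobi]). What is left is polynomial algebra in finitely many
    numbers: three vertical indices give the integrability of [beta] along the fibers
    ([jacobi_vertical]), one horizontal index gives the equation with theta ([jacobi_mixed]), two
    give the equation with rho ([jacobi_horizontal]). The lemmas [triple_eq1], [triple_eq2] and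
    [triple_eq3] pass from frame vectors to arbitrary arguments.

    Smoothness. A local frame of the subbundle expresses the lift through the inverse of a smooth
    matrix ([smooth_local_hor_lift]), which gives the connection; [kappa] and [beta] are smooth by
    their expressions in charts ([kappa_local], [beta_local]). *)

Lemma near_eq_differentiable (f g : V -> W) (x : V) :
  (\near x, f x = g x) -> differentiable f x -> differentiable g x.
Proof.
move=> fg df; have fgx : f x = g x by exact: nbhs_singleton fg.
have [dfc dfe] := (diff_locallyP x f).1 df.
have dge : g \o shift x = cst (g x) + 'd f x +o_ 0 id.
  apply/eqaddoP => e e0; move/eqaddoP : dfe => /(_ e e0).
  apply: filter_app.
  have : \forall h \near (0 : V), f (h + x) = g (h + x).
    by have := fg; rewrite (near_shift (0 : V)) subr0.
  apply: filter_app; near=> h => fgh.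
  by rewrite /= !fctE /= -fgx fgh.
apply/diff_locallyP; have := @diff_unique _ _ _ g ('d f x) x dfc dge.
by move=> ->.
Unshelve. all: by end_near. Qed.

Lemma near_eq_continuous (f g : V -> W) (x : V) :
  (\near x, f x = g x) -> {for x, continuous f} -> {for x, continuous g}.
Proof.
move=> fg cf; rewrite /prop_for /continuous_at -(nbhs_singleton fg).
by apply: cvg_trans cf; apply: near_eq_cvg; apply: filterS fg => y.
Qed.

Lemma open_near_eq (U : set V) (f g : V -> W) (x : V) :
  open U -> U x -> (forall y, U y -> f y = g y) -> \near x, f x = g x.
Proof. by move=> oU Ux fg; apply: filterS (open_nbhs_nbhs (conj oU Ux)). Qed.

Lemma diff_uptoS k (U : set V) (f : V -> W) :
  diff_upto k.+1 U f -> diff_upto k U f.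
Proof.
elim: k f => [|k IH] f [df Df]; first by move=> x /df; exact: differentiable_continuous.
by split=> // v; apply: IH.
Qed.

Lemma sub_diff_upto k (U N : set V) (f : V -> W) :
  N `<=` U -> diff_upto k U f -> diff_upto k N f.
Proof.
move=> NU; elim: k f => [|k IH] f /=; first by move=> cf x /NU; exact: cf.
by move=> [df Df]; split=> [x /NU|v]; [exact: df|apply: IH].
Qed.

(** On an open set, equality is equality of germs at each point, and this passes to directional
    derivatives at every order. *)
Lemma eq_diff_upto k (U : set V) (f g : V -> W) : open U ->
  (forall x, U x -> f x = g x) -> diff_upto k U f -> diff_upto k U g.
Proof.
move=> oU; elim: k f g => [|k IH] f g fg /=.
  by move=> cf x Ux; apply: near_eq_continuous (cf x Ux); exact: open_near_eq fg.
move=> [df Df]; split=> [x Ux|v].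
  by apply: near_eq_differentiable (df x Ux); exact: open_near_eq fg.
by apply: IH (Df v) => x Ux; apply: near_eq_derive; exact: open_near_eq fg.
Qed.

(** Every clause of [diff_upto] is a condition at single points on globally defined functions, so it
    is inherited from any sets that cover [U]. *)
Lemma diff_upto_local k (U : set V) (f : V -> W) :
  (forall x, U x -> exists2 N : set V, N x & diff_upto k N f) -> diff_upto k U f.
Proof.
elim: k f => [|k IH] f loc /=.
  by move=> x /loc[N Nx]; exact.
split=> [x /loc[N Nx [df _]]|v]; first exact: df.
apply: IH => x /loc[N Nx [_ Df]]; exists N => //; exact: Df.
Qed.

Lemma smooth_local (U : set V) (f : V -> W) :
  (forall x, U x -> exists2 N : set V, N x & smooth_on N f) -> smooth_on U f.
Proof. by move=> loc k; apply: diff_upto_local => x /loc[N Nx sf]; exists N. Qed.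

Lemma sub_smooth (U N : set V) (f : V -> W) :
  N `<=` U -> smooth_on U f -> smooth_on N f.
Proof. by move=> NU sf k; exact: sub_diff_upto (sf k). Qed.

Lemma eq_smooth (U : set V) (f g : V -> W) : open U ->
  (forall x, U x -> f x = g x) -> smooth_on U f -> smooth_on U g.
Proof. by move=> oU fg sf k; exact: eq_diff_upto (sf k). Qed.

Lemma smooth_differentiable (U : set V) (f : V -> W) x :
  smooth_on U f -> U x -> differentiable f x.
Proof. by move=> sf Ux; have [df _] := sf 1%N; exact: df. Qed.

Lemma smooth_derive (U : set V) (f : V -> W) v :
  smooth_on U f -> smooth_on U ('D_v f).
Proof. by move=> sf k; have [_ Df] := sf k.+1; exact: Df. Qed.

Lemma diff_upto_cst k (U : set V) (c : W) : diff_upto k U (cst c).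
Proof.
elim: k c => [|k IH] c /=; first by move=> x _; exact: cst_continuous.
split=> // v; rewrite (_ : 'D_v (cst c) = cst 0) //.
by apply/funext => x; rewrite derive_cst.
Qed.

Lemma smooth_cst (U : set V) (c : W) : smooth_on U (fun=> c).
Proof. by move=> k; exact: diff_upto_cst. Qed.

Lemma diff_uptoD k (U : set V) (f g : V -> W) : open U ->
  diff_upto k U f -> diff_upto k U g -> diff_upto k U (fun x => f x + g x).
Proof.
move=> oU; elim: k f g => [|k IH] f g /=.
  by move=> cf cg x Ux; apply: continuousD; [exact: cf|exact: cg].
move=> [df Df] [dg Dg]; split=> [x Ux|v].
  by apply: differentiableD; [exact: df|exact: dg].
apply: eq_diff_upto (IH _ _ (Df v) (Dg v)) => // x Ux /=.
by rewrite -deriveD //; apply: diff_derivable; [exact: df|exact: dg].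
Qed.

Lemma smoothD (U : set V) (f g : V -> W) : open U ->
  smooth_on U f -> smooth_on U g -> smooth_on U (fun x => f x + g x).
Proof. by move=> oU sf sg k; exact: diff_uptoD. Qed.

Lemma diff_upto_sum k (U : set V) I (r : seq I) (P : pred I) (f : I -> V -> W) :
  open U -> (forall i, P i -> diff_upto k U (f i)) ->
  diff_upto k U (fun x => \sum_(i <- r | P i) f i x).
Proof.
move=> oU sf; elim: r => [|i r IH].
  by apply: eq_diff_upto (@diff_upto_cst k U 0) => // x _; rewrite big_nil.
case Pi : (P i); last by apply: eq_diff_upto IH => // x _; rewrite big_cons Pi.
apply: eq_diff_upto (diff_uptoD oU (sf i Pi) IH) => // x _.
by rewrite big_cons Pi.
Qed.

Lemma smooth_sum (U : set V) I (r : seq I) (P : pred I) (f : I -> V -> W) :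
  open U -> (forall i, P i -> smooth_on U (f i)) ->
  smooth_on U (fun x => \sum_(i <- r | P i) f i x).
Proof. by move=> oU sf k; apply: diff_upto_sum => // i Pi; exact: sf. Qed.

Lemma diff_uptoZl k (U : set V) (f : V -> R) (c : W) : open U ->
  diff_upto k U f -> diff_upto k U (fun x => f x *: c).
Proof.
move=> oU; elim: k f => [|k IH] f /=.
  by move=> cf x Ux; apply: continuousZr_tmp; exact: cf.
move=> [df Df]; split=> [x Ux|v].
  by apply: differentiableZl; exact: df.
apply: eq_diff_upto (IH _ (Df v)) => // x Ux /=.
have dfx := df x Ux; rewrite [RHS]deriveE; last exact: differentiableZl.
by rewrite diffZl // deriveE.
Qed.

End Germs.

(** * Products, inverses, coordinates and composition of smooth maps *)

Section SmoothScalars.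
Variables (R : realType) (V : normedModType R).
Implicit Types (U : set V) (f g : V -> R).

Lemma diff_uptoM k U f g : open U ->
  diff_upto k U f -> diff_upto k U g -> diff_upto k U (fun x => f x * g x).
Proof.
move=> oU; elim: k f g => [|k IH] f g.
  by move=> cf cg x Ux; apply: continuousM; [exact: cf|exact: cg].
move=> sf sg; have [df Df] := sf; have [dg Dg] := sg; split=> [x Ux|v].
  by apply: differentiableM; [exact: df|exact: dg].
apply: (@eq_diff_upto _ _ _ _ _ (fun x => f x * 'D_v g x + g x * 'D_v f x)) => //.
  move=> x Ux; rewrite (@deriveM _ _ f g) //; apply: diff_derivable.
    exact: df.
  exact: dg.
by apply: diff_uptoD => //; apply: IH; do ?[exact: diff_uptoS|exact: Df|exact: Dg].
Qed.

Lemma smoothM U f g : open U ->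
  smooth_on U f -> smooth_on U g -> smooth_on U (fun x => f x * g x).
Proof. by move=> oU sf sg k; exact: diff_uptoM. Qed.

Lemma diff_uptoV k U f : open U -> (forall x, U x -> f x != 0) ->
  diff_upto k U f -> diff_upto k U (fun x => (f x)^-1).
Proof.
move=> oU f0; elim: k => [|k IH].
  by move=> cf x Ux; apply: cvgV; [exact: f0|exact: cf].
move=> sf; have [df Df] := sf; split=> [x Ux|v].
  by apply: differentiableV; [exact: df|exact: f0].
apply: (@eq_diff_upto _ _ _ _ _
  (fun x => -1 * (((f x)^-1 * (f x)^-1) * 'D_v f x))) => //.
  move=> x Ux; rewrite (@deriveV _ _ f) ?f0 //; last exact: diff_derivable (df x Ux).
  by rewrite mulN1r scaleNr /GRing.scale /= expr2 invfM.
have sV := IH (diff_uptoS sf).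
apply: diff_uptoM => //; first exact: diff_upto_cst.
by apply: diff_uptoM => //; [exact: diff_uptoM|exact: Df].
Qed.

Lemma smoothV U f : open U -> (forall x, U x -> f x != 0) ->
  smooth_on U f -> smooth_on U (fun x => (f x)^-1).
Proof. by move=> oU f0 sf k; exact: diff_uptoV. Qed.

Lemma derive_coord m n (F : V -> 'M[R]_(m, n)) x v i j :
  derivable F x v -> 'D_v (fun y => F y i j : R) x = 'D_v F x i j.
Proof. by move=> dF; rewrite derive_mx // mxE. Qed.

Lemma diff_upto_coord k U m n (F : V -> 'M[R]_(m, n)) i j : open U ->
  diff_upto k U F -> diff_upto k U (fun x => F x i j : R).
Proof.
move=> oU; elim: k F => [|k IH] F /=.
  move=> cF x Ux; apply: (@continuous_comp _ _ _ F (fun N => N i j)); first exact: cF.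
  exact: coord_continuous.
move=> [dF DF]; split=> [x Ux|v].
  apply: (@differentiable_comp _ _ _ _ F (fun N => N i j)); first exact: dF.
  exact: differentiable_coord.
apply: eq_diff_upto (IH _ (DF v)) => // x Ux.
by rewrite derive_coord //; exact: diff_derivable (dF x Ux).
Qed.

Lemma smooth_coord U m n (F : V -> 'M[R]_(m, n)) i j : open U ->
  smooth_on U F -> smooth_on U (fun x => F x i j : R).
Proof. by move=> oU sF k; exact: diff_upto_coord. Qed.

Lemma smooth_mx U m n (F : V -> 'M[R]_(m, n)) : open U ->
  (forall i j, smooth_on U (fun x => F x i j : R)) -> smooth_on U F.
Proof.
move=> oU sF k.
apply: (@eq_diff_upto _ _ _ _ _ (fun x => \sum_i \sum_j F x i j *: delta_mx i j)) => //.
  by move=> x _; rewrite -matrix_sum_delta.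
apply: diff_upto_sum => // i _; apply: diff_upto_sum => // j _.
by apply: diff_uptoZl => //; exact: sF.
Qed.

Lemma smooth_mulmx U m n p (F : V -> 'M[R]_(m, n)) (G : V -> 'M[R]_(n, p)) :
  open U -> smooth_on U F -> smooth_on U G -> smooth_on U (fun x => F x *m G x).
Proof.
move=> oU sF sG; apply: smooth_mx => // i j.
apply: (@eq_smooth _ _ _ _ (fun x => \sum_k F x i k * G x k j)) => //.
  by move=> x _; rewrite mxE.
by apply: smooth_sum => // k _; apply: smoothM => //; exact: smooth_coord.
Qed.

Lemma derive_comp_coord m (f : 'rV[R]_m -> R) (g : V -> 'rV[R]_m) x v :
  differentiable g x -> differentiable f (g x) ->
  'D_v (f \o g) x = \sum_j 'D_v g x 0 j * 'D_(delta_mx 0 j) f (g x).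
Proof.
move=> dg df; rewrite deriveE; last exact: differentiable_comp.
rewrite diff_comp // /= -(deriveE v dg) [in LHS](row_sum_delta ('D_v g x)) linear_sum /=.
by apply: eq_bigr => j _; rewrite linearZ /= (deriveE _ df).
Qed.

(** Induction through the chain rule: a directional derivative of the composite is a sum of products
    of a derivative of [g] and a partial derivative of [f] composed with [g], all of one order
    less. *)
Lemma diff_upto_comp k m U (U' : set 'rV[R]_m) (f : 'rV[R]_m -> R)
    (g : V -> 'rV[R]_m) : open U -> (forall x, U x -> U' (g x)) ->
  diff_upto k U' f -> diff_upto k U g -> diff_upto k U (f \o g).
Proof.
move=> oU gU; elim: k f => [|k IH] f.
  move=> cf cg x Ux; apply: continuous_comp; first exact: cg.
  by apply: cf; exact: gU.
move=> [df Df] sg; have [dg Dg] := sg; split=> [x Ux|v].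
  by apply: differentiable_comp; [exact: dg|apply: df; exact: gU].
apply: (@eq_diff_upto _ _ _ _ _
  (fun x => \sum_j 'D_v g x 0 j * ('D_(delta_mx 0 j) f \o g) x)) => //.
  move=> x Ux; rewrite derive_comp_coord //; first exact: dg.
  by apply: df; exact: gU.
apply: diff_upto_sum => // j _; apply: diff_uptoM => //.
  by apply: diff_upto_coord => //; exact: Dg.
by apply: IH (Df _) _; exact: diff_uptoS.
Qed.

Lemma smooth_comp m U (U' : set 'rV[R]_m) (f : 'rV[R]_m -> R)
    (g : V -> 'rV[R]_m) : open U -> (forall x, U x -> U' (g x)) ->
  smooth_on U' f -> smooth_on U g -> smooth_on U (f \o g).
Proof. by move=> oU gU sf sg k; exact: diff_upto_comp (sf k) (sg k). Qed.

End SmoothScalars.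

(** * Jacobian matrices *)

Section Jacobians.
Variable R : realType.

Lemma smooth_comp_mx (V : normedModType R) m n p (U : set V) (U' : set 'rV[R]_m)
    (f : 'rV[R]_m -> 'M[R]_(n, p)) (g : V -> 'rV[R]_m) :
  open U -> open U' -> (forall x, U x -> U' (g x)) ->
  smooth_on U' f -> smooth_on U g -> smooth_on U (f \o g).
Proof.
move=> oU oU' gU sf sg; apply: smooth_mx => // i j.
exact: (smooth_comp oU gU (smooth_coord i j oU' sf) sg).
Qed.

Lemma jacobianE m n (f : 'rV[R]_m -> 'rV[R]_n) x i j : differentiable f x ->
  'J f x i j = 'D_(delta_mx 0 i) f x 0 j.
Proof. by move=> df; rewrite deriveEjacobian // -rowE [RHS]mxE. Qed.

Lemma smooth_jacobian m n (U : set 'rV[R]_m) (f : 'rV[R]_m -> 'rV[R]_n) : open U ->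
  smooth_on U f -> smooth_on U (jacobian f).
Proof.
move=> oU sf; apply: smooth_mx => // i j.
apply: (@eq_smooth _ _ _ _ (fun x => 'D_(delta_mx 0 i) f x 0 j)) => //.
  by move=> x Ux; rewrite jacobianE //; exact: smooth_differentiable sf Ux.
by apply: smooth_coord => //; exact: smooth_derive.
Qed.

Lemma jacobian_comp m n p (f : 'rV[R]_m -> 'rV[R]_n) (g : 'rV[R]_n -> 'rV[R]_p) x :
  differentiable f x -> differentiable g (f x) ->
  'J (g \o f) x = 'J f x *m 'J g (f x).
Proof.
move=> df dg; apply/row_matrixP => i; rewrite row_mul (rowE i (jacobian f x)) (rowE i (jacobian _ x)).
rewrite -(deriveEjacobian _ df) -(deriveEjacobian _ dg).
rewrite -(deriveEjacobian _ (differentiable_comp df dg)).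
rewrite (deriveE _ (differentiable_comp df dg)) (deriveE _ df) (deriveE _ dg).
by rewrite diff_comp.
Qed.

Lemma near_eq_jacobian m n (f g : 'rV[R]_m -> 'rV[R]_n) x :
  (\near x, f x = g x) -> differentiable f x -> 'J f x = 'J g x.
Proof.
move=> fg df; have dg := near_eq_differentiable fg df.
apply/matrixP => i j.
apply: etrans (jacobianE i j df) (etrans _ (esym (jacobianE i j dg))).
by rewrite (near_eq_derive _ fg).
Qed.

Lemma jacobian_id m x : 'J (@id 'rV[R]_m) x = 1%:M.
Proof.
apply/matrixP => i j; apply: etrans (jacobianE i j (@ex_diff _ _ _ _ _ _ _ (is_diff_id x))) _.
by rewrite derive_id !mxE eqxx eq_sym.
Qed.

End Jacobians.

(** * Symmetry of second derivatives *)

Section Schwarz.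
Variables (R : realType) (V : normedModType R).

Lemma is_derive_line (f : V -> R) (y v : V) (s : R) :
  differentiable f (y + s *: v) ->
  is_derive s 1 (fun r => f (y + r *: v)) ('D_v f (y + s *: v)).
Proof.
move=> df; have dv : derivable f (y + s *: v) v by exact: diff_derivable.
have E : (fun h : R => h^-1 *: (((fun r => f (y + r *: v)) \o shift s) (h *: 1)
                          - f (y + s *: v)))
  = (fun h => h^-1 *: ((f \o shift (y + s *: v)) (h *: v) - f (y + s *: v))).
  apply/funext => h /=; congr (_ *: (f _ - _)).
  by rewrite [h *: 1]mulr1 scalerDl addrCA.
by split; rewrite /derivable /derive /= E.
Qed.

(* The second difference of f, divided by t^2, tends to D_w D_v f; being      *)
(* symmetric in v and w, it also tends to D_v D_w f.                          *)
Let second_diff (f : V -> R) (x v w : V) (t : R) :=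
  f (x + t *: v + t *: w) - f (x + t *: v) - f (x + t *: w) + f x.

(** The mean value theorem on [0, t] is applied to the difference of [f] along two parallel segments
    in direction [v], a distance [t *: w] apart. Its derivative is a difference of two values of
    ['D_v f], each compared with the first-order expansion of ['D_v f] at [x]. *)
Let second_diff_derive (U : set V) (f : V -> R) (x v w : V) (e : R) :
  open U -> diff_upto 2 U f -> U x -> 0 < e ->
  exists2 d : R, 0 < d & forall t, 0 < t < d ->
    `|second_diff f x v w t - t ^+ 2 * 'D_w ('D_v f) x|
      <= e * t ^+ 2 * (2 * `|v| + 2 * `|w|).
Proof.
move=> oU sf Ux e0; have [df Df] := sf; have [/(_ x Ux) dDv _] := Df v.
have := diff_locally dDv => /eqaddoP /(_ e e0) /nbhs_ballP[d1 /= d10 hd1].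
have /nbhs_ballP[d2 /= d20 hd2] := open_nbhs_nbhs (conj oU Ux).
set C := 2 * `|v| + 2 * `|w|; have C0 : 0 <= C by rewrite addr_ge0 // mulr_ge0.
(* All points met below lie within t (C + 1) of [x], hence in both balls for such t. *)
exists (Num.min d1 d2 / (C + 1)).
  by rewrite divr_gt0 ?ltr_wpDl // lt_min d10 d20.
move=> t /andP[t0]; rewrite ltr_pdivlMr ?ltr_wpDl // lt_min => /andP[td1 td2].
(* The boolean switches the displacement [t *: w] on or off, so that both segments share one set of
   estimates. *)
have small s (b : bool) : 0 <= s <= t ->
    `|s *: v + (b%:R * t) *: w| <= t * (`|v| + `|w|).
  move=> /andP[s0 st]; rewrite (le_trans (ler_normD _ _)) // mulrDr !normrZ.
  apply: lerD; apply: ler_wpM2r => //; first by rewrite ger0_norm.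
  rewrite ?normrM (gtr0_norm t0).
  by case: b; rewrite /= ?normr1 ?normr0 ?mul1r ?mul0r // ltW.
have smallC s (b : bool) : 0 <= s <= t ->
    `|s *: v + (b%:R * t) *: w| < t * (C + 1).
  move=> /small-/(_ b)/le_lt_trans; apply; rewrite ltr_pM2l // /C.
  rewrite (@le_lt_trans _ _ C) ?ltrDl // /C -mulrDr ler_peMl ?addr_ge0 //.
  by rewrite ler1n.
have inU s (b : bool) : 0 <= s <= t -> U (x + (b%:R * t) *: w + s *: v).
  move=> /smallC-/(_ b) h; apply: hd2; rewrite -ball_normE /=.
  rewrite -addrA opprD addrA subrr add0r normrN addrC.
  exact: lt_trans h td2.
have appr s (b : bool) : 0 <= s <= t ->
    `|'D_v f (x + (b%:R * t) *: w + s *: v) - ('D_v f x +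
      'd ('D_v f) x (s *: v + (b%:R * t) *: w))| <= e * (t * (`|v| + `|w|)).
  move=> hs; have h := smallC s b hs.
  have := hd1 (s *: v + (b%:R * t) *: w); rewrite -ball_normE /= sub0r normrN.
  move=> /(_ (lt_trans h td1)); rewrite !fctE /= => H.
  rewrite -addrA [(_ *: w) + _]addrC [x + _]addrC (le_trans H) //.
  by rewrite ler_pM2l // small.
pose k (b : bool) s := f (x + (b%:R * t) *: w + s *: v).
have dk b s : 0 <= s <= t ->
    is_derive s 1 (k b) ('D_v f (x + (b%:R * t) *: w + s *: v)).
  by move=> /(inU s b) Uy; apply: is_derive_line; exact: df.
have dg s : 0 <= s <= t -> is_derive s 1 (fun r => k true r - k false r)
    ('D_v f (x + (true%:R * t) *: w + s *: v) -
     'D_v f (x + (false%:R * t) *: w + s *: v)).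
  by move=> hs; apply: is_deriveB; exact: dk.
have [||s] := @MVT R (fun r => k true r - k false r)
    (fun s => 'D_v f (x + (true%:R * t) *: w + s *: v) -
              'D_v f (x + (false%:R * t) *: w + s *: v)) 0 t t0.
- move=> s; rewrite in_itv /= => /andP[s0 st]; apply: dg.
  by rewrite !ltW.
- apply: derivable_within_continuous => s; rewrite in_itv /= => hs.
  by have [] := dg s hs.
rewrite in_itv /= => /andP[s0 st]; rewrite subr0 /k /= mulr1n mulr0n !scale0r !addr0 mul1r mul0r scale0r addr0.
have hs : 0 <= s <= t by rewrite !ltW.
move: (appr s true hs) (appr s false hs); rewrite /= mulr1n mulr0n mul1r mul0r scale0r !addr0.
have lind : 'd ('D_v f) x (s *: v + t *: w) = 'd ('D_v f) x (s *: v) + t * 'D_w ('D_v f) x.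
  by rewrite linearD [X in _ + X]linearZ /= -(deriveE w dDv).
rewrite lind; set p := 'D_v f (x + t *: w + _); set q := 'D_v f (x + s *: v).
set L := 'd _ _ _; set D := 'D_w _ x; set c := 'D_v f x => hp hq eqk.
have -> : second_diff f x v w t = (p - q) * t.
  by rewrite -eqk /second_diff [x + t *: w + _]addrAC; ring.
have -> : (p - q) * t - t ^+ 2 * D = t * ((p - (c + (L + t * D))) - (q - (c + L))) by ring.
have -> : e * t ^+ 2 * C = t * (e * (t * (`|v| + `|w|)) + e * (t * (`|v| + `|w|))).
  by rewrite /C; ring.
rewrite normrM gtr0_norm // ler_pM2l // (le_trans (ler_normB _ _)) //.
exact: lerD.
Qed.

Lemma schwarz (U : set V) (f : V -> R) (x v w : V) :
  open U -> diff_upto 2 U f -> U x -> 'D_w ('D_v f) x = 'D_v ('D_w f) x.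
Proof.
move=> oU sf Ux; apply/eqP; rewrite -subr_eq0 -normr_le0; apply/ler_addgt0Pr => e e0.
rewrite add0r; set C := 2 * `|v| + 2 * `|w|.
have C0 : 0 <= C by rewrite addr_ge0 // mulr_ge0.
have e'0 : 0 < e / (2 * C + 1) by rewrite divr_gt0 // ltr_wpDl // mulr_ge0.
have [d1 d10 h1] := second_diff_derive v w oU sf Ux e'0.
have [d2 d20 h2] := second_diff_derive w v oU sf Ux e'0.
set e' := e / _ in e'0 h1 h2.
have d0 : 0 < Num.min d1 d2 by rewrite lt_min d10 d20.
set t := Num.min d1 d2 / 2; have t0 : 0 < t by rewrite divr_gt0.
have : t < Num.min d1 d2 by rewrite /t ltr_pdivrMr // ltr_pMr // ltr1n.
rewrite lt_min => /andP[td1 td2].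
have := h1 t; rewrite t0 td1 => /(_ isT); have := h2 t; rewrite t0 td2 => /(_ isT).
have -> : second_diff f x w v t = second_diff f x v w t.
  by rewrite /second_diff [x + t *: w + _]addrAC; ring.
rewrite [2 * `|w| + _]addrC -/C; set Dvw := 'D_v _ x; set Dwv := 'D_w _ x => H2 H1.
have : t ^+ 2 * `|Dwv - Dvw| <= t ^+ 2 * e.
  rewrite -{1}(@ger0_norm _ (t ^+ 2)) ?sqr_ge0 // -normrM.
  have -> : t ^+ 2 * (Dwv - Dvw) = (second_diff f x v w t - t ^+ 2 * Dvw) -
    (second_diff f x v w t - t ^+ 2 * Dwv) by ring.
  rewrite (le_trans (ler_normB _ _)) // (le_trans (lerD H2 H1)) //.
  have -> : e' * t ^+ 2 * C + e' * t ^+ 2 * C = t ^+ 2 * (e' * (2 * C)) by ring.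
  rewrite ler_pM2l ?exprn_gt0 // /e' mulrAC ler_pdivrMr ?ltr_wpDl ?mulr_ge0 //.
  by rewrite ler_pM2l // lerDl.
by rewrite ler_pM2l // exprn_gt0.
Qed.

End Schwarz.

(** * Multilinear algebra *)

Section Multilinear.
Variables (R : realType) (n : nat).

Lemma eq_row'P m (A B : 'M[R]_(m, n)) i :
  row' i A = row' i B <-> forall j, j != i -> row j A = row j B.
Proof.
split=> [E j ji|E].
  case: (unliftP i j) ji => [l ->|->]; last by rewrite eqxx.
  by move=> _; apply/rowP => c; have /matrixP/(_ l c) := E; rewrite !mxE.
apply/matrixP => l c; have li : lift i l != i by rewrite eq_sym neq_lift.
by have /rowP/(_ c) := E _ li; rewrite !mxE.
Qed.

Lemma multilinear_row k (f : 'M[R]_(k, n) -> R) (A B C : 'M[R]_(k, n)) i b c :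
  multilinear f -> row i A = b *: row i B + c *: row i C ->
  (forall j, j != i -> row j B = row j A) ->
  (forall j, j != i -> row j C = row j A) -> f A = b * f B + c * f C.
Proof. by move=> mf Ei EB EC; apply: (mf _ _ _ i) => //; apply/eq_row'P. Qed.

Lemma multilinear_row0 k (f : 'M[R]_(k, n) -> R) (A : 'M[R]_(k, n)) i :
  multilinear f -> row i A = 0 -> f A = 0.
Proof.
move=> mf Ai; rewrite (@multilinear_row _ f A A A i 0 0) ?mul0r ?addr0 //.
by rewrite Ai !scaler0 addr0.
Qed.

Lemma multilinear_sum k (f : 'M[R]_(k, n) -> R) I (r : seq I) (A : 'M[R]_(k, n))
    (F : I -> 'M[R]_(k, n)) (c : I -> R) i :
  multilinear f -> row i A = \sum_(l <- r) c l *: row i (F l) ->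
  (forall l j, j != i -> row j (F l) = row j A) ->
  f A = \sum_(l <- r) c l * f (F l).
Proof.
move=> mf; elim: r A => [|l r IH] A.
  by rewrite !big_nil => /(multilinear_row0 mf).
rewrite !big_cons => Ai EF.
pose A' : 'M[R]_(k, n) :=
  \matrix_j (if j == i then \sum_(l <- r) c l *: row i (F l) else row j A).
have EA' j : j != i -> row j A' = row j A by move=> ji; rewrite rowK (negPf ji).
rewrite (@multilinear_row _ f A (F l) A' i (c l) 1) // ?mul1r.
- congr (_ + _); apply: IH; first by rewrite rowK eqxx.
  by move=> l' j ji; rewrite EF // EA'.
- by rewrite rowK eqxx scale1r.
- by move=> j; exact: EF.
Qed.

Lemma multilinear_tail k (f : 'M[R]_(k.+1, n) -> R) (u : 'rV[R]_n) :
  multilinear f ->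
  multilinear (fun B : 'M[R]_(k, n) => f (col_mx u B : 'M[R]_(1 + k, n))).
Proof.
move=> mf A B C i b c Ei /eq_row'P EB /eq_row'P EC.
apply: (@multilinear_row _ f (col_mx u A : 'M[R]_(1 + k, n))
  (col_mx u B : 'M[R]_(1 + k, n)) (col_mx u C : 'M[R]_(1 + k, n)) (rshift 1 i)) => //.
- by rewrite !(@rowKd _ 1).
- move=> j; case: (@split_ordP 1 k j) => l -> ji; first by rewrite !(@rowKu _ 1).
  by rewrite !(@rowKd _ 1) EB //; apply: contra ji => /eqP->.
- move=> j; case: (@split_ordP 1 k j) => l -> ji; first by rewrite !(@rowKu _ 1).
  by rewrite !(@rowKd _ 1) EC //; apply: contra ji => /eqP->.
Qed.

Definition ffcons (T : Type) k (a : T) (s : {ffun 'I_k -> T}) : {ffun 'I_k.+1 -> T} :=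
  [ffun i => oapp s a (unlift ord0 i)].

Lemma ffcons0 (T : Type) k (a : T) (s : {ffun 'I_k -> T}) : ffcons a s ord0 = a.
Proof. by rewrite ffunE unlift_none. Qed.

Lemma ffconsS (T : Type) k (a : T) (s : {ffun 'I_k -> T}) i :
  ffcons a s (lift ord0 i) = s i.
Proof. by rewrite ffunE liftK. Qed.

Lemma big_ffcons (m k : nat) (F : {ffun 'I_k.+1 -> 'I_m} -> R) :
  \sum_s F s = \sum_a \sum_s F (ffcons a s).
Proof.
rewrite pair_big /= (reindex (fun p => ffcons p.1 p.2)) //=.
exists (fun s => (s ord0, [ffun i => s (lift ord0 i)])) => [[a s]|s] _ /=.
  by rewrite ffcons0; congr pair; apply/ffunP => i; rewrite ffunE ffconsS.
apply/ffunP => i; case: (unliftP ord0 i) => [j ->|->].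
  by rewrite ffconsS ffunE.
by rewrite ffcons0.
Qed.

Lemma rowsub_ffcons m k (T : 'M[R]_(m, n)) a (s : {ffun 'I_k -> 'I_m}) :
  rowsub (ffcons a s) T = col_mx (row a T) (rowsub s T) :> 'M[R]_(1 + k, n).
Proof.
apply/row_matrixP => i; rewrite row_rowsub; case: (@split_ordP 1 k i) => j ->.
  rewrite rowKu ord1 (_ : lshift k 0 = ord0) ?ffcons0; last exact: val_inj.
  by apply/rowP => c; rewrite !mxE.
by rewrite rowKd row_rowsub (_ : rshift 1 j = lift ord0 j) ?ffconsS //; exact: val_inj.
Qed.

(** Each slot is expanded in turn along the rows of [T]. This is the one bridge between multilinear
    functions of matrices and their components. *)
Lemma multilinear_expand k m (f : 'M[R]_(k, n) -> R) (A : 'M[R]_(k, m))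
    (T : 'M[R]_(m, n)) : multilinear f ->
  f (A *m T) = \sum_(s : {ffun 'I_k -> 'I_m}) (\prod_i A i (s i)) * f (rowsub s T).
Proof.
elim: k f A => [|k IH] f A mf.
  pose e : {ffun 'I_0 -> 'I_m} := ffun0 (card_ord 0).
  rewrite (big_pred1 e) => [|s]; last by apply/esym/eqP/ffunP => -[].
  by rewrite big_ord0 mul1r; congr f; rewrite [LHS]flatmx0 [RHS]flatmx0.
rewrite big_ffcons.
have EA : A *m T = col_mx (row ord0 A *m T) (row' ord0 A *m T) :> 'M[R]_(1 + k, n).
  apply/row_matrixP => i; case: (@split_ordP 1 k i) => j ->.
    by rewrite rowKu !row_mul ord1; congr (_ *m T); apply/rowP => c; rewrite !mxE; congr (A _ c); exact: val_inj.
  by rewrite rowKd !row_mul; congr (_ *m T); apply/rowP => c; rewrite !mxE; congr (A _ c); exact: val_inj.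
rewrite EA (@multilinear_sum _ f _ (index_enum 'I_m) _
  (fun a => col_mx (row a T) (row' ord0 A *m T) : 'M[R]_(1 + k, n)) (A ord0) (lshift k (ord0 : 'I_1))) //.
- apply: eq_bigr => a _; rewrite (IH _ _ (multilinear_tail (row a T) mf)) mulr_sumr.
  apply: eq_bigr => s _; rewrite rowsub_ffcons mulrA big_ord_recl ffcons0; congr (_ * _ * _).
  by apply: eq_bigr => i _; rewrite ffconsS !mxE.
- rewrite (@rowKu _ 1); under eq_bigr do rewrite (@rowKu _ 1).
  apply/rowP => c; rewrite !mxE summxE; apply: eq_bigr => a _.
  by rewrite !mxE.
- move=> a j; case: (@split_ordP 1 k j) => l -> jl; last by rewrite !(@rowKd _ 1).
  by move: jl; rewrite !ord1 eqxx.
Qed.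

(** Put u + v in both slots and expand. The vanishing hypothesis concerns the pair [i], [j] alone
    because [alternating_adjacent] applies the lemma when only neighbouring equal rows are known to
    give zero. *)
Lemma multilinear_xrow k (f : 'M[R]_(k, n) -> R) (A : 'M[R]_(k, n)) i j :
  multilinear f -> (forall B, row i B = row j B -> f B = 0) -> i != j ->
  f (xrow i j A) = - f A.
Proof.
move=> mf af ij.
pose G (u v : 'rV[R]_n) : 'M[R]_(k, n) :=
  \matrix_l (if l == i then u else if l == j then v else row l A).
have Gi u v : row i (G u v) = u by rewrite rowK eqxx.
have Gj u v : row j (G u v) = v by rewrite rowK eq_sym (negPf ij) eqxx.
have Gl u v l : l != i -> l != j -> row l (G u v) = row l A.
  by move=> /negPf li /negPf lj; rewrite rowK li lj.
have GD1 u u' v : f (G (u + u') v) = f (G u v) + f (G u' v).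
  rewrite (@multilinear_row _ f _ (G u v) (G u' v) i 1 1) ?mul1r ?Gi ?scale1r //.
    by move=> l li; case: (eqVneq l j) => [->|lj]; rewrite ?Gj ?Gl.
  by move=> l li; case: (eqVneq l j) => [->|lj]; rewrite ?Gj ?Gl.
have GD2 u v v' : f (G u (v + v')) = f (G u v) + f (G u v').
  rewrite (@multilinear_row _ f _ (G u v) (G u v') j 1 1) ?mul1r ?Gj ?scale1r //.
    by move=> l lj; case: (eqVneq l i) => [->|li]; rewrite ?Gi ?Gl.
  by move=> l lj; case: (eqVneq l i) => [->|li]; rewrite ?Gi ?Gl.
have Guu u : f (G u u) = 0 by apply: af; rewrite Gi Gj.
have -> : xrow i j A = G (row j A) (row i A).
  apply/row_matrixP => l; rewrite rowK; apply/rowP => c; rewrite !mxE.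
  by case: tpermP => [->|->|/eqP/negPf-> /eqP/negPf->]; rewrite ?eqxx ?mxE // eq_sym (negPf ij) mxE.
have -> : A = G (row i A) (row j A).
  apply/row_matrixP => l; case: (eqVneq l i) => [->|li]; first by rewrite Gi.
  by case: (eqVneq l j) => [->|lj]; rewrite ?Gj ?Gl.
rewrite !Gi !Gj; set u := row i _; set v := row j _.
have := Guu (u + v); rewrite GD1 !GD2 !Guu add0r addr0 addrC => /eqP.
by rewrite addr_eq0 => /eqP.
Qed.

Lemma alternating_tperm k (f : 'M[R]_(k, n) -> R) (A : 'M[R]_(k, n)) i j :
  multilinear f -> Defs.alternating f -> i != j -> f (xrow i j A) = - f A.
Proof. by move=> mf af ij; apply: multilinear_xrow => // B; exact: af. Qed.

Lemma alternating_perm k (f : 'M[R]_(k, n) -> R) (A : 'M[R]_(k, n)) (s : 'S_k) :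
  multilinear f -> Defs.alternating f -> f (row_perm s A) = (-1) ^+ s * f A.
Proof.
move=> mf af; have [ts -> tsP] := prod_tpermP s.
elim: ts tsP => [|[i j] ts IH] /=.
  by rewrite big_nil odd_perm1 mul1r row_perm1.
move=> /andP[ij tsP]; rewrite big_cons /= odd_mul_tperm ij row_permM.
by rewrite (alternating_tperm _ mf af) // IH // signrN mulNr.
Qed.

Lemma alternating_rowsub k m (f : 'M[R]_(k, n) -> R) (T : 'M[R]_(m, n)) (s : 'I_k -> 'I_m) :
  Defs.alternating f -> ~ injective s -> f (rowsub s T) = 0.
Proof.
move=> af ns; have [i [j [ij sij]]] : exists i j, i != j /\ s i = s j.
  apply: contra_notP ns => ns i j sij; apply/eqP/negPn/negP => ij.
  by apply: ns; exists i, j.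
by apply: (af _ i j ij); rewrite !row_rowsub sij.
Qed.

(** Leibniz formula: after expansion the noninjective index functions drop out and the others are
    permutations, contributing signs. *)
Lemma alternating_det k (f : 'M[R]_(k, n) -> R) (X : 'M[R]_k) (T : 'M[R]_(k, n)) :
  multilinear f -> Defs.alternating f -> f (X *m T) = \det X * f T.
Proof.
move=> mf af; rewrite multilinear_expand //.
rewrite (bigID (fun s : {ffun 'I_k -> 'I_k} => injectiveb s)) /= [X in _ + X]big1 ?addr0; last first.
  by move=> s /injectiveP ns; rewrite alternating_rowsub ?mulr0.
rewrite /determinant mulr_suml (reindex (@pval _)) /=; last first.
  exists (fun s => insubd (1%g : 'S_k) s) => [s _|s si].
    by apply: val_inj; rewrite val_insubd (valP s).
  exact: (insubdK _ si).
rewrite (eq_bigl xpredT) => [|s]; last exact: (valP s).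
apply: eq_bigr => s _; have -> : rowsub (pval s) T = row_perm s T.
  by apply/row_matrixP => i; rewrite row_rowsub; apply/rowP => c; rewrite !mxE pvalE.
rewrite alternating_perm // mulrCA mulrA; congr (_ * _ * _).
by apply: eq_bigr => i _; rewrite pvalE.
Qed.

End Multilinear.

(** * Contractions computed in dual bases *)

Section Contraction.
Variables (R : realType) (n : nat).

Lemma multilinear_head k l (f : 'M[R]_(k + l, n) -> R) (A : 'M[R]_(l, n)) :
  multilinear f -> multilinear (fun B : 'M[R]_(k, n) => f (col_mx B A)).
Proof.
move=> mf B C D i b c Ei /eq_row'P EC /eq_row'P ED.
apply: (@multilinear_row _ _ _ f _ _ _ (lshift l i)) => //.
- by rewrite !rowKu.
- move=> j; case: (split_ordP j) => r -> jr; last by rewrite !rowKd.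
  by rewrite !rowKu EC //; apply: contra jr => /eqP->.
- move=> j; case: (split_ordP j) => r -> jr; last by rewrite !rowKd.
  by rewrite !rowKu ED //; apply: contra jr => /eqP->.
Qed.

Lemma alternating_head k l (f : 'M[R]_(k + l, n) -> R) (A : 'M[R]_(l, n)) :
  Defs.alternating f -> Defs.alternating (fun B : 'M[R]_(k, n) => f (col_mx B A)).
Proof.
move=> af B i j ij Bij; apply: (af _ (lshift l i) (lshift l j)).
  by apply: contra ij => /eqP h; apply/eqP; exact: (@lshift_inj k l).
by rewrite !rowKu.
Qed.

Let rv k (b : {ffun 'I_k -> 'I_n}) : {ffun 'I_k -> 'I_n} := [ffun i => b (rev_ord i)].

Let rvK k : involutive (@rv k).
Proof. by move=> b; apply/ffunP => i; rewrite !ffunE rev_ordK. Qed.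

Let contract_expand k l m (Q : 'M[R]_(k, n) -> R) (f : 'M[R]_(k + l, n) -> R)
    (A : 'M[R]_(l, n)) (U T : 'M[R]_(m, n)) :
  multilinear Q -> multilinear f ->
  \sum_(s : {ffun 'I_k -> 'I_m})
     Q (rowsub s U) * f (col_mx (rowsub (fun i => s (rev_ord i)) T) A) =
  \sum_(a : {ffun 'I_k -> 'I_n}) \sum_(b : {ffun 'I_k -> 'I_n})
     (\prod_i (U^T *m T) (a i) (b i)) *
     (Q (rowsub a 1%:M) * f (col_mx (rowsub (rv b) 1%:M) A)).
Proof.
move=> mQ mf.
transitivity (\sum_(s : {ffun 'I_k -> 'I_m}) \sum_(a : {ffun 'I_k -> 'I_n})
    \sum_(b : {ffun 'I_k -> 'I_n})
    (\prod_i (U (s i) (a i) * T (s i) (b i))) *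
    (Q (rowsub a 1%:M) * f (col_mx (rowsub (rv b) 1%:M) A))).
  apply: eq_bigr => s _.
  have -> : Q (rowsub s U) =
      \sum_(a : {ffun 'I_k -> 'I_n}) (\prod_i U (s i) (a i)) * Q (rowsub a 1%:M).
    rewrite -[rowsub s U]mulmx1 multilinear_expand //; apply: eq_bigr => a _.
    by congr (_ * _); apply: eq_bigr => i _; rewrite mxE.
  have -> : f (col_mx (rowsub (fun i => s (rev_ord i)) T) A) =
      \sum_(b : {ffun 'I_k -> 'I_n}) (\prod_i T (s i) (b i)) *
        f (col_mx (rowsub (rv b) 1%:M) A).
    rewrite -[rowsub _ T]mulmx1.
    rewrite (multilinear_expand _ _ (multilinear_head A mf)) (reindex_inj (inv_inj (@rvK k))).
    apply: eq_bigr => b _; congr (_ * _); rewrite (reindex_inj rev_ord_inj) /=.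
    by apply: eq_bigr => i _; rewrite mxE !ffunE !rev_ordK.
  rewrite mulr_suml; apply: eq_bigr => a _; rewrite mulr_sumr; apply: eq_bigr => b _.
  by rewrite big_split /=; ring.
rewrite exchange_big; apply: eq_bigr => a _; rewrite exchange_big.
apply: eq_bigr => b _; rewrite -mulr_suml; congr (_ * _).
rewrite -(bigA_distr_bigA (fun i j => U j (a i) * T j (b i))).
apply: eq_bigr => i _; rewrite mxE.
by apply: eq_bigr => j _; rewrite mxE.
Qed.

(* The sum depends on U and T only through U^T T. *)
Lemma contract_transfer k l m m' (Q : 'M[R]_(k, n) -> R) (f : 'M[R]_(k + l, n) -> R)
    (A : 'M[R]_(l, n)) (U T : 'M[R]_(m, n)) (U' T' : 'M[R]_(m', n)) :
  multilinear Q -> multilinear f -> U^T *m T = U'^T *m T' ->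
  \sum_(s : {ffun 'I_k -> 'I_m})
     Q (rowsub s U) * f (col_mx (rowsub (fun i => s (rev_ord i)) T) A) =
  \sum_(s : {ffun 'I_k -> 'I_m'})
     Q (rowsub s U') * f (col_mx (rowsub (fun i => s (rev_ord i)) T') A).
Proof. by move=> mQ mf UT; rewrite !contract_expand // UT. Qed.

Lemma contract_basis k l m (Q : 'M[R]_(k, n) -> R) (f : 'M[R]_(k + l, n) -> R)
    (A : 'M[R]_(l, n)) (U T : 'M[R]_(m, n)) :
  multilinear Q -> multilinear f -> U^T *m T = 1%:M ->
  Defs.contract Q f A = (k`!%:R)^-1 * \sum_(s : {ffun 'I_k -> 'I_m})
     Q (rowsub s U) * f (col_mx (rowsub (fun i => s (rev_ord i)) T) A).
Proof.
move=> mQ mf UT; congr (_ * _); apply: contract_transfer => //.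
by rewrite UT trmx1 mul1mx.
Qed.

(** Noninjective index functions contribute nothing, so by hypothesis only the k! rearrangements of
    [t] remain. They contribute equally: a permutation acts on [Q], its conjugate by the reversal
    acts on [f], and the two signs cancel. Thus k! cancels the normalisation. *)
Lemma contract_single k l m (Q : 'M[R]_(k, n) -> R) (f : 'M[R]_(k + l, n) -> R)
    (A : 'M[R]_(l, n)) (U T : 'M[R]_(m, n)) (t : 'I_k -> 'I_m) :
  multilinear Q -> multilinear f -> Defs.alternating Q -> Defs.alternating f ->
  U^T *m T = 1%:M -> injective t ->
  (forall s : {ffun 'I_k -> 'I_m}, (exists i, s i \notin codom t) ->
     Q (rowsub s U) * f (col_mx (rowsub (fun i => s (rev_ord i)) T) A) = 0) ->
  Defs.contract Q f A = Q (rowsub t U) * f (col_mx (rowsub (fun i => t (rev_ord i)) T) A).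
Proof.
move=> mQ mf aQ af UT tI F0; rewrite (contract_basis _ mQ mf UT).
pose F (s : {ffun 'I_k -> 'I_m}) :=
  Q (rowsub s U) * f (col_mx (rowsub (fun i => s (rev_ord i)) T) A).
pose g (s : 'S_k) : {ffun 'I_k -> 'I_m} := [ffun i => t (s i)].
have gI : injective g.
  by move=> s s' /ffunP E; apply/permP => i; apply: tI; have := E i; rewrite !ffunE.
rewrite -[X in _ * X]/(\sum_s F s) (bigID (mem (imset g (mem (predT : pred 'S_k))))) /=.
rewrite [X in _ + X]big1 ?addr0 => [|s /negP sg]; last first.
  have [sI|] := pselect (injective s); last first.
    by move=> /(alternating_rowsub U aQ) Q0; rewrite /F Q0 mul0r.
  apply: F0; apply: contra_notP sg => sc; apply/imsetP.
  have h i : s i \in codom t by apply: contra_notT sc => h; exists i.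
  have vI : injective (fun i => iinv (h i)).
    by move=> i j ij; apply: sI; rewrite -(f_iinv (h i)) -(f_iinv (h j)) ij.
  by exists (perm vI) => //; apply/ffunP => i; rewrite ffunE permE f_iinv.
rewrite big_imset => [|s s' _ _]; last exact: gI.
have revE s : (fun i => g s (rev_ord i)) =1 (fun i => t (rev_ord ((perm (@rev_ord_inj k) * s * perm (@rev_ord_inj k))%g i))).
  by move=> i; rewrite ffunE !permM !permE rev_ordK.
rewrite (eq_bigr (fun=> Q (rowsub t U) * f (col_mx (rowsub (fun i => t (rev_ord i)) T) A))).
  by rewrite sumr_const card_Sn mulrnAr -mulrnAl -[X in X * _]mulr_natr mulVf ?mul1r // pnatr_eq0 -lt0n fact_gt0.
move=> s _; rewrite /F.
have -> : rowsub (g s) U = row_perm s (rowsub t U).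
  by apply/matrixP => i j; rewrite !mxE ffunE.
rewrite (eq_rowsub _ (revE s)); set p := (_ * s * _)%g.
have -> : rowsub (fun i => t (rev_ord (p i))) T = row_perm p (rowsub (fun i => t (rev_ord i)) T).
  by apply/matrixP => i j; rewrite !mxE.
rewrite (alternating_perm _ s mQ aQ).
rewrite (alternating_perm _ p (multilinear_head A mf) (alternating_head A af)).
rewrite /p !odd_permM addbAC addbb addFb.
by rewrite mulrACA -signr_addb addbb mul1r.
Qed.

End Contraction.

(** * Matrices given by rows, small symmetric groups and bidegree parts *)

Section Rows.
Variables (R : realType) (n : nat).

Definition mxrows {k} (s : seq 'rV[R]_n) : 'M[R]_(k, n) := \matrix_(i < k) s`_i.

Lemma row_mxrows k (s : seq 'rV[R]_n) (i : 'I_k) : row i (mxrows s) = s`_i.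
Proof. exact: rowK. Qed.

Definition o2 i : 'I_2 := inord i.
Definition o3 i : 'I_3 := inord i.

Lemma mxrows2E (A : 'M[R]_(2, n)) : A = mxrows [:: row (o2 0) A; row (o2 1) A].
Proof.
apply/row_matrixP => -[[|[|//]] hi]; rewrite row_mxrows /=; congr row;
  by apply: val_inj; rewrite /= inordK.
Qed.

Lemma mxrows3E (A : 'M[R]_(3, n)) :
  A = mxrows [:: row (o3 0) A; row (o3 1) A; row (o3 2) A].
Proof.
apply/row_matrixP => -[[|[|[|//]]] hi]; rewrite row_mxrows /=; congr row;
  by apply: val_inj; rewrite /= inordK.
Qed.

Lemma o2P (P : 'I_2 -> Prop) : P (o2 0) -> P (o2 1) -> forall i, P i.
Proof.
move=> P0 P1 [[|[|//]] hi].
  by rewrite (_ : Ordinal hi = o2 0) //; apply: val_inj; rewrite /= inordK.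
by rewrite (_ : Ordinal hi = o2 1) //; apply: val_inj; rewrite /= inordK.
Qed.

Lemma o3P (P : 'I_3 -> Prop) : P (o3 0) -> P (o3 1) -> P (o3 2) -> forall i, P i.
Proof.
move=> P0 P1 P2 [[|[|[|//]]] hi].
- by rewrite (_ : Ordinal hi = o3 0) //; apply: val_inj; rewrite /= inordK.
- by rewrite (_ : Ordinal hi = o3 1) //; apply: val_inj; rewrite /= inordK.
- by rewrite (_ : Ordinal hi = o3 2) //; apply: val_inj; rewrite /= inordK.
Qed.

Lemma part0 (h v : 'M[R]_n) k (f : 'M[R]_(k, n) -> R) A : part h v 0 f A = f (A *m v).
Proof.
rewrite /part (big_pred1 finset.set0) => [|S]; last by rewrite cards_eq0.
by congr f; apply/row_matrixP => i; rewrite rowK finset.in_set0 row_mul.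
Qed.

Lemma partk (h v : 'M[R]_n) k (f : 'M[R]_(k, n) -> R) A : part h v k f A = f (A *m h).
Proof.
rewrite /part (big_pred1 finset.setT) => [|S]; last first.
  rewrite /= eqEcard finset.subsetT cardsT card_ord /=.
  by rewrite eqn_leq -[X in (_ <= X)%N]card_ord max_card.
by congr f; apply/row_matrixP => i; rewrite rowK finset.in_setT row_mul.
Qed.

(** Another subset of the same size contains an index outside [S], whose row is killed by [h]; so a
    single term of [part] survives. *)
Lemma part_single_vert (h v : 'M[R]_n) k (f : 'M[R]_(k, n) -> R) (A : 'M[R]_(k, n))
    (S : {set 'I_k}) : multilinear f ->
  (forall i, i \notin S -> row i A *m h = 0) ->
  part h v #|S| f A = f (\matrix_i (row i A *m (if i \in S then h else v))).
Proof.
move=> mf Ah; rewrite /part (bigD1 S) //= big1 ?addr0 // => S' /andP[/eqP cS nS].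
have [i iS' iS] : exists2 i, i \in S' & i \notin S.
  by apply/subsetPn; apply: contra nS => sS; rewrite eqEcard sS cS /=.
by apply: (multilinear_row0 (i := i) mf); rewrite rowK iS' Ah.
Qed.

Lemma part_single_hor (h v : 'M[R]_n) k (f : 'M[R]_(k, n) -> R) (A : 'M[R]_(k, n))
    (S : {set 'I_k}) : multilinear f ->
  (forall i, i \in S -> row i A *m v = 0) ->
  part h v #|S| f A = f (\matrix_i (row i A *m (if i \in S then h else v))).
Proof.
move=> mf Ah; rewrite /part (bigD1 S) //= big1 ?addr0 // => S' /andP[/eqP cS nS].
have [i iS iS'] : exists2 i, i \in S & i \notin S'.
  apply/subsetPn; apply: contra nS => sS.
  by rewrite eq_sym eqEcard sS cS /=.
by apply: (multilinear_row0 (i := i) mf); rewrite rowK (negPf iS') Ah.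
Qed.

Lemma part1_2 (h v : 'M[R]_n) (f : 'M[R]_(2, n) -> R) A :
  part h v 1 f A = f (mxrows [:: row (o2 0) A *m h; row (o2 1) A *m v]) +
                   f (mxrows [:: row (o2 0) A *m v; row (o2 1) A *m h]).
Proof.
have ne : o2 1 != o2 0 by rewrite -val_eqE /= !inordK.
rewrite /part (bigD1 (finset.set1 (o2 0))) ?cards1 //=.
rewrite (bigD1 (finset.set1 (o2 1))) /=; last first.
  by rewrite cards1 eqxx /= (inj_eq finset.set1_inj).
rewrite big1 ?addr0 => [|S]; last first.
  move=> /andP[/andP[/cards1P[i ->]]]; rewrite !(inj_eq finset.set1_inj).
  by move: i; apply: o2P; rewrite eqxx.
congr (f _ + f _); apply/row_matrixP; apply: o2P; rewrite row_mxrows rowK !finset.in_set1 ?eqxx ?(negPf ne);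
 by rewrite /= !inordK // eq_sym (negPf ne).
Qed.

Lemma sum_S2 (F : 'S_2 -> R) : \sum_s F s = F 1%g + F (tperm (o2 0) (o2 1)).
Proof.
have ne : o2 1 != o2 0 by rewrite -val_eqE /= !inordK.
set L := [:: 1%g; tperm (o2 0) (o2 1)].
have uL : uniq L.
  rewrite /= andbT in_cons orbF; apply/eqP => /permP/(_ (o2 0)).
  by rewrite perm1 tpermL => /eqP; rewrite eq_sym (negPf ne).
have LT : mem L =i predT.
  apply/subset_cardP; last by apply/fintype.subsetP.
  by rewrite (card_uniqP uL) card_Sn.
transitivity (\sum_(s in mem L) F s); first by apply: eq_bigl => s; rewrite LT.
by rewrite -big_uniq //= !big_cons big_nil addr0.
Qed.

Lemma sum_S3 (F : 'S_3 -> R) (t01 := tperm (o3 0) (o3 1)) (t12 := tperm (o3 1) (o3 2))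
    (t02 := tperm (o3 0) (o3 2)) :
  \sum_s F s = F 1%g + (F t01 + (F t02 + (F t12 + (F (t01 * t12)%g + F (t12 * t01)%g)))).
Proof.
have n10 : o3 1 != o3 0 by rewrite -val_eqE /= !inordK.
have n20 : o3 2 != o3 0 by rewrite -val_eqE /= !inordK.
have n21 : o3 2 != o3 1 by rewrite -val_eqE /= !inordK.
have n01 := n10; have n02 := n20; have n12 := n21.
rewrite eq_sym in n01; rewrite eq_sym in n02; rewrite eq_sym in n12.
set L := [:: 1%g; t01; t02; t12; (t01 * t12)%g; (t12 * t01)%g].
have uL : uniq L.
  apply: (@map_uniq _ _ (fun s : 'S_3 => (s (o3 0), s (o3 1)))).
  rewrite /= !permM !perm1 /t01 /t02 /t12.
  rewrite ?(tpermL, tpermR, @tpermD _ _ _ (o3 0), @tpermD _ _ _ (o3 1), @tpermD _ _ _ (o3 2)) //.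
  rewrite !inE !xpair_eqE ?eqxx.
  by rewrite ?(negPf n01) ?(negPf n02) ?(negPf n12) ?(negPf n10) ?(negPf n20) ?(negPf n21).
have LT : mem L =i predT.
  apply/subset_cardP; last by apply/fintype.subsetP.
  by rewrite (card_uniqP uL) card_Sn.
transitivity (\sum_(s in mem L) F s); first by apply: eq_bigl => s; rewrite LT.
by rewrite -big_uniq //= !big_cons big_nil addr0.
Qed.

(** Antisymmetry in the first two slots pairs the six permutations and leaves twice a cyclic sum.
    The integrands of the Schouten bracket and of a wedge of a 2-form with a 1-form have just this
    symmetry. *)
Lemma sum_S3_alt (G : 'M[R]_(3, n) -> R) (A : 'M[R]_(3, n)) :
  (forall u v w, G (mxrows [:: v; u; w]) = - G (mxrows [:: u; v; w])) ->
  \sum_(s : 'S_3) (-1) ^+ s * G (row_perm s A) =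
  2 * (G (mxrows [:: row (o3 0) A; row (o3 1) A; row (o3 2) A]) +
       G (mxrows [:: row (o3 1) A; row (o3 2) A; row (o3 0) A]) +
       G (mxrows [:: row (o3 2) A; row (o3 0) A; row (o3 1) A])).
Proof.
move=> Galt.
have n10 : o3 1 != o3 0 by rewrite -val_eqE /= !inordK.
have n20 : o3 2 != o3 0 by rewrite -val_eqE /= !inordK.
have n21 : o3 2 != o3 1 by rewrite -val_eqE /= !inordK.
have n01 := n10; have n02 := n20; have n12 := n21.
rewrite eq_sym in n01; rewrite eq_sym in n02; rewrite eq_sym in n12.
have rp (s : 'S_3) : row_perm s A =
    mxrows [:: row (s (o3 0)) A; row (s (o3 1)) A; row (s (o3 2)) A].
  by rewrite [LHS]mxrows3E; congr (mxrows [:: _; _; _]); apply/rowP => c; rewrite !mxE.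
rewrite sum_S3 !rp !odd_mul_tperm !odd_tperm odd_perm1 n01 n02 n12 /=.
rewrite !permM !perm1.
rewrite ?(tpermL, tpermR, @tpermD _ _ _ (o3 0), @tpermD _ _ _ (o3 1), @tpermD _ _ _ (o3 2)) //.
rewrite expr0 expr1.
rewrite (Galt (row (o3 0) A) (row (o3 1) A)) (Galt (row (o3 1) A) (row (o3 2) A)).
rewrite (Galt (row (o3 2) A) (row (o3 0) A)).
ring.
Qed.

End Rows.

(** * Low-degree wedge products in closed form *)

Section Wedges.
Variables (R : realType) (n : nat).

Lemma wedge11E (f g : 'M[R]_(1, n) -> R) (A : 'M[R]_(2, n)) :
  @Defs.wedge R n 1 1 f g A =
  f (row (o2 0) A) * g (row (o2 1) A) - f (row (o2 1) A) * g (row (o2 0) A).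
Proof.
have ne : o2 0 != o2 1 by rewrite -val_eqE /= !inordK.
rewrite /Defs.wedge (_ : (1`! * 1`!)%N = 1) // invr1 mul1r sum_S2 odd_tperm odd_perm1 ne expr0 expr1 mul1r mulN1r.
have u (B : 'M[R]_(1 + 1, n)) : usubmx B = row (o2 0) B.
  apply/rowP => c; rewrite !mxE; congr (B _ c); apply: val_inj.
  by rewrite /= inordK.
have d (B : 'M[R]_(1 + 1, n)) : dsubmx B = row (o2 1) B.
  apply/rowP => c; rewrite !mxE; congr (B _ c); apply: val_inj.
  by rewrite /= inordK.
by rewrite !u !d row_perm1; congr (_ - f _ * g _);
  apply/rowP => c; rewrite !mxE ?tpermL ?tpermR.
Qed.

Lemma usubmx_rows3 (B : 'M[R]_(2 + 1, n)) :
  usubmx B = mxrows [:: row (o3 0) B; row (o3 1) B].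
Proof.
apply/row_matrixP; apply: o2P; rewrite row_mxrows /=; apply/rowP => c; rewrite !mxE;
  by rewrite inordK //=; rewrite !mxE; congr (B _ c); apply: val_inj; rewrite /= !inordK.
Qed.

Lemma dsubmx_row3 (B : 'M[R]_(2 + 1, n)) : dsubmx B = row (o3 2) B.
Proof.
by apply/rowP => c; rewrite !mxE; congr (B _ c); apply: val_inj; rewrite /= inordK.
Qed.

Lemma mxrows_swap (f : 'M[R]_(2, n) -> R) u v :
  multilinear f -> Defs.alternating f -> f (mxrows [:: v; u]) = - f (mxrows [:: u; v]).
Proof.
move=> mf af; have ne : o2 0 != o2 1 by rewrite -val_eqE /= !inordK.
rewrite -(alternating_tperm _ mf af ne); congr f.
apply/row_matrixP; apply: o2P; rewrite row_mxrows /=; apply/rowP => c; rewrite !mxE;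
  by rewrite ?tpermL ?tpermR !inordK.
Qed.

Lemma row_mxrows3 (u v w : 'rV[R]_n) :
  ((row (o3 0) (mxrows [:: u; v; w] : 'M[R]_(3, n)) = u) *
  (row (o3 1) (mxrows [:: u; v; w] : 'M[R]_(3, n)) = v) *
  (row (o3 2) (mxrows [:: u; v; w] : 'M[R]_(3, n)) = w))%type.
Proof. by rewrite !row_mxrows /= !inordK. Qed.

Lemma row_mxrows2 (u v : 'rV[R]_n) :
  ((row (o2 0) (mxrows [:: u; v] : 'M[R]_(2, n)) = u) *
  (row (o2 1) (mxrows [:: u; v] : 'M[R]_(2, n)) = v))%type.
Proof. by rewrite !row_mxrows /= !inordK. Qed.

Lemma wedge21E (f : 'M[R]_(2, n) -> R) (g : 'M[R]_(1, n) -> R) (A : 'M[R]_(3, n)) :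
  (forall u v, f (mxrows [:: v; u]) = - f (mxrows [:: u; v])) ->
  @Defs.wedge R n 2 1 f g A =
    f (mxrows [:: row (o3 0) A; row (o3 1) A]) * g (row (o3 2) A) +
    f (mxrows [:: row (o3 1) A; row (o3 2) A]) * g (row (o3 0) A) +
    f (mxrows [:: row (o3 2) A; row (o3 0) A]) * g (row (o3 1) A).
Proof.
move=> fN; rewrite /Defs.wedge.
pose G (B : 'M[R]_(3, n)) := f (mxrows [:: row (o3 0) B; row (o3 1) B]) * g (row (o3 2) B).
rewrite (eq_bigr (fun s : 'S_3 => (-1) ^+ s * G (row_perm s A))); last first.
  by move=> s _; rewrite usubmx_rows3 dsubmx_row3.
rewrite sum_S3_alt; last first.
  by move=> u v w; rewrite /G !row_mxrows3 fN mulNr.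
by rewrite /G !row_mxrows3 mulrA (_ : (2`! * 1`!)%N = 2) // mulVf ?mul1r // pnatr_eq0.
Qed.

End Wedges.

(** * Operations that preserve multilinearity and alternation *)

Section MoreMultilinear.
Variables (R : realType) (n : nat).

Lemma multilinear_rows k (f : 'M[R]_(k, n) -> R) (G : 'I_k -> 'M[R]_n) :
  multilinear f -> multilinear (fun A => f (\matrix_i (row i A *m G i))).
Proof.
move=> mf A B C i b c Ei /eq_row'P EB /eq_row'P EC.
apply: (@multilinear_row _ _ _ f _ _ _ i) => //.
- by rewrite !rowK Ei mulmxDl -!scalemxAl.
- by move=> j ji; rewrite !rowK EB.
- by move=> j ji; rewrite !rowK EC.
Qed.

Lemma multilinear_mulmxr k n' (f : 'M[R]_(k, n') -> R) (G : 'M[R]_(n, n')) :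
  multilinear f -> multilinear (fun A => f (A *m G)).
Proof.
move=> mf A B C i b c Ei /eq_row'P EB /eq_row'P EC.
apply: (@multilinear_row _ _ _ f _ _ _ i) => //.
- by rewrite !row_mul Ei mulmxDl -!scalemxAl.
- by move=> j ji; rewrite !row_mul EB.
- by move=> j ji; rewrite !row_mul EC.
Qed.

Lemma alternating_mulmxr k n' (f : 'M[R]_(k, n') -> R) (G : 'M[R]_(n, n')) :
  Defs.alternating f -> Defs.alternating (fun A => f (A *m G)).
Proof. by move=> af A i j ij Aij; apply: (af _ i j ij); rewrite !row_mul Aij. Qed.

Lemma multilinear_last k l (f : 'M[R]_(k + l, n) -> R) (A : 'M[R]_(k, n)) :
  multilinear f -> multilinear (fun B : 'M[R]_(l, n) => f (col_mx A B)).
Proof.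
move=> mf B C D i b c Ei /eq_row'P EC /eq_row'P ED.
apply: (@multilinear_row _ _ _ f _ _ _ (rshift k i)) => //.
- by rewrite !rowKd.
- move=> j; case: (split_ordP j) => r -> jr; first by rewrite !rowKu.
  by rewrite !rowKd EC //; apply: contra jr => /eqP->.
- move=> j; case: (split_ordP j) => r -> jr; first by rewrite !rowKu.
  by rewrite !rowKd ED //; apply: contra jr => /eqP->.
Qed.

Lemma multilinear_contract k l (Q : 'M[R]_(k, n) -> R) (f : 'M[R]_(k + l, n) -> R) :
  multilinear f -> multilinear (fun B : 'M[R]_(l, n) => Defs.contract Q f B).
Proof.
move=> mf A B C i b c Ei EB EC; rewrite /Defs.contract.
rewrite mulrCA [c * _]mulrCA -mulrDr; congr (_ * _).
rewrite 2!mulr_sumr -big_split; apply: eq_bigr => s _ /=.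
by rewrite (multilinear_last _ mf Ei EB EC) mulrDr; congr (_ + _); rewrite mulrCA.
Qed.

Lemma multilinear1_sum (f : 'M[R]_(1, n) -> R) I (r : seq I) (c : I -> R) (v : I -> 'rV[R]_n) :
  multilinear f -> f (\sum_(i <- r) c i *: v i) = \sum_(i <- r) c i * f (v i).
Proof.
move=> mf; apply: (multilinear_sum (i := ord0) mf) => [|i j]; last by rewrite ord1 eqxx.
rewrite row_id; apply: eq_bigr => i _; by rewrite row_id.
Qed.

Lemma multilinear_part (h v : 'M[R]_n) r k (f : 'M[R]_(k, n) -> R) :
  multilinear f -> multilinear (part h v r f).
Proof.
move=> mf A B C i b c Ei EB EC; rewrite /part 2!mulr_sumr -big_split; apply: eq_bigr => S _.
exact: (multilinear_rows (fun i => if i \in S then h else v) mf Ei).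
Qed.

(** Exchanging [i] and [j] in the subset [S] is an involution on the subsets of a given size, and it
    changes the sign of the corresponding term when the two rows agree. The sum therefore equals its
    opposite. *)
Lemma alternating_part (h v : 'M[R]_n) r k (f : 'M[R]_(k, n) -> R) :
  multilinear f -> Defs.alternating f -> Defs.alternating (part h v r f).
Proof.
move=> mf af A i j ij Aij; rewrite /part.
pose F (S : {set 'I_k}) := f (\matrix_l (row l A *m (if l \in S then h else v))).
pose t := tperm i j; pose tS (S : {set 'I_k}) := [set x | t x \in S]%SET.
have tSK : involutive tS by move=> S; apply/setP => x; rewrite !finset.inE tpermK.
have FN S : F (tS S) = - F S.
  rewrite -(alternating_tperm _ mf af ij); congr f; apply/row_matrixP => l.
  rewrite rowK [RHS](_ : _ = row (t l) (\matrix_l (row l A *m (if l \in S then h else v)))).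
    rewrite rowK finset.inE; congr (_ *m _).
    by rewrite /t; case: tpermP => [->|->|//]; rewrite Aij.
  by apply/rowP => c; rewrite !mxE.
set s := \sum_(S | _) _; suff /eqP : s = - s.
  by rewrite -addr_eq0 -mulr2n mulrn_eq0 /= => /eqP.
rewrite {2}/s -sumrN /s (reindex_inj (inv_inj tSK)); apply: eq_big => S.
  congr (_ == _); have -> : tS S = (t @^-1: S)%SET by apply/setP => x; rewrite !finset.inE.
  by rewrite -(card_preimset S (@perm_inj _ t)).
by move=> _; exact: FN.
Qed.

(** Induction on the distance of the equal rows: swapping the later one with its predecessor costs a
    sign and brings them closer. *)
Lemma alternating_adjacent k (f : 'M[R]_(k, n) -> R) : multilinear f ->
  (forall A (i j : 'I_k), val j = i.+1 -> row i A = row j A -> f A = 0) ->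
  Defs.alternating f.
Proof.
move=> mf adj.
have main d : forall A (i j : 'I_k), (val j = i + d.+1)%N -> row i A = row j A -> f A = 0.
  elim: d => [|d IH] A i j ij Aij; first by apply: adj Aij; rewrite ij addn1.
  have lk : (i + d.+1 < k)%N by rewrite (leq_trans _ (ltn_ord j)) // ij ltnS leq_add2l.
  pose l := Ordinal lk; have lj : l != j by rewrite -val_eqE /= ij eqn_add2l ltn_eqF.
  have li : i != l by rewrite -val_eqE /= -[X in X == _]addn0 eqn_add2l.
  have ijn : i != j by rewrite -val_eqE /= ij -[X in X == _]addn0 eqn_add2l.
  have : f (xrow l j A) = 0.
    apply: (IH _ i l) => //; apply/rowP => c; have /rowP/(_ c) := Aij; rewrite !mxE tpermL => <-.
    by rewrite tpermD // eq_sym.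
  rewrite (multilinear_xrow _ mf _ lj) => [/eqP|B]; first by rewrite oppr_eq0 => /eqP.
  by apply: adj; rewrite /= ij addnS.
move=> A i j; rewrite neq_ltn => /orP[ij|ji] Aij.
  by apply: (main (j - i.+1)%N A i j) => //; rewrite -addSnnS subnKC.
by apply: (main (i - j.+1)%N A j i) => //; rewrite -addSnnS subnKC.
Qed.

End MoreMultilinear.

(** * Charts *)

Section Charts.
Variables (R : realType) (n : nat) (M : manifold R n).
Implicit Types (p q r s : M).

Lemma chart_cimg p r : cdom p r -> cimg p (chart p r).
Proof. by move=> pr; exists r. Qed.

Lemma cimg_unchart p x : cimg p x -> cdom p (unchart p x) /\ chart p (unchart p x) = x.
Proof. by move=> [r pr <-]; rewrite chartK. Qed.

Lemma chart_image p (U : set M) :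
  chart p @` (cdom p `&` U) = cimg p `&` unchart p @^-1` U.
Proof.
apply/seteqP; split=> [_ [r [pr Ur] <-]|x [px Ux]].
  by split; [exact: chart_cimg|rewrite /preimage /= chartK].
by have [h1 h2] := cimg_unchart px; exists (unchart p x).
Qed.

Lemma chart_image_open p (U : set M) : open U -> open (chart p @` (cdom p `&` U)).
Proof.
move=> oU; rewrite chart_image openE => x [px Ux].
apply: filterI; first exact: (open_nbhs_nbhs (conj (@cimg_open _ _ M p) px)).
exact: (unchart_continuous px) (open_nbhs_nbhs (conj oU Ux)).
Qed.

Lemma transition_open p q : open (chart p @` (cdom p `&` cdom q)).
Proof. by apply: chart_image_open; exact: cdom_open. Qed.

Lemma transition_differentiable p q r : cdom p r -> cdom q r ->
  differentiable (chart q \o unchart p) (chart p r).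
Proof.
by move=> pr qr; apply: (smooth_differentiable (@transition_smooth _ _ M p q)); exists r.
Qed.

Lemma near_unchart p (U : set M) r : open U -> cdom p r -> U r ->
  \forall x \near chart p r, cimg p x /\ U (unchart p x).
Proof.
move=> oU pr Ur; have h : (chart p @` (cdom p `&` U)) (chart p r) by exists r.
by have := open_nbhs_nbhs (conj (@chart_image_open p U oU) h); rewrite chart_image.
Qed.

Lemma chart_change_cocycle p q s r : cdom p r -> cdom q r -> cdom s r ->
  chart_change p q r *m chart_change q s r = chart_change p s r.
Proof.
move=> pr qr sr; rewrite /chart_change.
have dpq := transition_differentiable pr qr.
have Eq : (chart q \o unchart p) (chart p r) = chart q r by rewrite /= chartK.
have dqs : differentiable (chart s \o unchart q) ((chart q \o unchart p) (chart p r)).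
  by rewrite Eq; exact: transition_differentiable.
rewrite -Eq -(jacobian_comp dpq dqs); apply: near_eq_jacobian.
  apply: filterS (near_unchart (cdom_open q) pr qr) => x [px qx] /=.
  by rewrite chartK.
exact: differentiable_comp.
Qed.

Lemma chart_change_id p r : cdom p r -> chart_change p p r = 1%:M.
Proof.
move=> pr; rewrite /chart_change -[RHS](jacobian_id (chart p r)).
apply: near_eq_jacobian; last exact: transition_differentiable.
apply: filterS (near_unchart (cdom_open p) pr pr) => x [px _] /=.
by have [] := cimg_unchart px.
Qed.

Lemma chart_changeV p q r : cdom p r -> cdom q r ->
  chart_change p q r *m chart_change q p r = 1%:M.
Proof. by move=> pr qr; rewrite chart_change_cocycle // chart_change_id. Qed.

Lemma smooth_chart_change p q :
  smooth_on (chart p @` (cdom p `&` cdom q)) (fun x => chart_change p q (unchart p x)).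
Proof.
apply: (@eq_smooth _ _ _ _ (jacobian (chart q \o unchart p))); first exact: transition_open.
  by move=> _ [r [pr qr] <-]; rewrite /chart_change chartK.
by apply: smooth_jacobian; [exact: transition_open|exact: transition_smooth].
Qed.

End Charts.

(** * The projection in charts *)

Section LocalMaps.
Variables (R : realType) (n m : nat) (M : manifold R n) (B : manifold R m).
Variables (pi : M -> B) (spi : smooth_map pi).

Definition local_map (p : M) (b : B) := chart b \o pi \o unchart p.

Lemma local_dom_open (p : M) (b : B) : open (chart p @` (cdom p `&` pi @^-1` cdom b)).
Proof.
by apply: chart_image_open; apply: open_comp; [move=> x _; exact: spi.1|exact: cdom_open].
Qed.

Lemma local_map_differentiable p b r : cdom p r -> cdom b (pi r) ->
  differentiable (local_map p b) (chart p r).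
Proof. by move=> pr br; apply: (smooth_differentiable (spi.2 p b)); exists r. Qed.

(** [dmap pi] uses at each point the charts attached to that point. This chain rule relates it to
    the Jacobian in one fixed pair of charts, which can be differentiated. *)
Lemma dmap_local p b r : cdom p r -> cdom b (pi r) ->
  'J (local_map p b) (chart p r) =
  chart_change p r r *m dmap pi r *m chart_change (pi r) b (pi r).
Proof.
move=> pr br; rewrite /chart_change /dmap.
have rr := mem_cdom r; have bb := mem_cdom (pi r).
have d1 := transition_differentiable pr rr.
have E1 : (chart r \o unchart p) (chart p r) = chart r r by rewrite /= chartK.
have d2 : differentiable (local_map r (pi r)) ((chart r \o unchart p) (chart p r)).
  by rewrite E1; exact: local_map_differentiable.
have d12 := differentiable_comp d1 d2.
have E2 : (local_map r (pi r) \o (chart r \o unchart p)) (chart p r) = chart (pi r) (pi r).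
  by rewrite /local_map /= !chartK.
have d3 : differentiable (chart b \o unchart (pi r))
    ((local_map r (pi r) \o (chart r \o unchart p)) (chart p r)).
  by rewrite E2; exact: transition_differentiable.
rewrite -E2 -E1 -(jacobian_comp d1 d2) -(jacobian_comp d12 d3).
apply/esym/near_eq_jacobian; last exact: differentiable_comp.
have oU : open (cdom r `&` pi @^-1` cdom (pi r)).
  apply: openI; first exact: cdom_open.
  by apply: open_comp; [move=> x _; exact: spi.1|exact: cdom_open].
apply: filterS (near_unchart oU pr (conj rr bb)) => x [px [rx bx]] /=.
by rewrite /local_map /= !chartK.
Qed.

End LocalMaps.

(** * The horizontal lift *)

Section SmoothMatrices.
Variables (R : realType) (V : normedModType R).
Implicit Types U : set V.

Lemma smooth_prod U I (s : seq I) (P : pred I) (f : I -> V -> R) :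
  open U -> (forall i, P i -> smooth_on U (f i)) ->
  smooth_on U (fun x => \prod_(i <- s | P i) f i x).
Proof.
move=> oU sf; elim: s => [|i s IH].
  apply: (@eq_smooth _ _ _ _ (fun=> 1 : R)) => //; first by move=> x _; rewrite big_nil.
  exact: smooth_cst.
case Pi : (P i); last first.
  apply: (@eq_smooth _ _ _ _ (fun x => \prod_(i <- s | P i) f i x)) => //.
  by move=> x _; rewrite big_cons Pi.
apply: (@eq_smooth _ _ _ _ (fun x => f i x * \prod_(i <- s | P i) f i x)) => //.
  by move=> x _; rewrite big_cons Pi.
by apply: smoothM => //; exact: sf.
Qed.

Lemma smooth_det U n (F : V -> 'M[R]_n) : open U -> smooth_on U F ->
  smooth_on U (fun x => \det (F x)).
Proof.
move=> oU sF; apply: smooth_sum => // s _; apply: smoothM => //.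
  exact: smooth_cst.
by apply: smooth_prod => // i _; exact: smooth_coord.
Qed.

Lemma smooth_invmx U n (F : V -> 'M[R]_n) : open U -> smooth_on U F ->
  (forall x, U x -> F x \in unitmx) -> smooth_on U (fun x => invmx (F x)).
Proof.
move=> oU sF uF; apply: smooth_mx => // i j.
apply: (@eq_smooth _ _ _ _ (fun x => (\det (F x))^-1 * cofactor (F x) j i)) => //.
  by move=> x Ux; rewrite /invmx uF // !mxE.
apply: smoothM => //.
  apply: smoothV => //; last exact: smooth_det.
  by move=> x /uF; rewrite unitmxE unitfE.
apply: smoothM => //; first exact: smooth_cst.
apply: smooth_det => //; apply: smooth_mx => // k l.
apply: (@eq_smooth _ _ _ _ (fun x => F x (lift j k) (lift i l))) => //.
  by move=> x _; rewrite !mxE.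
exact: smooth_coord.
Qed.

Lemma smooth_multilinear U k n (a : V -> 'M[R]_(k, n) -> R) (F : V -> 'M[R]_(k, n)) :
  open U -> (forall x, U x -> multilinear (a x)) ->
  (forall A, smooth_on U (fun x => a x A)) -> smooth_on U F ->
  smooth_on U (fun x => a x (F x)).
Proof.
move=> oU ma sa sF.
apply: (@eq_smooth _ _ _ _ (fun x => \sum_(s : {ffun 'I_k -> 'I_n})
  (\prod_i F x i (s i)) * a x (rowsub s 1%:M))) => //.
  by move=> x Ux; rewrite -[in RHS](mulmx1 (F x)) multilinear_expand //; exact: ma.
apply: smooth_sum => // s _; apply: smoothM => //.
by apply: smooth_prod => // i _; exact: smooth_coord.
Qed.

End SmoothMatrices.

(** * Projection onto a kernel along a framed complement *)

Section Projections.
Variable F : fieldType.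

Lemma mulmx_cancel a b c d (X : 'M[F]_(a, b)) (Y : 'M[F]_(b, d)) (G : 'M[F]_(b, c))
    (G' : 'M[F]_(c, b)) : G *m G' = 1%:M -> (X *m G) *m (G' *m Y) = X *m Y.
Proof. by move=> GG; rewrite -mulmxA (mulmxA G) GG mul1mx. Qed.

Lemma mulmx1_invmx n (A B : 'M[F]_n) : A *m B = 1%:M -> invmx B = A.
Proof.
by move=> AB; have [_ uB] := mulmx1_unit AB; rewrite -[LHS]mul1mx -AB -mulmxA mulmxV // mulmx1.
Qed.

(** Both sides vanish on [H] and are the identity on [kermx D], and these subspaces span. The matrix
    [E *m D] is invertible because [H] meets the kernel trivially. *)
Lemma proj_mx_graph n m (D : 'M[F]_(n, m)) (E : 'M[F]_(m, n)) (H : 'M[F]_n) :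
  row_free E -> (E :=: H)%MS -> (H :&: kermx D = 0)%MS -> (H + kermx D :=: 1%:M)%MS ->
  E *m D \in unitmx /\ proj_mx (kermx D) H = 1%:M - D *m (invmx (E *m D) *m E).
Proof.
move=> Ef EH HV HV1.
have ED : E *m D \in unitmx.
  rewrite -row_free_unit /row_free; apply/eqP.
  have EV : (E :&: kermx D = 0)%MS.
    by apply/eqP; rewrite -submx0 -HV; apply: capmxS => //; rewrite EH submx_refl.
  by have := mxrank_mul_ker E D; rewrite EV mxrank0 addn0 (eqP Ef).
split=> //; set G := _ - _.
have VH : (kermx D :&: H = 0)%MS by rewrite capmxC.
have : (1%:M <= H + kermx D)%MS by rewrite HV1.
move=> /sub_addsmxP[[a b] /= ab].
have split1 (X : 'M[F]_n) : X = a *m (H *m X) + b *m (kermx D *m X).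
  by rewrite -[LHS]mul1mx ab mulmxDl (mulmxA a) (mulmxA b).
have HG : H *m G = 0.
  have /submxP[c ->] : (H <= E)%MS by rewrite EH.
  rewrite /G mulmxBr mulmx1 !mulmxA.
  by rewrite -[c *m E *m D]mulmxA -[c *m (E *m D) *m _]mulmxA mulmxV // mulmx1 subrr.
have VG : kermx D *m G = kermx D.
  by rewrite /G mulmxBr mulmx1 mulmxA mulmx_ker mul0mx subr0.
by rewrite (split1 (proj_mx _ _)) (split1 G) HG VG (proj_mx_0 VH) // (proj_mx_id VH).
Qed.

End Projections.

(** * Smoothness of the horizontal lift and of the connection *)

Section LocalStructure.
Variables (R : realType) (n m : nat) (M : manifold R n) (B : manifold R m).
Variables (pi : M -> B) (hpi : fiber_bundle pi).
Variables (H : M -> 'M[R]_n) (hH : horizontal_subbundle pi H).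

Let gamma := connection_along pi H.
Let hl := hor_lift pi gamma.
Let spi : smooth_map pi. Proof. by case: hpi. Qed.

(** The arbitrary right inverse [pinvmx] disappears: the horizontal projection factors through
    [dmap pi r], which it cancels. *)
Lemma hor_lift_frame r (E : 'M[R]_(m, n)) : row_free E -> (E :=: H r)%MS ->
  E *m dmap pi r \in unitmx /\ hl r = invmx (E *m dmap pi r) *m E.
Proof.
move=> Ef EH; have [HV HV1] := hH.2 r.
have [ED pE] := proj_mx_graph Ef EH HV HV1; split=> //.
have [_ _ full] := hpi; rewrite /hl /hor_lift /gamma /connection_along pE opprB addrCA subrr addr0.
by rewrite mulmxA (mulVpmx (full r)) mul1mx.
Qed.

Lemma hor_liftE r : hl r *m dmap pi r = 1%:M /\ gamma r = 1%:M - dmap pi r *m hl r.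
Proof.
have [U [E [_ Ur _ /(_ r Ur)[Ef EH] _]]] := hH.1 r.
have [ED ->] := hor_lift_frame Ef EH; have [HV HV1] := hH.2 r.
have [_ pE] := proj_mx_graph Ef EH HV HV1.
by rewrite /gamma /connection_along pE -mulmxA mulVmx.
Qed.

Definition local_hor_lift (p : M) (b : B) (x : 'rV[R]_n) : 'M[R]_(m, n) :=
  let r := unchart p x in
  chart_change b (pi r) (pi r) *m hl r *m chart_change r p r.

Let dom p b := chart p @` (cdom p `&` pi @^-1` cdom b).

Let domP p b x : dom p b x -> exists r, [/\ cdom p r, cdom b (pi r), x = chart p r & unchart p x = r].
Proof. by move=> [r [pr br] <-]; exists r; rewrite chartK. Qed.

Lemma local_hor_liftK p b x : dom p b x ->
  local_hor_lift p b x *m 'J (local_map pi p b) x = 1%:M.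
Proof.
move=> /domP[r [pr br -> Er]]; rewrite (dmap_local spi pr br) /local_hor_lift chartK //.
have rr := mem_cdom r; have bb := mem_cdom (pi r).
have := (hor_liftE r).1; move: (hl r) => h hD.
rewrite -!mulmxA [chart_change r p r *m _]mulmxA chart_changeV // mul1mx.
by rewrite [h *m _]mulmxA hD mul1mx chart_changeV.
Qed.

Lemma end_loc_connection p b x : dom p b x ->
  end_loc gamma p x = 1%:M - 'J (local_map pi p b) x *m local_hor_lift p b x.
Proof.
move=> /domP[r [pr br -> Er]]; rewrite (dmap_local spi pr br) /local_hor_lift /end_loc chartK //.
have rr := mem_cdom r; have bb := mem_cdom (pi r).
rewrite (hor_liftE r).2; move: (hl r) => h.
rewrite mulmxBr mulmxBl mulmx1 chart_changeV //; congr (_ - _).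
rewrite -(mulmxA _ h) (mulmx_cancel _ _ (chart_changeV bb br)).
by rewrite (mulmxA _ (dmap pi r)) -(mulmxA _ h).
Qed.

(** Near any point [q] of the domain the subbundle has a smooth frame, known in chart [q]. Carried
    to chart [p] as [Fr], it expresses the lift as the inverse of [Fr] times the Jacobian of the
    projection, times [Fr]. *)
Lemma smooth_local_hor_lift p b : smooth_on (dom p b) (local_hor_lift p b).
Proof.
apply: smooth_local => x1 /domP[q [pq bq -> _]].
have [U [E [oU Uq Ucd fr sE]]] := hH.1 q.
pose N := U `&` cdom q `&` pi @^-1` cdom b.
have oN : open N.
  apply: openI; first by apply: openI => //; exact: cdom_open.
  by apply: open_comp; [move=> x _; exact: spi.1|exact: cdom_open].
have sub : chart p @` (cdom p `&` N) `<=` dom p b.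
  by move=> _ [r [pr [[Ur qr] br]] <-]; exists r.
have sub2 : chart p @` (cdom p `&` N) `<=` chart p @` (cdom p `&` cdom q).
  by move=> _ [r [pr [[Ur qr] br]] <-]; exists r.
exists (chart p @` (cdom p `&` N)).
  by exists q => //; split=> //; do ![split]; rewrite //=; exact: mem_cdom.
have oW := @chart_image_open _ _ M p N oN.
pose t := chart q \o unchart p.
pose Fr x := (vec_loc E q \o t) x *m ((fun y => chart_change q p (unchart q y)) \o t) x.
have tE r : cdom p r -> t (chart p r) = chart q r by move=> pr; rewrite /t /= chartK.
have st : smooth_on (chart p @` (cdom p `&` N)) t.
  exact: sub_smooth sub2 (@transition_smooth _ _ M p q).
have FrE r : cdom p r -> N r -> Fr (chart p r) = E r *m chart_change r p r.
  move=> pr [[Ur qr] br].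
  have -> : Fr (chart p r) = vec_loc E q (t (chart p r)) *m
      chart_change q p (unchart q (t (chart p r))) by [].
  rewrite (tE r pr) (chartK qr).
  have -> : vec_loc E q (chart q r) = E r *m chart_change r q r by rewrite /vec_loc chartK.
  by rewrite -mulmxA (chart_change_cocycle (mem_cdom r) qr pr).
have oU' : open (chart q @` U).
  have -> : U = cdom q `&` U; last exact: chart_image_open.
  by apply/seteqP; split=> [y Uy|y []//]; split=> //; exact: Ucd.
have s1 : smooth_on (chart p @` (cdom p `&` N)) (vec_loc E q \o t).
  apply: (smooth_comp_mx oW oU' _ sE st).
  by move=> _ [r [pr [[Ur qr] br]] <-]; exists r => //; rewrite tE.
have s2 : smooth_on (chart p @` (cdom p `&` N))
    ((fun y => chart_change q p (unchart q y)) \o t).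
  apply: (smooth_comp_mx oW _ _ (@smooth_chart_change _ _ M q p) st).
    exact: transition_open.
  by move=> _ [r [pr [[Ur qr] br]] <-]; exists r => //; rewrite tE.
have sFr : smooth_on (chart p @` (cdom p `&` N)) Fr := smooth_mulmx oW s1 s2.
have sJ : smooth_on (chart p @` (cdom p `&` N)) (jacobian (local_map pi p b)).
  apply: sub_smooth sub _; apply: smooth_jacobian; first exact: local_dom_open.
  exact: spi.2.
have key r : cdom p r -> N r ->
    Fr (chart p r) *m 'J (local_map pi p b) (chart p r) \in unitmx /\
    local_hor_lift p b (chart p r) =
    invmx (Fr (chart p r) *m 'J (local_map pi p b) (chart p r)) *m Fr (chart p r).
  move=> pr Nr; have [[Ur qr] br] := Nr; have [Ef EH] := fr r Ur.
  have [ED hlE] := hor_lift_frame Ef EH.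
  have rr := mem_cdom r; have bb := mem_cdom (pi r).
  have FJ : Fr (chart p r) *m 'J (local_map pi p b) (chart p r) =
      (E r *m dmap pi r) *m chart_change (pi r) b (pi r).
    rewrite (FrE r pr Nr) (dmap_local spi pr br) -(mulmxA _ (dmap pi r)).
    by rewrite (mulmx_cancel _ _ (chart_changeV rr pr)) mulmxA.
  (* This left inverse yields at once the invertibility and the value of the inverse. *)
  have L : chart_change b (pi r) (pi r) *m invmx (E r *m dmap pi r) *m
      (Fr (chart p r) *m 'J (local_map pi p b) (chart p r)) = 1%:M.
    by rewrite FJ (mulmx_cancel _ _ (mulVmx ED)) chart_changeV.
  have [_ uFJ] := mulmx1_unit L; split=> //.
  have iZ := mulmx1_invmx L.
  apply: etrans (congr1 (fun Y => Y *m Fr (chart p r)) (esym iZ)).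
  have -> : local_hor_lift p b (chart p r) =
      chart_change b (pi r) (pi r) *m hl r *m chart_change r p r.
    by rewrite /local_hor_lift chartK.
  by rewrite hlE (FrE r pr Nr) (mulmxA _ (invmx _) (E r)) -(mulmxA _ (E r)).
apply: (@eq_smooth _ _ _ _ (fun x => invmx (Fr x *m 'J (local_map pi p b) x) *m Fr x)) => //.
  by move=> _ [r [pr Nr] <-]; rewrite (key r pr Nr).2.
apply: smooth_mulmx => //; apply: smooth_invmx => //; first exact: smooth_mulmx.
by move=> _ [r [pr Nr] <-]; exact: (key r pr Nr).1.
Qed.

Lemma connection_ehresmann : ehresmann pi gamma.
Proof.
split=> [p|p]; last first.
  have [hD ->] := hor_liftE p; move: (hl p) hD => h hD; split.
    apply/sub_kermxP; rewrite mulmxBl mul1mx -mulmxA hD mulmx1 subrr //.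
  by rewrite mulmxBr mulmx1 mulmxA mulmx_ker mul0mx subr0.
apply: smooth_local => _ [q pq <-]; exists (dom p (pi q)).
  by exists q => //; split=> //; exact: mem_cdom.
have oD : open (dom p (pi q)) by exact: local_dom_open.
apply: (@eq_smooth _ _ _ _
  (fun x => 1%:M + (-1)%:M *m ('J (local_map pi p (pi q)) x *m local_hor_lift p (pi q) x))) => //.
  by move=> x Dx; rewrite (end_loc_connection Dx) mul_scalar_mx scaleN1r.
apply: smoothD => //; first exact: smooth_cst.
apply: smooth_mulmx => //; first exact: smooth_cst.
apply: smooth_mulmx => //; last exact: smooth_local_hor_lift.
by apply: smooth_jacobian => //; exact: spi.2.
Qed.

End LocalStructure.

(** * The Jacobi identity in an adapted frame *)

Section Frames.

Definition o5 i : 'I_5 := inord i.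

Lemma sum5 (V : nmodType) (F : 'I_5 -> V) :
  \sum_i F i = F (o5 0) + (F (o5 1) + (F (o5 2) + (F (o5 3) + F (o5 4)))).
Proof.
rewrite !big_ord_recl big_ord0 addr0.
by do ![congr (_ + _)]; congr F; apply: val_inj; rewrite /= inordK.
Qed.

End Frames.

Section JacobiIdentity.
Variable R : realType.

Definition sumn5 (F : nat -> R) := F 0%N + (F 1%N + (F 2%N + (F 3%N + F 4%N))).

(* One-jets in an adapted frame whose first two vectors are horizontal and     *)
(* last three vertical: p and dp of the bivector, om and dom of the vertical    *)
(* volume, S of the differential of the projection, B of the horizontal lift,   *)
(* kp and dk of the coefficient of the horizontal part of the bivector; the     *)
(* first index of dp, dom, B, S and dk is the direction of derivation.          *)
Variables (p : nat -> nat -> R) (dp : nat -> nat -> nat -> R).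
Variables (om : nat -> nat -> nat -> R) (dom : nat -> nat -> nat -> nat -> R).
Variables (B : nat -> nat -> nat -> R) (S : nat -> nat -> nat -> R).
Variables (kp : R) (dk : nat -> R).
Hypothesis pN : forall i j, p j i = - p i j.
Hypothesis dpN : forall k i j, dp k j i = - dp k i j.
Hypothesis omN1 : forall i j l, om j i l = - om i j l.
Hypothesis omN2 : forall i j l, om i l j = - om i j l.
Hypothesis domN1 : forall k i j l, dom k j i l = - dom k i j l.
Hypothesis domN2 : forall k i j l, dom k i l j = - dom k i j l.
Hypothesis om0 : forall j l, om 0 j l = 0.
Hypothesis om1 : forall j l, om 1 j l = 0.
Hypothesis p01 : p 0 1 = kp.
Hypothesis p0 : forall a, (1 < a < 5)%N -> p 0 a = 0.
Hypothesis p1 : forall a, (1 < a < 5)%N -> p 1 a = 0.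
Hypothesis Ssym : forall k l i, S k l i = S l k i.
Hypothesis BS : forall k i j, (i < 2)%N -> (j < 2)%N ->
  B k i j = - S k i j.
Hypothesis dom0 : forall k l m, dom k 0 l m = - sumn5 (fun n => B k 0 n * om n l m).
Hypothesis dom1 : forall k l m, dom k 1 l m = - sumn5 (fun n => B k 1 n * om n l m).
Hypothesis dp0 : forall k l, dp k 0 l =
  dk k * (l == 1)%N%:R + kp * B k 1 l - sumn5 (fun n => S k n 0 * p n l).
(** Indices are natural numbers read through [o5], whose [inord] sends those above 4 to 0; hence the
    second disjunct. This hypothesis and [dp0] are the derivative of the statement that the bivector
    maps the base covectors to multiples of lifted vectors. *)
Hypothesis dp1 : forall k l, dp k 1 l =
  - (dk k * ((l == 0) || (4 < l))%N%:R + kp * B k 0 l) - sumn5 (fun n => S k n 1 * p n l).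
Hypothesis jac : forall l m n, sumn5 (fun k => dp k l m * p k n) + sumn5 (fun k => dp k m n * p k l) +
  sumn5 (fun k => dp k n l * p k m) = 0.

(** Components of the 1-form beta in the frame, as in [betaE]; [dbe] below is their derivative by
    the product rule. *)
Let be l := 2^-1 * sumn5 (fun i => sumn5 (fun j => p i j * om i j l)).
Let dbe k l := 2^-1 * sumn5 (fun i => sumn5 (fun j => dp k i j * om i j l + p i j * dom k i j l)).
Let f := om 2 3 4.

Let pii i : p i i = 0. Proof. by apply/eqP; rewrite -eqNr -pN. Qed.
Let omii i j : om i i j = 0.
Proof. by apply/eqP; rewrite -eqNr -omN1. Qed.
Let omjj i j : om i j j = 0.
Proof. by apply/eqP; rewrite -eqNr -omN2. Qed.
Let domii k i j : dom k i i j = 0.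
Proof. by apply/eqP; rewrite -eqNr -domN1. Qed.
Let domjj k i j : dom k i j j = 0.
Proof. by apply/eqP; rewrite -eqNr -domN2. Qed.
Let omiji i j : om i j i = 0. Proof. by rewrite omN2 omii oppr0. Qed.
Let domiji k i j : dom k i j i = 0. Proof. by rewrite domN2 domii oppr0. Qed.

Let p'l : (p 0 1 = kp) * (p 0 2 = 0) * (p 0 3 = 0) *
 (p 0 4 = 0) * (p 1 2 = 0) * (p 1 3 = 0) *
 (p 1 4 = 0).
Proof. by do ![split]; rewrite ?p01 ?p0 ?p1. Qed.

Let p'g : (p 1 0 = - kp) * (p 2 0 = 0) * (p 3 0 = 0) *
 (p 4 0 = 0) * (p 2 1 = 0) * (p 3 1 = 0) *
 (p 4 1 = 0) *
 (p 3 2 = - p 2 3) * (p 4 2 = - p 2 4) *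
 (p 4 3 = - p 3 4).
Proof. by do ![split]; rewrite pN ?p'l ?oppr0. Qed.

Let dp'g k : (dp k 1 0 = - dp k 0 1) *
 (dp k 2 0 = - dp k 0 2) * (dp k 3 0 = - dp k 0 3) *
 (dp k 4 0 = - dp k 0 4) * (dp k 2 1 = - dp k 1 2) *
 (dp k 3 1 = - dp k 1 3) * (dp k 4 1 = - dp k 1 4) *
 (dp k 3 2 = - dp k 2 3) * (dp k 4 2 = - dp k 2 4) *
 (dp k 4 3 = - dp k 3 4).
Proof. by do ![split]; rewrite dpN. Qed.

Let om'0 i j : (om 0 i j = 0) * (om 1 i j = 0) * (om i 0 j = 0) *
 (om i 1 j = 0) * (om i j 0 = 0) * (om i j 1 = 0).
Proof.
do ![split]; rewrite ?om0 ?om1 //.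
- by rewrite omN1 om0 oppr0.
- by rewrite omN1 om1 oppr0.
- by rewrite omN2 omN1 om0 !oppr0.
- by rewrite omN2 omN1 om1 !oppr0.
Qed.

Let om'v : (om 2 3 4 = f) * (om 3 4 2 = f) *
 (om 4 2 3 = f) * (om 3 2 4 = - f) *
 (om 2 4 3 = - f) * (om 4 3 2 = - f).
Proof.
have e1 : om 3 2 4 = - f by rewrite omN1.
have e2 : om 2 4 3 = - f by rewrite omN2.
by do ![split]; rewrite ?e1 ?e2 // ?[om 3 4 2]omN2
  ?[om 4 2 3]omN1 ?e1 ?e2 ?opprK // omN1 omN2 e1 opprK.
Qed.

Let dom'v k : (dom k 3 4 2 = dom k 2 3 4) *
 (dom k 4 2 3 = dom k 2 3 4) *
 (dom k 3 2 4 = - dom k 2 3 4) *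
 (dom k 2 4 3 = - dom k 2 3 4) *
 (dom k 4 3 2 = - dom k 2 3 4).
Proof.
have e1 : dom k 3 2 4 = - dom k 2 3 4 by rewrite domN1.
have e2 : dom k 2 4 3 = - dom k 2 3 4 by rewrite domN2.
by do ![split]; rewrite ?e1 ?e2 // ?[dom k 3 4 2]domN2
  ?[dom k 4 2 3]domN1 ?e1 ?e2 ?opprK // domN1 domN2 e1 opprK.
Qed.

Lemma be_components : (be 0 = 0) * (be 1 = 0) * (be 2 = f * p 3 4) *
  (be 3 = - (f * p 2 4)) * (be 4 = f * p 2 3).
Proof.
by do ![split]; rewrite /be /sumn5 !pii !p'l !p'g !om'0 ?omii ?omjj ?omiji ?om'v; field.
Qed.

Let zs := (@mul0r R, @mulr0 R, @addr0 R, @add0r R, @oppr0 R).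

Let dbe_v k : (dbe k 2 = dom k 2 3 4 * p 3 4 + f * dp k 3 4) *
  (dbe k 3 = - (dom k 2 3 4 * p 2 4 + f * dp k 2 4)) *
  (dbe k 4 = dom k 2 3 4 * p 2 3 + f * dp k 2 3).
Proof.
by do ![split]; rewrite /dbe /sumn5 !pii !p'l !p'g !om'0 ?omii ?omjj ?omiji ?om'v !zs
  ?dp'g ?dom0 ?dom1 /sumn5 ?om'0 ?omii ?omjj ?omiji ?om'v ?dom'v ?domii ?domjj ?domiji !zs; field.
Qed.

Let dom_last k a b i : dom k a b i = dom k i a b.
Proof. by rewrite domN2 domN1 opprK. Qed.

(** The 1-form beta vanishes on lifted vectors, and these leave the constant frame vectors at the
    rate [B]; so the derivative of a horizontal component of beta is not zero but given by [B]. *)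
Let dbe_h k i : (i < 2)%N -> dbe k i = - (B k i 2 * be 2 + B k i 3 * be 3 + B k i 4 * be 4).
Proof.
case: i => [|[|//]] _; rewrite !be_components /dbe /sumn5 !pii !p'l !p'g !om'0 ?omii ?omjj ?omiji !zs
  ?domii ?domjj ?domiji !zs.
  rewrite !(dom_last k _ _ 0) !dom0 /sumn5 ?om'0 ?omii ?omjj ?omiji ?om'v !zs; by field.
rewrite !(dom_last k _ _ 1) !dom1 /sumn5 ?om'0 ?omii ?omjj ?omiji ?om'v !zs; by field.
Qed.

(** On vertical indices [be] is [f] times the dual of the vertical bivector. The derivatives of [f]
    cancel in the Frobenius expression, which becomes [f ^+ 2] times the Jacobi sum. *)
Lemma jacobi_vertical : (dbe 2 3 - dbe 3 2) * be 4 +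
  (dbe 3 4 - dbe 4 3) * be 2 +
  (dbe 4 2 - dbe 2 4) * be 3 = 0.
Proof.
apply: (etrans _ (mulr0 (f ^+ 2))); rewrite -(jac 2 3 4).
rewrite !be_components !dbe_v /sumn5 !p'l !p'g !pii !dp'g; ring.
Qed.

(** Up to sign this is [f ^+ 2] times the Jacobi sum on the other horizontal index and the two
    vertical indices different from [a]: the bivector maps the other base covector to [kp] times the
    lifted vector [i], up to sign. The terms in [S] cancel by symmetry. *)
Lemma jacobi_mixed i a : (i < 2)%N -> (1 < a < 5)%N ->
  kp * (f * (dbe i a - dbe a i) -
   (dom 4 3 2 i - dom 3 4 2 i +
    dom 2 4 3 i - dom i 4 3 2) * be a) = 0.
Proof.
move=> i2 a5; rewrite (dbe_h _ i2).
have S' i' : (S 3 2 i' = S 2 3 i') * (S 4 2 i' = S 2 4 i') *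
  (S 4 3 i' = S 3 4 i') by do ![split]; rewrite Ssym.
case: i i2 => [|[|//]] _; case: a a5 => [|[|[|[|[|[|//]]]]]] // _.
- apply: (etrans _ (mulr0 (f ^+ 2))); rewrite -(jac 1 3 4).
  rewrite !be_components !dbe_v !(dom_last _ _ _ 0) !dom0 /sumn5 !p'l !p'g !pii !dp'g !dp1.
  rewrite /sumn5 /= ?p'l ?p'g ?pii !om'0 ?omii ?omjj ?omiji !om'v !dom'v !S'; ring.
- apply: (etrans _ (mulr0 (- f ^+ 2))); rewrite -(jac 1 2 4).
  rewrite !be_components !dbe_v !(dom_last _ _ _ 0) !dom0 /sumn5 !p'l !p'g !pii !dp'g !dp1.
  rewrite /sumn5 /= ?p'l ?p'g ?pii !om'0 ?omii ?omjj ?omiji !om'v !dom'v !S'; ring.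
- apply: (etrans _ (mulr0 (f ^+ 2))); rewrite -(jac 1 2 3).
  rewrite !be_components !dbe_v !(dom_last _ _ _ 0) !dom0 /sumn5 !p'l !p'g !pii !dp'g !dp1.
  rewrite /sumn5 /= ?p'l ?p'g ?pii !om'0 ?omii ?omjj ?omiji !om'v !dom'v !S'; ring.
- apply: (etrans _ (mulr0 (- f ^+ 2))); rewrite -(jac 0 3 4).
  rewrite !be_components !dbe_v !(dom_last _ _ _ 1) !dom1 /sumn5 !p'l !p'g !pii !dp'g !dp0.
  rewrite /sumn5 /= ?p'l ?p'g ?pii !om'0 ?omii ?omjj ?omiji !om'v !dom'v !S'; ring.
- apply: (etrans _ (mulr0 (f ^+ 2))); rewrite -(jac 0 2 4).
  rewrite !be_components !dbe_v !(dom_last _ _ _ 1) !dom1 /sumn5 !p'l !p'g !pii !dp'g !dp0.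
  rewrite /sumn5 /= ?p'l ?p'g ?pii !om'0 ?omii ?omjj ?omiji !om'v !dom'v !S'; ring.
- apply: (etrans _ (mulr0 (- f ^+ 2))); rewrite -(jac 0 2 3).
  rewrite !be_components !dbe_v !(dom_last _ _ _ 1) !dom1 /sumn5 !p'l !p'g !pii !dp'g !dp0.
  rewrite /sumn5 /= ?p'l ?p'g ?pii !om'0 ?omii ?omjj ?omiji !om'v !dom'v !S'; ring.
Qed.

(** For [a] different from [b] this is, up to sign, [f] times the Jacobi sum on both horizontal
    indices and the remaining vertical one. The derivatives [B] and [S] cancel through [BS] and
    [Ssym]. *)
Lemma jacobi_horizontal a b : (1 < a < 5)%N -> (1 < b < 5)%N ->
  (dk a * be b - dk b * be a) + kp ^+ 2 *
  (dom 1 0 a b - dom 0 1 a b + dom a 1 0 b - dom b 1 0 a) = 0.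
Proof.
(* The vertical volume on two horizontal frame vectors vanishes to first order, so the last two
   derivatives drop out. *)
have red a' b' : dom 1 0 a' b' - dom 0 1 a' b' + dom a' 1 0 b' - dom b' 1 0 a' =
    dom 1 0 a' b' - dom 0 1 a' b'.
  have z k l : dom k 1 0 l = 0.
    by rewrite dom1 /sumn5 !om'0 !mulr0 !addr0 oppr0.
  by rewrite !z subr0 addr0.
rewrite red.
have BS11 k : B k 1 1 = - S k 1 1 by exact: BS.
have S' : (S 2 0 0 = S 0 2 0) * (S 3 0 0 = S 0 3 0) * (S 4 0 0 = S 0 4 0) *
  (S 2 1 1 = S 1 2 1) * (S 3 1 1 = S 1 3 1) * (S 4 1 1 = S 1 4 1).
  by do ![split]; rewrite Ssym.
case: a => [|[|[|[|[|//]]]]] //; case: b => [|[|[|[|[|//]]]]] // _ _.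
- by rewrite !domjj subrr subr0 mulr0 addr0.
- apply: (etrans _ (mulr0 (- f))); rewrite -(jac 0 1 4).
  rewrite !be_components dom0 dom1 /sumn5 !p'l !p'g !pii !dp'g !dp1 !dp0.
  rewrite /sumn5 /= !p'l !p'g ?pii !om'0 ?omii ?omjj ?omiji !om'v !BS11 !S'; ring.
- apply: (etrans _ (mulr0 (f))); rewrite -(jac 0 1 3).
  rewrite !be_components dom0 dom1 /sumn5 !p'l !p'g !pii !dp'g !dp1 !dp0.
  rewrite /sumn5 /= !p'l !p'g ?pii !om'0 ?omii ?omjj ?omiji !om'v !BS11 !S'; ring.
- apply: (etrans _ (mulr0 (f))); rewrite -(jac 0 1 4).
  rewrite !be_components dom0 dom1 /sumn5 !p'l !p'g !pii !dp'g !dp1 !dp0.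
  rewrite /sumn5 /= !p'l !p'g ?pii !om'0 ?omii ?omjj ?omiji !om'v !BS11 !S'; ring.
- by rewrite !domjj subrr subr0 mulr0 addr0.
- apply: (etrans _ (mulr0 (- f))); rewrite -(jac 0 1 2).
  rewrite !be_components dom0 dom1 /sumn5 !p'l !p'g !pii !dp'g !dp1 !dp0.
  rewrite /sumn5 /= !p'l !p'g ?pii !om'0 ?omii ?omjj ?omiji !om'v !BS11 !S'; ring.
- apply: (etrans _ (mulr0 (- f))); rewrite -(jac 0 1 3).
  rewrite !be_components dom0 dom1 /sumn5 !p'l !p'g !pii !dp'g !dp1 !dp0.
  rewrite /sumn5 /= !p'l !p'g ?pii !om'0 ?omii ?omjj ?omiji !om'v !BS11 !S'; ring.
- apply: (etrans _ (mulr0 (f))); rewrite -(jac 0 1 2).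
  rewrite !be_components dom0 dom1 /sumn5 !p'l !p'g !pii !dp'g !dp1 !dp0.
  rewrite /sumn5 /= !p'l !p'g ?pii !om'0 ?omii ?omjj ?omiji !om'v !BS11 !S'; ring.
- by rewrite !domjj subrr subr0 mulr0 addr0.
Qed.

End JacobiIdentity.

(** * Exterior derivative *)

Section DerivativeLemmas.
Variables (R : realType) (V : normedModType R).

Lemma derive_linear (W : normedModType R) (f : V -> W) x u v (b c : R) : differentiable f x ->
  'D_(b *: u + c *: v) f x = b *: 'D_u f x + c *: 'D_v f x.
Proof. by move=> df; rewrite !deriveE // linearP linearZ. Qed.

Lemma derive_sum_dir (W : normedModType R) (f : V -> W) x I (r : seq I) (c : I -> R)
    (v : I -> V) : differentiable f x ->
  'D_(\sum_(i <- r) c i *: v i) f x = \sum_(i <- r) c i *: 'D_(v i) f x.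
Proof.
move=> df; rewrite deriveE // linear_sum; apply: eq_bigr => i _.
by rewrite linearZ deriveE.
Qed.

Lemma derive_sumM I (r : seq I) (f g : I -> V -> R) x v :
  (forall i, differentiable (f i) x) -> (forall i, differentiable (g i) x) ->
  'D_v (fun y => \sum_(i <- r) f i y * g i y) x =
  \sum_(i <- r) ('D_v (f i) x * g i x + f i x * 'D_v (g i) x).
Proof.
move=> df dg; elim: r => [|i r IH].
  rewrite big_nil (_ : (fun _ => _) = cst 0) ?derive_cst //.
  by apply/funext => y; rewrite big_nil.
have E : (fun y => \sum_(j <- i :: r) f j y * g j y) =
  (f i * g i) + (fun y => \sum_(j <- r) f j y * g j y).
  by apply/funext => y; rewrite big_cons.
have ds : differentiable (fun y => \sum_(j <- r) f j y * g j y) x.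
  elim: (r) => [|j s dj].
    have -> : (fun y => \sum_(j <- [::]) f j y * g j y) = cst (0 : R).
      by apply/funext => y; rewrite big_nil.
    exact: differentiable_cst.
  rewrite (_ : (fun _ => _) = (f j * g j) + (fun y => \sum_(j <- s) f j y * g j y)).
    by apply: differentiableD => //; exact: differentiableM.
  by apply/funext => y; rewrite big_cons.
rewrite E deriveD; first last.
- exact: diff_derivable.
- by apply: diff_derivable; exact: differentiableM.
rewrite IH big_cons; congr (_ + _).
rewrite deriveM; [|exact: diff_derivable|exact: diff_derivable].
by rewrite /GRing.scale /= addrC mulrC.
Qed.

End DerivativeLemmas.

Section ExteriorDerivative.
Variables (R : realType) (n : nat) (M : manifold R n).
Implicit Types p : M.

Lemma multilinear_form_loc k (a : tfield M k) p x : is_form a -> multilinear (form_loc a p x).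
Proof. by move=> [ma _]; apply: multilinear_mulmxr; exact: (ma _).1. Qed.

Lemma alternating_form_loc k (a : tfield M k) p x :
  is_form a -> Defs.alternating (form_loc a p x).
Proof. by move=> [ma _]; apply: alternating_mulmxr; exact: (ma _).2. Qed.

Lemma multilinear_mv_loc k (a : tfield M k) p x :
  is_multivector a -> multilinear (mv_loc a p x).
Proof. by move=> [ma _]; apply: multilinear_mulmxr; exact: (ma _).1. Qed.

Lemma alternating_mv_loc k (a : tfield M k) p x :
  is_multivector a -> Defs.alternating (mv_loc a p x).
Proof. by move=> [ma _]; apply: alternating_mulmxr; exact: (ma _).2. Qed.

Lemma form_loc_differentiable k (a : tfield M k) p A :
  is_form a -> differentiable (fun x => form_loc a p x A : R) (chart p p).
Proof.
by move=> [_ sa]; apply: (smooth_differentiable (sa p A)); exact/chart_cimg/mem_cdom.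
Qed.

Lemma mv_loc_differentiable k (a : tfield M k) p A :
  is_multivector a -> differentiable (fun x => mv_loc a p x A : R) (chart p p).
Proof.
by move=> [_ sa]; apply: (smooth_differentiable (sa p A)); exact/chart_cimg/mem_cdom.
Qed.

Lemma form_loc_center k (a : tfield M k) p A : form_loc a p (chart p p) A = a p A.
Proof.
have pp := mem_cdom p.
by rewrite /form_loc (chartK pp) (chart_change_id pp) mulmx1.
Qed.

Lemma mv_loc_center k (a : tfield M k) p A : mv_loc a p (chart p p) A = a p A.
Proof.
have pp := mem_cdom p.
by rewrite /mv_loc (chartK pp) (chart_change_id pp) trmx1 mulmx1.
Qed.

Lemma multilinear_ext_d k (a : tfield M k) p : is_form a -> multilinear (ext_d a p).
Proof.
move=> fa A B C j b c Ej EB EC; rewrite /ext_d 2!mulr_sumr -big_split; apply: eq_bigr => i _ /=.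
rewrite mulrCA [c * _]mulrCA -mulrDr; congr (_ * _).
case: (eqVneq i j) => [->|ij].
  rewrite Ej EB EC; apply: derive_linear; exact: form_loc_differentiable.
move/eq_row'P : EB => EB; move/eq_row'P : EC => EC; rewrite EB // EC //.
have -> : (fun x => form_loc a p x (row' i A) : R) =
    (b *: (fun x => form_loc a p x (row' i B) : R)) +
    (c *: (fun x => form_loc a p x (row' i C) : R)).
  apply/funext => x; have [l jl] : exists l, j = lift i l.
    by case: (unliftP i j) ij => [l ->|->]; [exists l|rewrite eqxx].
  have rl (X : 'M[R]_(k.+1, n)) l' : row l' (row' i X) = row (lift i l') X.
    by apply/rowP => d; rewrite !mxE.
  apply: (multilinear_row (i := l) (multilinear_form_loc p x fa)).
  - by rewrite !rl -jl.
  - by move=> l' l'l; rewrite !rl EB // jl; apply: contra l'l => /eqP/lift_inj->.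
  - by move=> l' l'l; rewrite !rl EC // jl; apply: contra l'l => /eqP/lift_inj->.
have dB := form_loc_differentiable p (row' i B) fa.
have dC := form_loc_differentiable p (row' i C) fa.
rewrite deriveD; [|by apply/diff_derivable/differentiableZ..].
by rewrite !deriveZ //; exact: diff_derivable.
Qed.

(** Two neighbouring equal rows are enough to consider. Terms that omit a third row keep both and
    vanish; the other two omit one of the equal rows each and have opposite signs. *)
Lemma alternating_ext_d k (a : tfield M k) p : is_form a -> Defs.alternating (ext_d a p).
Proof.
move=> fa; apply: alternating_adjacent; first exact: multilinear_ext_d.
move=> A i j ij Aij; have ji : j != i by rewrite -val_eqE /= ij gtn_eqF.
rewrite /ext_d (bigD1 i) //= (bigD1 j) //= big1 ?addr0 => [|l /andP[li lj]]; last first.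
  rewrite (_ : (fun _ => _) = cst 0) ?derive_cst ?mulr0 //; apply/funext => x /=.
  have [i' ii'] : exists i', i = lift l i'.
    by case: (unliftP l i) li => [i' ->|->]; [exists i'|rewrite eqxx].
  have [j' jj'] : exists j', j = lift l j'.
    by case: (unliftP l j) lj => [j' ->|->]; [exists j'|rewrite eqxx].
  apply: (alternating_form_loc p x fa (i := i') (j := j')).
    by apply: contra ji => /eqP ij'; rewrite ii' jj' ij'.
  have rl l' : row l' (row' l A) = row (lift l l') A by apply/rowP => d; rewrite !mxE.
  by rewrite !rl -ii' -jj'.
have -> : row' j A = row' i A.
  apply/matrixP => l d; rewrite !mxE.
  case: (eqVneq (val l) i) => [li|li].
    have -> : lift j l = i by apply: val_inj; rewrite /= /bump ij li ltnn.
    have -> : lift i l = j by apply: val_inj; rewrite /= /bump ij li leqnn.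
    by have /rowP/(_ d) := Aij; rewrite !mxE.
  congr (A _ d); apply: val_inj; rewrite /= /bump ij.
  by rewrite [in RHS]leq_eqVlt eq_sym (negPf li).
by rewrite Aij ij exprS mulN1r mulNr subrr.
Qed.

End ExteriorDerivative.

(** * Adapted bases *)

Section Pointwise.
Variable R : realType.

(** In the dual bases [(D, N)] and [(h, K)] a multivector that sees only the first block meets only
    index functions with values there, so [contract_single] applies. Used with the blocks in either
    order, for horizontal and for vertical multivectors. *)
Lemma contract_block n m k l (D : 'M[R]_(n, m)) (h : 'M[R]_(m, n)) (N : 'M[R]_(n, k))
    (K : 'M[R]_(k, n)) (Q : 'M[R]_(m, n) -> R) (f : 'M[R]_(m + l, n) -> R) (A : 'M[R]_(l, n)) :
  multilinear Q -> Defs.alternating Q -> multilinear f -> Defs.alternating f ->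
  D *m h + N *m K = 1%:M -> h *m N = 0 -> (forall X, Q (X *m h^T *m D^T) = Q X) ->
  Defs.contract Q f A = Q D^T * f (col_mx (rowsub (@rev_ord m) h) A).
Proof.
move=> mQ aQ mf af UT hN Qh.
rewrite (@contract_single _ _ _ _ _ Q f A (col_mx D^T N^T) (col_mx h K) (lshift k)) //.
- congr (Q _ * f (col_mx _ _)).
    by apply/row_matrixP => i; rewrite row_rowsub rowKu.
  by apply/row_matrixP => i; rewrite !row_rowsub rowKu.
- by rewrite tr_col_mx !trmxK mul_row_col.
- exact: lshift_inj.
move=> s [i si]; rewrite -Qh; set X := _ *m D^T.
rewrite (multilinear_row0 (i := i) mQ) ?mul0r // /X !row_mul row_rowsub.
case: (split_ordP (s i)) si => j ->; first by rewrite codom_f.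
by move=> _; rewrite rowKd -row_mul -trmx_mul hN trmx0 row0 mul0mx.
Qed.

Lemma det2 (X : 'M[R]_2) :
  \det X = X (o2 0) (o2 0) * X (o2 1) (o2 1) - X (o2 0) (o2 1) * X (o2 1) (o2 0).
Proof.
have ne : o2 0 != o2 1 by rewrite -val_eqE /= !inordK.
rewrite /determinant sum_S2 odd_tperm odd_perm1 ne expr0 expr1 mul1r mulN1r.
have P (F : 'I_2 -> R) : \prod_i F i = F (o2 0) * F (o2 1).
  rewrite !big_ord_recl big_ord0 mulr1.
  by congr (_ * _); congr F; apply: val_inj; rewrite /= inordK.
by rewrite !P !perm1 tpermL tpermR.
Qed.

Lemma sum3 (F : 'I_3 -> R) : \sum_i F i = F (o3 0) + (F (o3 1) + F (o3 2)).
Proof.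
rewrite !big_ord_recl big_ord0 addr0.
by do ![congr (_ + _)]; congr F; apply: val_inj; rewrite /= inordK.
Qed.

Lemma det3 (X : 'M[R]_3) (x := fun i j => X (o3 i) (o3 j)) :
  \det X = x 0 0 * x 1 1 * x 2 2 + x 0 1 * x 1 2 * x 2 0 + x 0 2 * x 1 0 * x 2 1
   - x 0 1 * x 1 0 * x 2 2 - x 0 2 * x 1 1 * x 2 0 - x 0 0 * x 1 2 * x 2 1.
Proof.
have n10 : o3 1 != o3 0 by rewrite -val_eqE /= !inordK.
have n20 : o3 2 != o3 0 by rewrite -val_eqE /= !inordK.
have n21 : o3 2 != o3 1 by rewrite -val_eqE /= !inordK.
have n01 := n10; have n02 := n20; have n12 := n21.
rewrite eq_sym in n01; rewrite eq_sym in n02; rewrite eq_sym in n12.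
rewrite /determinant sum_S3 !odd_mul_tperm !odd_tperm odd_perm1 n01 n02 n12 /=.
have P (F : 'I_3 -> R) : \prod_i F i = F (o3 0) * (F (o3 1) * F (o3 2)).
  rewrite !big_ord_recl big_ord0 mulr1.
  by do ![congr (_ * _)]; congr F; apply: val_inj; rewrite /= inordK.
rewrite !P !permM !perm1.
rewrite ?(tpermL, tpermR, @tpermD _ _ _ (o3 0), @tpermD _ _ _ (o3 1), @tpermD _ _ _ (o3 2)) //.
by rewrite expr0 expr1 /x; ring.
Qed.

Lemma multilinear_expand2 n m (f : 'M[R]_(2, n) -> R) (X : 'M[R]_(2, m)) (T : 'M[R]_(m, n)) :
  multilinear f ->
  f (X *m T) = \sum_i \sum_j X (o2 0) i * X (o2 1) j * f (mxrows [:: row i T; row j T]).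
Proof.
move=> mf; rewrite multilinear_expand // big_ffcons; apply: eq_bigr => i _.
rewrite big_ffcons; apply: eq_bigr => j _.
pose e : {ffun 'I_0 -> 'I_m} := ffun0 (card_ord 0).
rewrite (big_pred1 e) => [|s]; last by apply/esym/eqP/ffunP => -[].
have e0 : o2 0 = ord0 by apply: val_inj; rewrite /= inordK.
have e1 : o2 1 = lift ord0 ord0 by apply: val_inj; rewrite /= inordK.
rewrite big_ord_recl big_ord_recl big_ord0 mulr1 ffcons0 ffconsS ffcons0 -e1 -e0.
congr (_ * f _); apply/row_matrixP; apply: o2P; rewrite row_rowsub row_mxrows inordK //=.
  by rewrite e0 ffcons0.
by rewrite e1 ffconsS ffcons0.
Qed.

(** Rank factorisation of the vertical projection [1%:M - D *m h], an idempotent of rank 3. *)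
Lemma adapted_basis (D : 'M[R]_(5, 2)) (h : 'M[R]_(2, 5)) : h *m D = 1%:M ->
  exists (N : 'M[R]_(5, 3)) (K : 'M[R]_(3, 5)),
    [/\ D *m h + N *m K = 1%:M, h *m N = 0, K *m D = 0 & K *m N = 1%:M].
Proof.
move=> hD; pose g := 1%:M - D *m h.
have gD : g *m D = 0 by rewrite mulmxBl mul1mx -mulmxA hD mulmx1 subrr.
have hg : h *m g = 0 by rewrite mulmxBr mulmx1 mulmxA hD mul1mx subrr.
have gg : g *m g = g by rewrite {1}/g mulmxBl mul1mx -mulmxA hg mulmx0 subr0.
have rD : \rank D = 2.
  by apply/eqP; have : row_full D by apply/row_fullP; exists h.
have rg : \rank g = 3.
  have <- : \rank (kermx D) = 3 by rewrite mxrank_ker rD.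
  apply/eqP; rewrite eqn_leq !mxrankS //; last exact/sub_kermxP.
  have -> : kermx D = kermx D *m g by rewrite mulmxBr mulmx1 mulmxA mulmx_ker mul0mx subr0.
  exact: submxMl.
have fact r (G : 'M[R]_5) : \rank G = r -> exists (N : 'M[R]_(5, r)) (K : 'M[R]_(r, 5)),
    [/\ G = N *m K, row_full N & row_free K].
  move=> <-; exists (col_base G), (row_base G); split.
  - by rewrite mulmx_base.
  - by rewrite col_base_full.
  - by rewrite row_base_free.
have [N [K [gNK fN fK]]] := fact 3 g rg.
exists N, K; split.
- by rewrite -gNK /g addrC subrK.
- by apply: (row_free_inj fK); rewrite -mulmxA -gNK hg mul0mx.
- by apply: (row_full_inj fN); rewrite mulmxA -gNK gD mulmx0.
- apply: (row_free_inj fK); apply: (row_full_inj fN).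
  by rewrite mul1mx -mulmxA !mulmxA -gNK -mulmxA -gNK gg.
Qed.

End Pointwise.

Section RowSwaps.
Variables (R : realType) (n : nat).

Lemma col_mx_rows3 (X : 'M[R]_(2, n)) (v : 'rV[R]_n) :
  col_mx X v = mxrows [:: row (o2 0) X; row (o2 1) X; v] :> 'M[R]_(2 + 1, n).
Proof.
apply/row_matrixP => l; case: (@split_ordP 2 1 l) => a ->.
  rewrite (@rowKu _ 2 1) row_mxrows.
  by move: a; apply: o2P; rewrite /= inordK.
by rewrite (@rowKd _ 2 1) row_mxrows ord1 row_id.
Qed.

Variables (W : 'M[R]_(3, n) -> R) (u v w : 'rV[R]_n).
Hypotheses (mW : multilinear W) (aW : Defs.alternating W).

Lemma mxrows3_swap01 : W (mxrows [:: v; u; w]) = - W (mxrows [:: u; v; w]).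
Proof.
have n1 : o3 0 != o3 1 by rewrite -val_eqE /= !inordK.
have n2 : o3 0 != o3 2 by rewrite -val_eqE /= !inordK.
have n3 : o3 1 != o3 2 by rewrite -val_eqE /= !inordK.
rewrite -(alternating_tperm _ mW aW n1); congr W.
by apply/row_matrixP; apply: o3P; rewrite row_mxrows /=; apply/rowP => c; rewrite !mxE;
  rewrite ?tpermL ?tpermR ?(tpermD n2 n3) !inordK.
Qed.

Lemma mxrows3_swap12 : W (mxrows [:: u; w; v]) = - W (mxrows [:: u; v; w]).
Proof.
have n1 : o3 1 != o3 0 by rewrite -val_eqE /= !inordK.
have n2 : o3 2 != o3 0 by rewrite -val_eqE /= !inordK.
have n3 : o3 1 != o3 2 by rewrite -val_eqE /= !inordK.
rewrite -(alternating_tperm _ mW aW n3); congr W.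
by apply/row_matrixP; apply: o3P; rewrite row_mxrows /=; apply/rowP => c; rewrite !mxE;
  rewrite ?tpermL ?tpermR ?(tpermD n1 n2) !inordK.
Qed.

End RowSwaps.

(** * Pointwise algebra of an almost coupling bivector *)

Section PointAlgebra.
Variable R : realType.
Variables (D : 'M[R]_(5, 2)) (h : 'M[R]_(2, 5)) (N : 'M[R]_(5, 3)) (K : 'M[R]_(3, 5)).
Hypotheses (hD : h *m D = 1%:M) (DhNK : D *m h + N *m K = 1%:M).
Hypotheses (hN : h *m N = 0) (KD : K *m D = 0) (KN : K *m N = 1%:M).

Let g : 'M[R]_5 := 1%:M - D *m h.

Definition frame : 'M[R]_5 := col_mx h K.
Definition coframe : 'M[R]_5 := col_mx D^T N^T.

Lemma coframe_frame : coframe^T *m frame = 1%:M.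
Proof.
have : (col_mx D^T N^T)^T *m col_mx h K = 1%:M by rewrite tr_col_mx !trmxK mul_row_col.
exact.
Qed.

Lemma row_frame_hor i : (i < 2)%N -> row (o5 i) frame = row (o2 i) h.
Proof.
move=> i2; have -> : o5 i = lshift 3 (o2 i).
  by apply: val_inj; rewrite /= !inordK // (leq_trans i2).
exact: rowKu.
Qed.

Lemma row_frame_vert i : (i < 3)%N -> row (o5 i.+2) frame = row (o3 i) K.
Proof.
move=> i2; have -> : o5 i.+2 = rshift 2 (o3 i).
  by apply: val_inj; rewrite /= !inordK.
exact: rowKd.
Qed.

Lemma row_coframe_hor i : (i < 2)%N -> row (o5 i) coframe = row (o2 i) D^T.
Proof.
move=> i2; have -> : o5 i = lshift 3 (o2 i).
  by apply: val_inj; rewrite /= !inordK // (leq_trans i2).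
exact: rowKu.
Qed.

Lemma row_coframe_vert i : (i < 3)%N -> row (o5 i.+2) coframe = row (o3 i) N^T.
Proof.
move=> i2; have -> : o5 i.+2 = rshift 2 (o3 i).
  by apply: val_inj; rewrite /= !inordK.
exact: rowKd.
Qed.

Let gE : g = N *m K. Proof. by rewrite /g -DhNK addrC addKr. Qed.
Let hg : h *m g = 0. Proof. by rewrite gE mulmxA hN mul0mx. Qed.
Let Kg : K *m g = K. Proof. by rewrite gE mulmxA KN mul1mx. Qed.
Let gg : g *m g = g. Proof. by rewrite {1}gE -mulmxA Kg gE. Qed.
Let gD : g *m D = 0. Proof. by rewrite gE -mulmxA KD mulmx0. Qed.
Let gN : g *m N = N. Proof. by rewrite gE -mulmxA KN mulmx1. Qed.
Let h'E : 1%:M - g = D *m h. Proof. by rewrite /g opprB addrCA subrr addr0. Qed.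

Section Bivector.
Variable P : 'M[R]_(2, 5) -> R.
Hypotheses (mP : multilinear P) (aP : Defs.alternating P).
Hypothesis coupling : forall A, part (1%:M - g)^T g^T 1 P A = 0.

Lemma coupling_mixed (u w : 'rV[R]_5) : u *m g^T = 0 -> w *m g^T = w ->
  P (mxrows [:: u; w]) = 0.
Proof.
move=> ug wg; have := coupling (mxrows [:: u; w]).
rewrite part1_2 !row_mxrows2 ug wg linearB /= trmx1 !mulmxBr !mulmx1 ug wg subr0.
set X := mxrows [:: 0; _]; rewrite (multilinear_row0 (i := o2 0) mP (A := X)) ?addr0 //.
by rewrite row_mxrows2.
Qed.

(** Each argument is the sum of a part along [D^T] and a part along [N^T]. The mixed terms vanish by
    coupling, and on the plane an alternating function of two arguments is a multiple of the
    determinant. *)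
Lemma coupling_split A :
  P A = \det (A *m h^T) * P D^T + P (A *m K^T *m N^T).
Proof.
rewrite -(alternating_det _ _ mP aP).
set X := A *m h^T *m D^T; set Y := A *m K^T *m N^T.
have AXY : A = X + Y.
  rewrite /X /Y -!mulmxA -!trmx_mul -mulmxDr -linearD /= DhNK trmx1 mulmx1 //.
have Xg i : row i X *m g^T = 0.
  by rewrite -row_mul /X -!mulmxA -!trmx_mul gD mul0mx trmx0 mulmx0 row0.
have Yg i : row i Y *m g^T = row i Y.
  by rewrite -row_mul /Y -!mulmxA -!trmx_mul gN.
have PN := fun u v => mxrows_swap u v mP aP.
have E Z : P Z = P (mxrows [:: row (o2 0) Z; row (o2 1) Z]) by rewrite {1}[Z]mxrows2E.
have addl u u' v : P (mxrows [:: u + u'; v]) = P (mxrows [:: u; v]) + P (mxrows [:: u'; v]).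
  rewrite (multilinear_row (A := mxrows [:: u + u'; v]) (B := mxrows [:: u; v])
   (C := mxrows [:: u'; v]) (i := o2 0) (b := 1) (c := 1) mP) ?mul1r ?row_mxrows2 ?scale1r //.
  - by apply: o2P; rewrite ?eqxx // !row_mxrows2.
  - by apply: o2P; rewrite ?eqxx // !row_mxrows2.
have addr u v v' : P (mxrows [:: u; v + v']) = P (mxrows [:: u; v]) + P (mxrows [:: u; v']).
  by rewrite PN addl opprD -!PN.
have rD i : row i A = row i X + row i Y by rewrite -linearD -AXY.
rewrite [LHS]E !rD addl !addr -!E.
rewrite [P (mxrows [:: row _ X; row _ Y])]coupling_mixed // addr0.
by rewrite [P (mxrows [:: row _ Y; row _ X])]PN coupling_mixed // oppr0 add0r.
Qed.

(** Reversing two rows, or three as in [flip_rows3], is a single transposition. This is the origin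
    of the minus signs in full contractions, and of the values -1 below. *)
Lemma flip_rows2 n (X : 'M[R]_(2, n)) (A : 'M[R]_(0, n)) :
  col_mx (rowsub (@rev_ord 2) X) A = xrow (o2 0) (o2 1) X :> 'M[R]_(2 + 0, n).
Proof.
apply/row_matrixP => i; case: (split_ordP i) => j -> //; last by case: j.
rewrite rowKu row_rowsub; apply/rowP => c; rewrite !mxE; congr (X _ c).
have -> : lshift 0 j = j by apply: val_inj.
by move: j; apply: o2P; rewrite ?tpermL ?tpermR; apply: val_inj; rewrite /= !inordK.
Qed.

Lemma flip_rows3 n (X : 'M[R]_(3, n)) (A : 'M[R]_(0, n)) :
  col_mx (rowsub (@rev_ord 3) X) A = xrow (o3 0) (o3 2) X :> 'M[R]_(3 + 0, n).
Proof.
apply/row_matrixP => i; case: (split_ordP i) => j -> //; last by case: j.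
rewrite rowKu row_rowsub; apply/rowP => c; rewrite !mxE; congr (X _ c).
have -> : lshift 0 j = j by apply: val_inj.
have n1 : o3 1 != o3 0 by rewrite -val_eqE /= !inordK.
have n2 : o3 1 != o3 2 by rewrite -val_eqE /= !inordK.
move: j; apply: o3P; rewrite ?tpermL ?tpermR ?(tpermD _ _) 1?eq_sym //;
  by apply: val_inj; rewrite /= !inordK.
Qed.

Let o2n : o2 0 != o2 1. Proof. by rewrite -val_eqE /= !inordK. Qed.
Let o3n : o3 0 != o3 2. Proof. by rewrite -val_eqE /= !inordK. Qed.

Section Kappa.
Variable w2 : 'M[R]_(2, 2) -> R.
Hypotheses (mw : multilinear w2) (aw : Defs.alternating w2).

Lemma contract_pullback (Q : 'M[R]_(2, 5) -> R) (A : 'M[R]_(0, 5)) :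
  multilinear Q -> Defs.alternating Q -> (forall X, Q (X *m h^T *m D^T) = Q X) ->
  @Defs.contract R 5 2 0 Q (fun X => w2 (X *m D)) A = - (Q D^T * w2 1%:M).
Proof.
move=> mQ aQ Qh.
rewrite (@contract_block R 5 2 3 0 D h N K Q (fun X => w2 (X *m D)) A mQ aQ) //.
- rewrite flip_rows2 -mulrN; congr (_ * _).
  rewrite /xrow row_permE -mulmxA hD -row_permE.
  exact: (alternating_tperm 1%:M mw aw o2n).
- exact: multilinear_mulmxr.
- exact: alternating_mulmxr.
Qed.

Lemma contract_area (psi : 'M[R]_(2, 2) -> R) (A : 'M[R]_(0, 2)) :
  multilinear psi -> Defs.alternating psi ->
  @Defs.contract R 2 2 0 psi w2 A = - (psi 1%:M * w2 1%:M).
Proof.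
move=> mpsi apsi.
rewrite (@contract_block R 2 2 0 0 1%:M 1%:M 0 0 psi w2 A mpsi apsi mw aw).
- by rewrite flip_rows2 trmx1 -mulrN (alternating_tperm 1%:M mw aw o2n).
- by rewrite mulmx1 mulmx0 addr0.
- by rewrite mulmx0.
- by move=> X; rewrite trmx1 !mulmx1.
Qed.

Lemma kappa_point (A : 'M[R]_(0, 5)) :
  - @Defs.contract R 5 2 0 (part (1%:M - g)^T g^T 2 P) (fun X => w2 (X *m D)) A =
  w2 1%:M * P D^T.
Proof.
have E X : part (1%:M - g)^T g^T 2 P X = P (X *m h^T *m D^T).
  by rewrite partk h'E trmx_mul mulmxA.
rewrite contract_pullback ?opprK.
- by rewrite E -(trmx_mul h) hD trmx1 mul1mx mulrC.
- exact: multilinear_part.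
- exact: alternating_part.
- move=> X; rewrite !E; congr P; rewrite -!mulmxA; congr (_ *m _).
  by rewrite (mulmxA D^T) -(trmx_mul h) hD trmx1 mul1mx.
Qed.

End Kappa.

(** [P] turns a base covector into [P D^T] times the other lifted basis vector, up to sign. Applied
    at every point near p, it gives the identities that [jet_bi_cov] differentiates. *)
Lemma coupling_conormal (z : 'rV[R]_5) :
  (P (mxrows [:: row (o2 0) D^T; z]) = P D^T * (z *m h^T) 0 (o2 1)) *
  (P (mxrows [:: row (o2 1) D^T; z]) = - (P D^T * (z *m h^T) 0 (o2 0))).
Proof.
have ne : o2 1 != o2 0 by rewrite eq_sym.
have split i : P (mxrows [:: row (o2 i) D^T; z]) =
    \det (mxrows [:: row (o2 i) D^T; z] *m h^T) * P D^T.
  have Z : row (o2 0) (mxrows [:: row (o2 i) D^T; z] *m K^T *m N^T) = 0.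
    by rewrite !row_mul row_mxrows2 -row_mul -trmx_mul KD trmx0 row0 mul0mx.
  by rewrite coupling_split (multilinear_row0 mP Z) addr0.
have rE (X : 'M[R]_2) a b : X a b = row a X 0 b by rewrite mxE.
have e0 i j : (mxrows [:: row (o2 i) D^T; z] *m h^T) (o2 0) j = (j == o2 i)%:R.
  by rewrite rE row_mul row_mxrows2 -row_mul -trmx_mul hD trmx1 !mxE eq_sym.
have e1 i j : (mxrows [:: row (o2 i) D^T; z] *m h^T) (o2 1) j = (z *m h^T) 0 j.
  by rewrite rE row_mul row_mxrows2.
rewrite !split !det2 !e0 !e1 !eqxx (negPf ne) (negPf o2n).
by split; rewrite /=; ring.
Qed.

Section Beta.
Variable W : 'M[R]_(3, 5) -> R.
Hypotheses (mW : multilinear W) (aW : Defs.alternating W).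
Hypothesis Wg : forall A, W (A *m g) = W A.

Lemma volume_insert (v : 'rV[R]_5) : v *m g = 0 ->
  forall u w, W (mxrows [:: v; u; w]) = 0.
Proof.
move=> vg u w; rewrite -Wg (multilinear_row0 (i := o3 0) mW) //.
by rewrite row_mul row_mxrows3 vg.
Qed.

Definition beta_pt (v : 'rV[R]_5) : R :=
  - @Defs.contract R 5 2 1 (part (1%:M - g)^T g^T 0 P) W v.

Lemma multilinear_beta : multilinear beta_pt.
Proof.
move=> A B C i b c Ei EB EC; rewrite /beta_pt.
by rewrite (@multilinear_contract _ _ 2 1 _ W mW A B C i b c Ei EB EC) opprD !mulrN.
Qed.

Let Wgc (X : 'M[R]_(2, 5)) (v : 'rV[R]_5) :
  W (col_mx X v : 'M[R]_(2 + 1, 5)) = W (col_mx (X *m g) (v *m g) : 'M[R]_(2 + 1, 5)).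
Proof. by rewrite -[LHS]Wg -(mul_col_mx X v g). Qed.

Lemma beta_vert v : beta_pt (v *m g) = beta_pt v.
Proof.
rewrite /beta_pt /Defs.contract; congr (- (_ * _)); apply: eq_bigr => s _; congr (_ * _).
by rewrite [LHS]Wgc [RHS]Wgc -(mulmxA v) gg.
Qed.

Lemma sum_ffun2 m (F : 'I_m -> 'I_m -> R) :
  \sum_(s : {ffun 'I_2 -> 'I_m}) F (s (o2 0)) (s (o2 1)) = \sum_i \sum_j F i j.
Proof.
rewrite big_ffcons; apply: eq_bigr => i _; rewrite big_ffcons; apply: eq_bigr => j _.
pose e : {ffun 'I_0 -> 'I_m} := ffun0 (card_ord 0).
rewrite (big_pred1 e) => [|s]; last by apply/esym/eqP/ffunP => -[].
have -> : o2 0 = ord0 by apply: val_inj; rewrite /= inordK.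
have -> : o2 1 = lift ord0 ord0 by apply: val_inj; rewrite /= inordK.
by rewrite ffcons0 ffconsS ffcons0.
Qed.

(** The vertical part of [P] may be replaced by [P] itself because [W] only sees vertical parts of
    its arguments. Any dual pair of bases is allowed, in particular one that is constant in a chart;
    the minus sign of [beta_pt] is absorbed by restoring the order of the two inserted vectors. *)
Lemma betaE (U T : 'M[R]_5) v : U^T *m T = 1%:M ->
  beta_pt v = 2^-1 * \sum_i \sum_j
    P (mxrows [:: row i U; row j U]) * W (mxrows [:: row i T; row j T; v]).
Proof.
move=> UT; rewrite /beta_pt.
rewrite (@contract_basis _ 5 2 1 5 _ W v U T _ mW UT); last exact: multilinear_part.
rewrite -mulrN -sumrN; congr (_ * _).
have E s : part (1%:M - g)^T g^T 0 P (rowsub s U) = P (rowsub s (U *m g^T)).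
  by rewrite part0 mul_rowsub_mx.
rewrite sumrN; under eq_bigr do rewrite E.
have Wg' (s : 'I_2 -> 'I_5) : W (col_mx (rowsub s T) v : 'M[R]_(2 + 1, 5)) =
    W (col_mx (rowsub s (T *m g)) v : 'M[R]_(2 + 1, 5)).
  by rewrite [LHS]Wgc [RHS]Wgc !mul_rowsub_mx -[T *m g *m g]mulmxA gg.
(* The vertical projection moves from the arguments of [P] to those of [W], where it has no
   effect. *)
rewrite (@contract_transfer R 5 2 1 5 5 P W v (U *m g^T) T U (T *m g) mP mW); last first.
  by rewrite trmx_mul trmxK -mulmxA UT mulmx1 mulmxA UT mul1mx.
rewrite -sumrN -(sum_ffun2 (fun i j => P (mxrows [:: row i U; row j U]) * W (mxrows [:: row i T; row j T; v]))).
apply: eq_bigr => s _; rewrite -mulrN -Wg'; congr (P _ * _).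
  by apply/row_matrixP; apply: o2P; rewrite row_rowsub row_mxrows inordK.
rewrite col_mx_rows3 !row_rowsub.
have -> : rev_ord (o2 0) = o2 1 by apply: val_inj; rewrite /= !inordK.
have -> : rev_ord (o2 1) = o2 0 by apply: val_inj; rewrite /= !inordK.
by rewrite (mxrows3_swap01 (row (s (o2 0)) T) (row (s (o2 1)) T) v mW aW) opprK.
Qed.

Lemma contract_volume (Q : 'M[R]_(3, 5) -> R) (A : 'M[R]_(0, 5)) :
  multilinear Q -> Defs.alternating Q -> (forall X, Q (X *m g^T) = Q X) ->
  @Defs.contract R 5 3 0 Q W A = - (Q N^T * W K).
Proof.
move=> mQ aQ Qg.
rewrite (@contract_block R 5 3 2 0 N K D h Q W A mQ aQ mW aW) //.
- by rewrite flip_rows3 -mulrN (alternating_tperm K mW aW o3n).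
- by rewrite addrC.
- by move=> X; rewrite -mulmxA -trmx_mul -gE.
Qed.

Let P' i j := P (mxrows [:: row (o5 i) coframe; row (o5 j) coframe]).
Let W' i j l := W (mxrows [:: row (o5 i) frame; row (o5 j) frame; row (o5 l) frame]).

Lemma coframe_antisym i j : P' j i = - P' i j.
Proof. exact: mxrows_swap. Qed.

Lemma frame_antisym1 i j l : W' j i l = - W' i j l.
Proof. exact: mxrows3_swap01. Qed.

Lemma frame_antisym2 i j l : W' i l j = - W' i j l.
Proof. exact: mxrows3_swap12. Qed.

Lemma volume_frame_hor i j l : (i < 2)%N -> W' i j l = 0.
Proof. by move=> i2; apply: volume_insert; rewrite row_frame_hor // -row_mul hg row0. Qed.

Lemma bivector_coframe_mixed i a : (i < 2)%N -> (1 < a < 5)%N -> P' i a = 0.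
Proof.
move=> i2; case: a => [|[|a]] // a3; apply: coupling_mixed.
  by rewrite row_coframe_hor // -row_mul -trmx_mul gD trmx0 row0.
by rewrite row_coframe_vert // -row_mul -trmx_mul gN.
Qed.

Lemma bivector_coframe_hor : P' 0 1 = P D^T.
Proof. by rewrite /P' !row_coframe_hor // -mxrows2E. Qed.

Lemma volume_frame_vert : W' 2 3 4 = W K.
Proof. by rewrite /W' !row_frame_vert // -mxrows3E. Qed.

Lemma beta_frame l : beta_pt (row (o5 l) frame) =
  2^-1 * sumn5 (fun i => sumn5 (fun j => P' i j * W' i j l)).
Proof. by rewrite (betaE _ coframe_frame) sum5 !sum5. Qed.

Lemma beta_frame_vert :
  (beta_pt (row (o3 0) K) = W K * P' 3 4) *
  (beta_pt (row (o3 1) K) = - (W K * P' 2 4)) *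
  (beta_pt (row (o3 2) K) = W K * P' 2 3).
Proof.
have := be_components coframe_antisym frame_antisym1 frame_antisym2
  (fun j l => @volume_frame_hor 0 j l isT) (fun j l => @volume_frame_hor 1 j l isT)
  bivector_coframe_hor (fun a => @bivector_coframe_mixed 0 a isT)
  (fun a => @bivector_coframe_mixed 1 a isT).
rewrite -!beta_frame volume_frame_vert !row_frame_vert // => -[[[[_ _] e2] e3] e4].
by do ![split].
Qed.

(** The horizontal terms agree because [psi] is its value on the basis times a determinant. For the
    vertical ones, [Q] is [Q N^T] times a 3 by 3 determinant whose first row holds the values of
    beta on [K]; these are [W K] times components of [P], and [Q N^T * W K = -1] removes the
    volume. *)
Lemma coupling_formula (w2 psi : 'M[R]_2 -> R) (Q : 'M[R]_(3, 5) -> R) (A : 'M[R]_(2, 5)) :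
  multilinear psi -> Defs.alternating psi -> multilinear Q -> Defs.alternating Q ->
  (forall X, Q (X *m g^T) = Q X) -> Q N^T * W K = -1 -> psi 1%:M * w2 1%:M = 1 ->
  P A = (w2 1%:M * P D^T) * psi (A *m h^T) +
    - Q (col_mx (\row_(i < 5) beta_pt (delta_mx 0 i)) A).
Proof.
move=> mpsi apsi mQ aQ Qg qf pw.
rewrite coupling_split; congr (_ + _).
  have -> : psi (A *m h^T) = \det (A *m h^T) * psi 1%:M.
    by rewrite -(alternating_det _ _ mpsi apsi) mulmx1.
  rewrite -[LHS]mulr1 -[X in _ * X = _]pw; ring.
set xi := \row_i _; set y := A *m K^T.
have xiK a : (xi *m K^T) 0 a = beta_pt (row a K).
  rewrite [in RHS](row_sum_delta (row a K)) (multilinear1_sum _ _ _ multilinear_beta).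
  by rewrite mxE; apply: eq_bigr => c _; rewrite !mxE mulrC.
have -> : Q (col_mx xi A) = \det (col_mx (xi *m K^T) y : 'M[R]_(1 + 2, 3)) * Q N^T.
  rewrite -(alternating_det _ _ mQ aQ) -[LHS]Qg gE trmx_mul mulmxA.
  by rewrite (mul_col_mx xi A K^T).
have c0 j : (col_mx (xi *m K^T) y : 'M[R]_(1 + 2, 3)) (o3 0) j = beta_pt (row j K).
  have -> : o3 0 = lshift 2 (ord0 : 'I_1) by apply: val_inj; rewrite /= inordK.
  by rewrite col_mxEu xiK.
have c1 j : (col_mx (xi *m K^T) y : 'M[R]_(1 + 2, 3)) (o3 1) j = y (o2 0) j.
  have -> : o3 1 = rshift 1 (o2 0) by apply: val_inj; rewrite /= !inordK.
  by rewrite col_mxEd.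
have c2 j : (col_mx (xi *m K^T) y : 'M[R]_(1 + 2, 3)) (o3 2) j = y (o2 1) j.
  have -> : o3 2 = rshift 1 (o2 1) by apply: val_inj; rewrite /= !inordK.
  by rewrite col_mxEd.
rewrite det3 !c0 !c1 !c2 !beta_frame_vert.
have Pn i j : (i < 3)%N -> (j < 3)%N ->
    P (mxrows [:: row (o3 i) N^T; row (o3 j) N^T]) = P' i.+2 j.+2.
  by move=> i3 j3; rewrite /P' !row_coframe_vert.
have Pii i : P' i i = 0.
  by have /eqP := coframe_antisym i i; rewrite -addr_eq0 -mulr2n mulrn_eq0 /= => /eqP.
rewrite multilinear_expand2 // !sum3 !Pn // !Pii.
rewrite (coframe_antisym 2 3) (coframe_antisym 2 4) (coframe_antisym 3 4).
have qf1 : 1 = - (Q N^T * W K) by rewrite qf opprK.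
rewrite -[LHS]mulr1 [X in _ * X = _]qf1; ring.
Qed.

End Beta.
End Bivector.
End PointAlgebra.

(** * Expansion of arguments along frames *)

Section SlotSums.
Variables (R : realType) (n : nat).

Lemma mxrows2_sum (P : 'M[R]_(2, n) -> R) I (r : seq I) (c : I -> R) (v : I -> 'rV[R]_n) w :
  multilinear P ->
  P (mxrows [:: \sum_(i <- r) c i *: v i; w]) = \sum_(i <- r) c i * P (mxrows [:: v i; w]).
Proof.
move=> mP; apply: (multilinear_sum (i := o2 0) mP) => [|i].
  by rewrite row_mxrows2; apply: eq_bigr => i _; rewrite row_mxrows2.
by apply: o2P; rewrite ?eqxx // !row_mxrows2.
Qed.

Lemma mxrows3_sum (P : 'M[R]_(3, n) -> R) I (r : seq I) (c : I -> R) (v : I -> 'rV[R]_n) w z :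
  multilinear P ->
  P (mxrows [:: \sum_(i <- r) c i *: v i; w; z]) = \sum_(i <- r) c i * P (mxrows [:: v i; w; z]).
Proof.
move=> mP; apply: (multilinear_sum (i := o3 0) mP) => [|i].
  by rewrite row_mxrows3; apply: eq_bigr => i _; rewrite row_mxrows3.
by apply: o3P; rewrite ?eqxx // !row_mxrows3.
Qed.

Lemma frame_expand (U T : 'M[R]_n) (v : 'rV[R]_n) : U^T *m T = 1%:M ->
  v = \sum_i (v *m (row i U)^T) 0 0 *: row i T.
Proof.
move=> UT; rewrite -[LHS]mulmx1 -UT mulmxA mulmx_sum_row; apply: eq_bigr => i _.
congr (_ *: _); rewrite !mxE; apply: eq_bigr => c _; rewrite !mxE //.
Qed.

Lemma mul_tr_row m k (X : 'M[R]_(k, n)) (U : 'M[R]_(m, n)) i l :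
  (X *m (row l U)^T) i 0 = (X *m U^T) i l.
Proof. by rewrite !mxE; apply: eq_bigr => c _; rewrite !mxE. Qed.

Lemma mul_row_entry m k (T : 'M[R]_(m, n)) (X : 'M[R]_(n, k)) i l :
  (row l T *m X) 0 i = (T *m X) l i.
Proof. by rewrite -row_mul mxE. Qed.

Lemma tr_pairing m k (T : 'M[R]_(m, n)) (X : 'M[R]_(n, k)) i l :
  (row i X^T *m (row l T)^T) 0 0 = (row l T *m X) 0 i.
Proof. by rewrite !mxE; apply: eq_bigr => c _; rewrite !mxE mulrC. Qed.

Lemma row_mul_tr m k (U : 'M[R]_(m, n)) (X : 'M[R]_(k, n)) i l :
  (row l U *m X^T) 0 i = (X *m (row l U)^T) i 0.
Proof. by rewrite !mxE; apply: eq_bigr => c _; rewrite !mxE mulrC. Qed.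

End SlotSums.

(** * Functions of four vectors, for the derivative of the vertical volume *)

Section FourRows.
Variables (R : realType) (n : nat).

Definition o4 i : 'I_4 := inord i.

Lemma o4P (P : 'I_4 -> Prop) : P (o4 0) -> P (o4 1) -> P (o4 2) -> P (o4 3) -> forall i, P i.
Proof.
move=> P0 P1 P2 P3 i; have -> : i = o4 i by apply: val_inj; rewrite /= inordK.
by case: i => [[|[|[|[|//]]]] hi].
Qed.

Lemma row_mxrows4 (u v w z : 'rV[R]_n) :
  ((row (o4 0) (mxrows [:: u; v; w; z] : 'M[R]_(4, n)) = u) *
  (row (o4 1) (mxrows [:: u; v; w; z] : 'M[R]_(4, n)) = v) *
  (row (o4 2) (mxrows [:: u; v; w; z] : 'M[R]_(4, n)) = w) *
  (row (o4 3) (mxrows [:: u; v; w; z] : 'M[R]_(4, n)) = z))%type.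
Proof. by rewrite !row_mxrows /= !inordK. Qed.

Lemma mxrows4_sum (P : 'M[R]_(4, n) -> R) I (r : seq I) (c : I -> R) (v : I -> 'rV[R]_n) i0
    (F : 'rV[R]_n -> 'M[R]_(4, n)) : multilinear P ->
  (forall u, row i0 (F u) = u) ->
  (forall u u' j, j != i0 -> row j (F u) = row j (F u')) ->
  P (F (\sum_(i <- r) c i *: v i)) = \sum_(i <- r) c i * P (F (v i)).
Proof.
move=> mP Fi Fj; apply: (multilinear_sum (i := i0) mP) => [|i j ji].
  by rewrite Fi; apply: eq_bigr => i _; rewrite Fi.
exact: Fj.
Qed.

Lemma multilinear4_2 (P : 'M[R]_(4, n) -> R) I J (r : seq I) (s : seq J) (c : I -> R) (e : J -> R)
    (v : I -> 'rV[R]_n) (w : J -> 'rV[R]_n) y z : multilinear P ->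
  P (mxrows [:: y; z; \sum_(i <- r) c i *: v i; \sum_(j <- s) e j *: w j]) =
  \sum_(i <- r) \sum_(j <- s) c i * e j * P (mxrows [:: y; z; v i; w j]).
Proof.
move=> mP; rewrite (mxrows4_sum (i0 := o4 2) r c v
  (F := fun u => mxrows [:: y; z; u; \sum_(j <- s) e j *: w j]) mP); first last.
- by move=> u u'; apply: o4P; rewrite ?eqxx // !row_mxrows4.
- by move=> u; rewrite row_mxrows4.
apply: eq_bigr => i _; rewrite (mxrows4_sum (i0 := o4 3) s e w
  (F := fun u => mxrows [:: y; z; v i; u]) mP); first last.
- by move=> u u'; apply: o4P; rewrite ?eqxx // !row_mxrows4.
- by move=> u; rewrite row_mxrows4.
by rewrite mulr_sumr; apply: eq_bigr => j _; rewrite mulrA.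
Qed.

Lemma multilinear4_last (P : 'M[R]_(4, n) -> R) J (s : seq J) (e : J -> R)
    (w : J -> 'rV[R]_n) x y z : multilinear P ->
  P (mxrows [:: x; y; z; \sum_(j <- s) e j *: w j]) =
  \sum_(j <- s) e j * P (mxrows [:: x; y; z; w j]).
Proof.
move=> mP; rewrite (mxrows4_sum (i0 := o4 3) s e w
  (F := fun u => mxrows [:: x; y; z; u]) mP) //.
- by move=> u; rewrite row_mxrows4.
- by move=> u u'; apply: o4P; rewrite ?eqxx // !row_mxrows4.
Qed.

Lemma multilinear2_2 (P : 'M[R]_(2, n) -> R) I J (r : seq I) (s : seq J) (c : I -> R) (e : J -> R)
    (v : I -> 'rV[R]_n) (w : J -> 'rV[R]_n) : multilinear P -> Defs.alternating P ->
  P (mxrows [:: \sum_(i <- r) c i *: v i; \sum_(j <- s) e j *: w j]) =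
  \sum_(i <- r) \sum_(j <- s) c i * e j * P (mxrows [:: v i; w j]).
Proof.
move=> mP aP; rewrite mxrows2_sum //; apply: eq_bigr => i _.
rewrite (mxrows_swap _ _ mP aP) mxrows2_sum // -sumrN mulr_sumr; apply: eq_bigr => j _.
by rewrite (mxrows_swap (v i) _ mP aP); ring.
Qed.

Lemma rev_rows3_last (K : 'M[R]_(3, n)) (A : 'rV[R]_n) :
  col_mx (rowsub (@rev_ord 3) K) A =
  mxrows [:: row (o3 2) K; row (o3 1) K; row (o3 0) K; A] :> 'M[R]_(3 + 1, n).
Proof.
apply/row_matrixP => l; case: (@split_ordP 3 1 l) => a ->.
  rewrite (@rowKu _ 3 1) row_mxrows row_rowsub.
  by move: a; apply: o3P; rewrite /= inordK //=; congr (row _ K); apply: val_inj;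
    rewrite /= !inordK.
by rewrite (@rowKd _ 3 1) row_mxrows ord1 row_id.
Qed.

Lemma rev_rows2_last (h A : 'M[R]_(2, n)) :
  col_mx (rowsub (@rev_ord 2) h) A =
  mxrows [:: row (o2 1) h; row (o2 0) h; row (o2 0) A; row (o2 1) A] :> 'M[R]_(2 + 2, n).
Proof.
apply/row_matrixP => l; case: (@split_ordP 2 2 l) => a ->.
  rewrite (@rowKu _ 2 2) row_mxrows row_rowsub.
  by move: a; apply: o2P; rewrite /= inordK //=; congr (row _ h); apply: val_inj;
    rewrite /= !inordK.
rewrite (@rowKd _ 2 2) row_mxrows.
by move: a; apply: o2P; rewrite /= inordK.
Qed.

Lemma part_last (h v : 'M[R]_n) (f : 'M[R]_(4, n) -> R) x y z A : multilinear f ->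
  x *m h = 0 -> y *m h = 0 -> z *m h = 0 -> x *m v = x -> y *m v = y -> z *m v = z ->
  part h v 1 f (mxrows [:: x; y; z; A]) = f (mxrows [:: x; y; z; A *m h]).
Proof.
move=> mf xh yh zh xv yv zv.
have hS (i : 'I_4) : i \notin finset.set1 (o4 3) -> row i (mxrows [:: x; y; z; A]) *m h = 0.
  by move: i; apply: o4P; rewrite finset.in_set1 ?eqxx // !row_mxrows4.
have := part_single_vert v mf hS; rewrite cards1 => ->.
have n0 : o4 0 == o4 3 = false by rewrite -val_eqE /= !inordK.
have n1 : o4 1 == o4 3 = false by rewrite -val_eqE /= !inordK.
have n2 : o4 2 == o4 3 = false by rewrite -val_eqE /= !inordK.
congr f; apply/row_matrixP; apply: o4P; rewrite rowK finset.in_set1 !row_mxrows4;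
  by rewrite ?n0 ?n1 ?n2 ?eqxx.
Qed.

Lemma part_first2 (h v : 'M[R]_n) (f : 'M[R]_(4, n) -> R) x y A C : multilinear f ->
  x *m v = 0 -> y *m v = 0 -> x *m h = x -> y *m h = y ->
  part h v 2 f (mxrows [:: x; y; A; C]) = f (mxrows [:: x; y; A *m v; C *m v]).
Proof.
move=> mf xv yv xh yh.
have n10 : o4 0 == o4 1 = false by rewrite -val_eqE /= !inordK.
have n2 : o4 2 == o4 0 = false by rewrite -val_eqE /= !inordK.
have n3 : o4 3 == o4 0 = false by rewrite -val_eqE /= !inordK.
have n21 : o4 2 == o4 1 = false by rewrite -val_eqE /= !inordK.
have n31 : o4 3 == o4 1 = false by rewrite -val_eqE /= !inordK.
pose S : {set 'I_4} := [set o4 0; o4 1]%SET.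
have cS : #|S| = 2 by rewrite cards2 n10.
have hS (i : 'I_4) : i \in S -> row i (mxrows [:: x; y; A; C]) *m v = 0.
  by move: i; apply: o4P; rewrite /S finset.in_set2 ?eqxx ?orbT ?n2 ?n3 ?n21 ?n31 // !row_mxrows4.
have := part_single_hor h mf hS; rewrite cS => ->.
congr f; apply/row_matrixP; apply: o4P; rewrite rowK finset.in_set2 !row_mxrows4;
  by rewrite ?eqxx ?orbT ?n2 ?n3 ?n21 ?n31.
Qed.

End FourRows.

Section ExplicitExt.
Variables (R : realType) (n : nat) (M : manifold R n).

Lemma ext_d0E (a : tfield M 0) p (v : 'rV[R]_n) :
  ext_d a p v = 'D_v (fun x => form_loc a p x (0 : 'M[R]_(0, n)) : R) (chart p p).
Proof.
rewrite /ext_d big_ord_recl big_ord0 addr0 expr0 mul1r.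
by rewrite row_id [row' _ v]flatmx0.
Qed.

Lemma ext_d1E (a : tfield M 1) p (u v : 'rV[R]_n) :
  ext_d a p (mxrows [:: u; v]) =
  'D_u (fun x => form_loc a p x v : R) (chart p p) -
  'D_v (fun x => form_loc a p x u : R) (chart p p).
Proof.
rewrite /ext_d !big_ord_recl big_ord0 addr0 expr0 mul1r /= expr1 mulN1r.
rewrite !row_mxrows /=.
have r0 : row' (ord0 : 'I_2) (mxrows [:: u; v] : 'M[R]_(2, n)) = v.
  by apply/rowP => c; rewrite !mxE.
have r1 : row' (lift ord0 ord0 : 'I_2) (mxrows [:: u; v] : 'M[R]_(2, n)) = u.
  by apply/rowP => c; rewrite !mxE.
by rewrite r0 r1.
Qed.

Lemma ext_d3E (a : tfield M 3) p (x y z w : 'rV[R]_n) :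
  ext_d a p (mxrows [:: x; y; z; w]) =
  'D_x (fun r => form_loc a p r (mxrows [:: y; z; w]) : R) (chart p p) -
  'D_y (fun r => form_loc a p r (mxrows [:: x; z; w]) : R) (chart p p) +
  'D_z (fun r => form_loc a p r (mxrows [:: x; y; w]) : R) (chart p p) -
  'D_w (fun r => form_loc a p r (mxrows [:: x; y; z]) : R) (chart p p).
Proof.
rewrite /ext_d !big_ord_recl big_ord0 addr0 !row_mxrows /=.
have rE (i : 'I_4) (A : 'M[R]_(3, n)) : (forall l, row l A = row (lift i l) (mxrows [:: x; y; z; w])) ->
    row' i (mxrows [:: x; y; z; w] : 'M[R]_(4, n)) = A.
  by move=> h; apply/row_matrixP => l; rewrite h; apply/rowP => c; rewrite !mxE.
rewrite (rE _ (mxrows [:: y; z; w])); last first.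
  by apply: o3P; rewrite !row_mxrows /= ?inordK.
rewrite (rE _ (mxrows [:: x; z; w])); last first.
  by apply: o3P; rewrite !row_mxrows /= ?inordK.
rewrite (rE _ (mxrows [:: x; y; w])); last first.
  by apply: o3P; rewrite !row_mxrows /= ?inordK.
rewrite (rE _ (mxrows [:: x; y; z])); last first.
  by apply: o3P; rewrite !row_mxrows /= ?inordK.
by rewrite /bump /= !exprS expr0; ring.
Qed.

End ExplicitExt.

(** * The coefficients kappa and beta *)

Lemma mulmx_conj (F : pzRingType) n (J J' G : 'M[F]_n) :
  J' *m J = 1%:M -> J' *m (J *m (G *m J')) = G *m J'.
Proof. by move=> JJ; rewrite mulmxA JJ mul1mx. Qed.

Lemma mulmx_conj_compl (F : pzRingType) n (J J' G : 'M[F]_n) :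
  J' *m J = 1%:M -> J' *m (1%:M - J *m (G *m J')) = (1%:M - G) *m J'.
Proof. by move=> JJ; rewrite mulmxBr mulmxBl mulmx1 mul1mx mulmx_conj. Qed.

Lemma mulmx_conj_last (F : pzRingType) m n (A : 'M[F]_(m, n)) (J J' G : 'M[F]_n) :
  J' *m J = 1%:M -> A *m (J *m G *m J') *m J = A *m J *m G.
Proof. by move=> JJ; rewrite -!mulmxA JJ mulmx1. Qed.

Lemma mulmx_conj_first (F : pzRingType) m n (J J' : 'M[F]_n) (X : 'M[F]_(n, m)) (Y : 'M[F]_m) :
  J' *m J = 1%:M -> J' *m (J *m X *m Y) = X *m Y.
Proof. by move=> JJ; rewrite !mulmxA JJ mul1mx. Qed.

Section Geometry.
Variables (R : realType) (M : manifold R 5) (B : manifold R 2) (pi : M -> B).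
Hypothesis hpi : fiber_bundle pi.
Variables (omega : tfield B 2) (homega : is_form omega).
Variables (H : M -> 'M[R]_5) (hH : horizontal_subbundle pi H).
Let g := connection_along pi H.
Let hl := hor_lift pi g.
Variables (Pi : tfield M 2) (hPi : is_multivector Pi) (hcoupling : almost_coupling g Pi).
Variables (OmegaV : tfield M 3) (fV : is_form OmegaV) (bV : form_bidegree g 0 OmegaV).

Let spi : smooth_map pi. Proof. by case: hpi. Qed.
Let hlD r : hl r *m dmap pi r = 1%:M. Proof. exact: (hor_liftE hpi hH r).1. Qed.
Let gE r : g r = 1%:M - dmap pi r *m hl r. Proof. exact: (hor_liftE hpi hH r).2. Qed.
Let mP r : multilinear (Pi r). Proof. exact: (hPi.1 r).1. Qed.
Let aP r : Defs.alternating (Pi r). Proof. exact: (hPi.1 r).2. Qed.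
Let mW r : multilinear (OmegaV r). Proof. exact: (fV.1 r).1. Qed.
Let aW r : Defs.alternating (OmegaV r). Proof. exact: (fV.1 r).2. Qed.

Lemma coupling_at r A :
  part (1%:M - (1%:M - dmap pi r *m hl r))^T (1%:M - dmap pi r *m hl r)^T 1 (Pi r) A = 0.
Proof. by rewrite -gE; exact: hcoupling. Qed.

Lemma vertical_at r A : OmegaV r (A *m (1%:M - dmap pi r *m hl r)) = OmegaV r A.
Proof. by rewrite -gE -[RHS]bV /form_part part0. Qed.

Let kappa := kappa_of pi omega (mv_part g 2 Pi).
Let beta := beta_of OmegaV (mv_part g 0 Pi).

Lemma kappa_at r : kappa r = omega (pi r) 1%:M * Pi r (dmap pi r)^T.
Proof.
have [N [K [DhNK hN KD KN]]] := adapted_basis (hlD r).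
rewrite -(kappa_point (hlD r) DhNK hN (mP r) (aP r) (homega.1 _).1 (homega.1 _).2 0).
by rewrite -gE.
Qed.

Lemma beta_at r v : beta r v = beta_pt (dmap pi r) (hl r) (Pi r) (OmegaV r) v.
Proof. by rewrite /beta_pt -gE. Qed.

Section Local.
Variables (p : M) (b : B) (x : 'rV[R]_5).
Hypothesis hx : (chart p @` (cdom p `&` pi @^-1` cdom b)) x.
Let r := unchart p x.
Let J := chart_change p r r.
Let J' := chart_change r p r.
Let D := 'J (local_map pi p b) x.
Let E := local_hor_lift pi H p b x.

Let pr : cdom p r. Proof. by rewrite /r; case: hx => s [ps _] <-; rewrite chartK. Qed.
Let br : cdom b (pi r). Proof. by rewrite /r; case: hx => s [ps bs] <-; rewrite chartK. Qed.
Let xr : x = chart p r. Proof. by rewrite /r; case: hx => s [ps bs] <-; rewrite chartK. Qed.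
Let rr : cdom r r := mem_cdom r.
Let J'J : J' *m J = 1%:M. Proof. exact: chart_changeV. Qed.
Let EE : 1%:M - D *m E = J *m g r *m J'.
Proof. by rewrite /D /E -(end_loc_connection hpi hH hx). Qed.

Lemma local_coupling A :
  part (1%:M - (1%:M - D *m E))^T (1%:M - D *m E)^T 1 (mv_loc Pi p x) A = 0.
Proof.
rewrite -(hcoupling r (A *m J'^T)) EE /mv_part /part; apply: eq_bigr => S _.
rewrite /mv_loc -/r -/J'; congr (Pi r _); apply/row_matrixP => i.
move: (g r) => gr.
have JgJ := mulmx_conj gr J'J.
rewrite row_mul !rowK !row_mul -!mulmxA; congr (_ *m _).
case: (i \in S); rewrite -!trmx_mul; congr trmx; last exact: JgJ.
exact: mulmx_conj_compl.
Qed.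

Lemma local_vertical A : form_loc OmegaV p x (A *m (1%:M - D *m E)) = form_loc OmegaV p x A.
Proof.
rewrite EE /form_loc -/r -/J -[RHS](vertical_at r) -gE; congr (OmegaV r _).
exact: mulmx_conj_last.
Qed.

Lemma local_hor : E *m D = 1%:M.
Proof. exact: local_hor_liftK. Qed.

(** The two factors depend on the chart of [B] through mutually inverse determinants. Fixing that
    chart exhibits [kappa] as a product of a function pulled back from the base and a smooth
    component of [Pi]. *)
Lemma kappa_local : kappa r = form_loc omega b (local_map pi p b x) 1%:M * mv_loc Pi p x D^T.
Proof.
have bb := mem_cdom (pi r).
have ub : unchart b (local_map pi p b x) = pi r by rewrite /local_map /= chartK.
rewrite kappa_at /form_loc ub mul1mx /mv_loc -/r -/J'.
set G := chart_change b (pi r) (pi r).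
have DE : D = J *m dmap pi r *m chart_change (pi r) b (pi r).
  by rewrite /D xr (dmap_local spi pr br).
set G' := chart_change (pi r) b (pi r) in DE.
have G'G : G' *m G = 1%:M by exact: chart_changeV.
have -> : omega (pi r) G = \det G * omega (pi r) 1%:M.
  by rewrite -(alternating_det _ _ (homega.1 _).1 (homega.1 _).2) mulmx1.
have -> : D^T *m J'^T = G'^T *m (dmap pi r)^T.
  by rewrite -!trmx_mul; congr trmx; rewrite DE; exact: mulmx_conj_first.
rewrite (alternating_det _ _ (mP r) (aP r)) det_tr.
have d1 : \det G' * \det G = 1 by rewrite -det_mulmx G'G det1.
have key (a a' c q : R) : a' * a = 1 -> c * q = a * c * (a' * q).
  by move=> aa; rewrite mulrACA [a * a']mulrC aa mul1r.
exact: key.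
Qed.

End Local.

Lemma mul_mxrows n m k (s : seq 'rV[R]_n) (G : 'M[R]_(n, m)) :
  (mxrows s : 'M[R]_(k, n)) *m G = mxrows [seq v *m G | v <- s].
Proof.
apply/row_matrixP => i; rewrite row_mul !row_mxrows.
have [h|h] := ltnP i (size s); first by rewrite (nth_map 0).
by rewrite !nth_default ?size_map // mul0mx.
Qed.

(** The change of chart carries a dual pair to a dual pair, so [betaE] applies with bases constant
    in chart [p]; only the components of [Pi] and [OmegaV] vary with [x]. *)
Lemma beta_local p x v (U T : 'M[R]_5) : cimg p x -> U^T *m T = 1%:M ->
  form_loc beta p x v = 2^-1 * \sum_i \sum_j
    mv_loc Pi p x (mxrows [:: row i U; row j U]) *
    form_loc OmegaV p x (mxrows [:: row i T; row j T; v]).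
Proof.
move=> /cimg_unchart[]; rewrite /form_loc /mv_loc; set r := unchart p x => pr _ UT.
have rr := mem_cdom r.
have [N [K [DhNK hN KD KN]]] := adapted_basis (hlD r).
rewrite beta_at (betaE DhNK KN (mP r) (mW r) (aW r) (vertical_at r) (U := U *m (chart_change r p r)^T)
   (T := T *m chart_change p r r)); last first.
  rewrite trmx_mul trmxK -mulmxA (mulmxA U^T) UT mul1mx; exact: chart_changeV.
congr (_ * _); apply: eq_bigr => i _; apply: eq_bigr => j _.
by rewrite !mul_mxrows /= !row_mul.
Qed.

Lemma smooth_beta p v : smooth_on (cimg p) (fun x => form_loc beta p x v : R).
Proof.
have oU := @cimg_open _ _ M p.
have UT : (1%:M : 'M[R]_5)^T *m 1%:M = 1%:M by rewrite trmx1 mul1mx.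
apply: (@eq_smooth _ _ _ _ (fun x => 2^-1 * \sum_i \sum_j
    mv_loc Pi p x (mxrows [:: row i 1%:M; row j 1%:M]) *
    form_loc OmegaV p x (mxrows [:: row i 1%:M; row j 1%:M; v]))) => //.
  by move=> x px; rewrite (beta_local v px UT).
apply: smoothM => //; first exact: smooth_cst.
apply: smooth_sum => // i _; apply: smooth_sum => // j _; apply: smoothM => //.
  exact: hPi.2.
exact: fV.2.
Qed.

Lemma is_form_beta : is_form beta.
Proof.
split=> [p|]; last exact: smooth_beta.
split=> [|A i j]; last by rewrite !ord1 eqxx.
move=> A A' C i b c Ei EB EC; rewrite !beta_at.
exact: (multilinear_beta (dmap pi p) (hl p) (Pi p) (mW p) Ei EB EC).
Qed.

Lemma beta_bidegree : form_bidegree g 0 beta.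
Proof.
move=> p v; rewrite /form_part part0 !beta_at gE.
have [N [K [DhNK hN KD KN]]] := adapted_basis (hlD p).
by rewrite (beta_vert DhNK KN (Pi p) (vertical_at p)).
Qed.

Lemma local_map_dom p b x : (chart p @` (cdom p `&` pi @^-1` cdom b)) x ->
  cimg b (local_map pi p b x).
Proof. by move=> [r [pr br] <-]; rewrite /local_map /= chartK //; exact: chart_cimg. Qed.

Lemma smooth_local_jacobian p b :
  smooth_on (chart p @` (cdom p `&` pi @^-1` cdom b)) (jacobian (local_map pi p b)).
Proof. by apply: smooth_jacobian; [exact: local_dom_open|exact: spi.2]. Qed.

Lemma smooth_base_coef p b : smooth_on (chart p @` (cdom p `&` pi @^-1` cdom b))
  ((fun y => form_loc omega b y 1%:M : R) \o local_map pi p b).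
Proof.
apply: (smooth_comp _ _ (homega.2 b 1%:M) (spi.2 p b)); first exact: local_dom_open.
exact: local_map_dom.
Qed.

Lemma smooth_hor_coef p b : smooth_on (chart p @` (cdom p `&` pi @^-1` cdom b))
  (fun x => mv_loc Pi p x ('J (local_map pi p b) x)^T : R).
Proof.
have oU := @local_dom_open _ _ _ M B pi spi p b.
apply: (@smooth_multilinear _ _ _ _ _ (fun x => mv_loc Pi p x)
   (fun x => ('J (local_map pi p b) x)^T)) => //.
- by move=> x _; exact: multilinear_mv_loc.
- by move=> A; apply: sub_smooth (hPi.2 p A) => x [r [pr _] <-]; exact: chart_cimg.
- apply: smooth_mx => // i j.
  apply: (@eq_smooth _ _ _ _ (fun x => 'J (local_map pi p b) x j i : R)) => //.
    by move=> x _; rewrite [RHS]mxE.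
  by apply: smooth_coord => //; exact: smooth_local_jacobian.
Qed.

Lemma smooth_kappa : smooth_fun kappa.
Proof.
move=> p; apply: smooth_local => _ [q pq <-].
have oU := @local_dom_open _ _ _ M B pi spi p (pi q).
exists (chart p @` (cdom p `&` pi @^-1` cdom (pi q))).
  by exists q => //; split=> //; exact: mem_cdom.
apply: (@eq_smooth _ _ _ _ (fun x => ((fun y => form_loc omega (pi q) y 1%:M : R) \o local_map pi p (pi q)) x *
  mv_loc Pi p x ('J (local_map pi p (pi q)) x)^T)) => //.
  by move=> x hx; rewrite [RHS](kappa_local hx).
by apply: smoothM => //; [exact: smooth_base_coef|exact: smooth_hor_coef].
Qed.

End Geometry.

(** * The equations of a Poisson triple *)

Lemma sum5_pair (R : realType) (F : 'I_5 -> 'I_5 -> R) :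
  \sum_(ij : 'I_5 * 'I_5) F ij.1 ij.2 = sumn5 (fun i => sumn5 (fun j => F (o5 i) (o5 j))).
Proof. by rewrite -(pair_bigA _ F) sum5 !sum5. Qed.

Lemma derive_eq_opp (R : realType) n (f h : 'rV[R]_n -> R) x v :
  differentiable f x -> (forall y, h y = - f y) -> 'D_v h x = - 'D_v f x.
Proof.
move=> df hf; have -> : h = - f by apply/funext.
by rewrite deriveN //; exact: diff_derivable.
Qed.

Lemma o2_val (i : 'I_2) : o2 i = i.
Proof. by apply: val_inj; rewrite /= inordK. Qed.

Lemma o3_val (i : 'I_3) : o3 i = i.
Proof. by apply: val_inj; rewrite /= inordK. Qed.

Lemma split_bilinear (R : realType) m n (k q : R) (c X : 'I_m -> R) (e b : 'I_n -> R)
    (F : 'I_m -> 'I_n -> R) :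
  (forall i a, k * (F i a + q * X i * b a) = 0) ->
  k * (\sum_i \sum_a c i * e a * F i a - - (q * \sum_i c i * X i) * \sum_a e a * b a) = 0.
Proof.
move=> h; rewrite mulNr opprK [q * _]mulr_sumr mulr_suml -big_split mulr_sumr big1 // => i _ /=.
rewrite [q * _ * _]mulr_sumr -big_split mulr_sumr big1 // => a _ /=.
have := congr1 (fun z => c i * e a * z) (h i a); rewrite mulr0 => E; apply: (etrans _ E); ring.
Qed.

Lemma cancel_volume (R : realType) (q w w0 k F X b : R) :
  q * w = -1 -> k * (w * F - X * b) = 0 -> w0 * k * (F + q * X * b) = 0.
Proof.
move=> qw h; have := congr1 (fun z => - w0 * q * z) h; rewrite mulr0 => E; apply: (etrans _ E).
have -> : - w0 * q * (k * (w * F - X * b)) = w0 * k * (- (q * w) * F + q * X * b) by ring.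
by rewrite qw opprK mul1r.
Qed.

Lemma antisym_cancel (R : realType) (k y y' t b t' b' : R) :
  k * (y - t * b) = 0 -> k * (y' - t' * b') = 0 ->
  k * (y - y' - (t * b - t' * b')) = 0.
Proof.
move=> h h'; have -> : y - y' - (t * b - t' * b') = y - t * b - (y' - t' * b') by ring.
by rewrite mulrBr h h' subr0.
Qed.

(** Since q w = -1, the whole expression is w times a combination of the hypotheses. *)
Lemma area_cancel (R : realType) n (q w k : R) (c e d b : 'I_n -> R) (X : 'I_n -> 'I_n -> R) :
  q * w = -1 -> (forall i j, d i * b j - d j * b i + k ^+ 2 * X i j = 0) ->
  (\sum_i c i * (w * d i)) * (\sum_j e j * b j) - (\sum_j e j * (w * d j)) * (\sum_i c i * b i) -
  (w * k) ^+ 2 * (q * \sum_i \sum_j c i * e j * X i j) = 0.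
Proof.
move=> qw h.
have -> : (w * k) ^+ 2 * (q * \sum_i \sum_j c i * e j * X i j) =
    - (w * k ^+ 2) * \sum_i \sum_j c i * e j * X i j.
  by rewrite mulrA; congr (_ * _); rewrite exprMn -mulN1r -qw; ring.
rewrite [X in _ - X - _]mulrC !mulr_suml -sumrB mulr_sumr -sumrB big1 // => i _.
rewrite !mulr_sumr -sumrB -sumrB big1 // => j _.
have := congr1 (fun z => w * c i * e j * z) (h i j); rewrite mulr0 => E; apply: (etrans _ E); ring.
Qed.

(** A 3-form on a 3-space is determined by its value on a basis: the left side is the determinant of
    the coefficients times that value. *)
Lemma wedge21_alt (R : realType) (c : nat -> 'I_3 -> R) (x : 'I_3 -> 'I_3 -> R) (b : 'I_3 -> R) :
  (forall i j, x j i = - x i j) ->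
  x (o3 0) (o3 1) * b (o3 2) + x (o3 1) (o3 2) * b (o3 0) + x (o3 2) (o3 0) * b (o3 1) = 0 ->
  (\sum_i \sum_j c 0%N i * c 1%N j * x i j) * (\sum_i c 2%N i * b i) +
  (\sum_i \sum_j c 1%N i * c 2%N j * x i j) * (\sum_i c 0%N i * b i) +
  (\sum_i \sum_j c 2%N i * c 0%N j * x i j) * (\sum_i c 1%N i * b i) = 0.
Proof.
move=> xN J.
have xii i : x i i = 0.
  by apply/eqP; rewrite -eqNr -xN.
rewrite !sum3 !xii (xN (o3 0) (o3 1)) (xN (o3 1) (o3 2)) (xN (o3 2) (o3 0)).
pose e i j := c i (o3 j).
have := congr1 (fun z => (e 0%N 0%N * e 1%N 1%N * e 2%N 2%N + e 0%N 1%N * e 1%N 2%N * e 2%N 0%N + e 0%N 2%N * e 1%N 0%N * e 2%N 1%N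
   - e 0%N 1%N * e 1%N 0%N * e 2%N 2%N - e 0%N 2%N * e 1%N 1%N * e 2%N 0%N - e 0%N 0%N * e 1%N 2%N * e 2%N 1%N) * z) J.
rewrite mulr0 => h; apply: (etrans _ h); rewrite /e; ring.
Qed.

(** * One-jets at a point in the constant adapted frame *)

Section Jets.
Variables (R : realType) (M : manifold R 5) (B : manifold R 2) (pi : M -> B).
Hypothesis hpi : fiber_bundle pi.
Variables (omega : tfield B 2) (homega : is_form omega).
Variables (H : M -> 'M[R]_5) (hH : horizontal_subbundle pi H).
Let g := connection_along pi H.
Let hl := hor_lift pi g.
Variables (Pi : tfield M 2) (hPi : is_multivector Pi) (hcoupling : almost_coupling g Pi).
Variables (OmegaV : tfield M 3) (fV : is_form OmegaV) (bV : form_bidegree g 0 OmegaV).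
Variable p : M.
Variables (N : 'M[R]_(5, 3)) (K : 'M[R]_(3, 5)).
Hypotheses (DhNK : dmap pi p *m hl p + N *m K = 1%:M) (hN : hl p *m N = 0).
Hypotheses (KD : K *m dmap pi p = 0) (KN : K *m N = 1%:M).

Let spi : smooth_map pi. Proof. by case: hpi. Qed.
Let b := pi p.
Let x0 := chart p p.
Let V := chart p @` (cdom p `&` pi @^-1` cdom b).
Let D x := 'J (local_map pi p b) x.
Let E x := local_hor_lift pi H p b x.
Let T := frame (hl p) K.
Let U := coframe (dmap pi p) N.

Let oV : open V. Proof. exact: local_dom_open. Qed.
Let Vx0 : V x0. Proof. by exists p => //; split; exact: mem_cdom. Qed.
Let pV x : V x -> cimg p x. Proof. by move=> [r [pr _] <-]; exact: chart_cimg. Qed.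
Let UT : U^T *m T = 1%:M. Proof. exact: coframe_frame. Qed.
Let TU : T *m U^T = 1%:M. Proof. by apply: mulmx1C; exact: UT. Qed.
Let Dx0 : D x0 = dmap pi p. Proof. by []. Qed.
Let Ex0 : E x0 = hl p.
Proof.
have pp := mem_cdom p; have bb := mem_cdom (pi p).
rewrite /E /local_hor_lift /x0 (chartK pp) (chart_change_id pp) (chart_change_id bb).
by rewrite mulmx1 mul1mx.
Qed.

(* Components in the constant frame T and its dual U of, respectively, the      *)
(* horizontal lift of the i-th base coordinate vector, the pullback of the i-th *)
(* base coordinate covector, the bivector and the vertical volume; jet_kappa is *)
(* the bivector on the pulled back coordinate covectors.                        *)
Definition jet_hor (i : nat) (l : 'I_5) x := (E x *m (row l U)^T) (o2 i) 0.
Definition jet_cov (l : 'I_5) (i : nat) x := (row l T *m D x) 0 (o2 i).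
Definition jet_kappa x := mv_loc Pi p x (D x)^T.
Definition jet_bi (i j : 'I_5) x := mv_loc Pi p x (mxrows [:: row i U; row j U]).
Definition jet_vol (i j l : 'I_5) x := form_loc OmegaV p x (mxrows [:: row i T; row j T; row l T]).

Let d_hor i l : differentiable (jet_hor i l : _ -> R) x0.
Proof.
apply: (smooth_differentiable _ Vx0); apply: smooth_coord => //.
by apply: smooth_mulmx => //; [exact: smooth_local_hor_lift|exact: smooth_cst].
Qed.

Let d_cov l i : differentiable (jet_cov l i : _ -> R) x0.
Proof.
apply: (smooth_differentiable _ Vx0); apply: smooth_coord => //.
by apply: smooth_mulmx => //; [exact: smooth_cst|exact: smooth_local_jacobian].
Qed.

Let d_kappa : differentiable (jet_kappa : _ -> R) x0.
Proof. by apply: (smooth_differentiable _ Vx0); exact: smooth_hor_coef. Qed.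

Let d_bi i j : differentiable (jet_bi i j : _ -> R) x0.
Proof. exact: mv_loc_differentiable. Qed.

Let d_vol i j l : differentiable (jet_vol i j l : _ -> R) x0.
Proof. exact: form_loc_differentiable. Qed.

Let frame_pairing (k l : 'I_5) : (row k T *m (row l U)^T) 0 0 = (k == l)%:R.
Proof.
have /matrixP/(_ k l) := TU; rewrite !mxE => <-.
by apply: eq_bigr => c _; rewrite !mxE.
Qed.

Let hor_center i l : (i < 2)%N -> jet_hor i l x0 = (o5 i == l)%:R.
Proof.
move=> i2; rewrite /jet_hor Ex0 -frame_pairing (row_frame_hor _ _ i2) -row_mul.
by rewrite [RHS]mxE.
Qed.

Let cov_center l i : (i < 2)%N -> jet_cov l i x0 = (l == o5 i)%:R.
Proof.
move=> i2; rewrite /jet_cov Dx0 -frame_pairing (row_coframe_hor _ _ i2).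
by rewrite ![LHS]mxE ![RHS]mxE; apply: eq_bigr => c _; rewrite !mxE.
Qed.

(** Like [hor_vol] and [cov_bi], this holds on the neighbourhood [V] and not just at [x0], where the
    frame is adapted; so it can be differentiated there. *)
Lemma hor_cov i j x : V x -> \sum_n jet_hor i n x * jet_cov n j x = (o2 i == o2 j)%:R.
Proof.
move=> Vx; have : (E x *m U^T) *m (T *m D x) = 1%:M.
  by rewrite mulmxA -(mulmxA (E x)) UT mulmx1; exact: local_hor.
move=> /matrixP/(_ (o2 i) (o2 j)); rewrite [X in X = _]mxE [X in _ = X]mxE => <-.
by apply: eq_bigr => n _; rewrite /jet_hor /jet_cov mul_tr_row mul_row_entry.
Qed.

Lemma hor_expand i x : row (o2 i) (E x) = \sum_n jet_hor i n x *: row n T.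
Proof.
rewrite [LHS](frame_expand _ UT); apply: eq_bigr => n _; congr (_ *: _).
by rewrite /jet_hor mul_tr_row mul_row_entry mul_tr_row.
Qed.

Lemma cov_expand i x : row (o2 i) (D x)^T = \sum_n jet_cov n i x *: row n U.
Proof.
have TU' : T^T *m U = 1%:M by rewrite -[LHS]trmxK trmx_mul trmxK UT trmx1.
rewrite [LHS](frame_expand _ TU'); apply: eq_bigr => n _; congr (_ *: _).
exact: tr_pairing.
Qed.

Lemma hor_vol i l m x : V x -> \sum_n jet_hor i n x * jet_vol n l m x = 0.
Proof.
move=> Vx; have mWx := multilinear_form_loc p x fV.
have vE : row (o2 i) (E x) *m (1%:M - D x *m E x) = 0.
  by rewrite -row_mul mulmxBr mulmx1 mulmxA (local_hor hpi hH Vx) mul1mx subrr row0.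
have := volume_insert mWx (local_vertical hpi hH bV Vx) vE (row l T) (row m T).
by rewrite hor_expand mxrows3_sum.
Qed.

Lemma cov_bi l x : V x ->
  (\sum_n jet_cov n 0 x * jet_bi n l x = jet_kappa x * jet_hor 1 l x) *
  (\sum_n jet_cov n 1 x * jet_bi n l x = - (jet_kappa x * jet_hor 0 l x)).
Proof.
move=> Vx; have mPx := multilinear_mv_loc p x hPi; have aPx := alternating_mv_loc p x hPi.
have hD := local_hor hpi hH Vx.
(* An auxiliary adapted basis for the splitting at [x], distinct from the constant frame. *)
have [N' [K' [e1 e2 e3 e4]]] := adapted_basis hD.
have C := local_coupling hpi hH hcoupling Vx.
have hl' i : (row l U *m (E x)^T) 0 (o2 i) = jet_hor i l x.
  exact: row_mul_tr.
have [c0 c1] := coupling_conormal hD e1 e3 e4 mPx aPx C (row l U).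
by move: c0 c1; rewrite !hl' -/(D x) !cov_expand !mxrows2_sum.
Qed.

Local Notation d k f := ('D_(row k T) (f : _ -> R) x0).

(** Derivative of [hor_vol] at [x0], where [jet_hor] is a Kronecker symbol and one of the two sums
    collapses. The next two lemmas treat [cov_bi] and [hor_cov] in the same way. *)
Lemma jet_vol_hor k i l m : (i < 2)%N ->
  d k (jet_vol (o5 i) l m) = - \sum_n d k (jet_hor i n) * jet_vol n l m x0.
Proof.
move=> i2; apply/eqP; rewrite -addr_eq0; apply/eqP.
have : 'D_(row k T) (fun x => \sum_n jet_hor i n x * jet_vol n l m x) x0 = 0.
  rewrite (near_eq_derive (g := cst 0)) ?derive_cst //.
  by apply: (open_near_eq oV Vx0) => x; exact: hor_vol.
rewrite derive_sumM; [|by move=> n; exact: d_hor|by move=> n; exact: d_vol].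
rewrite big_split /= addrC => h; apply: (etrans _ h); congr (_ + _).
under eq_bigr do rewrite hor_center //.
rewrite (bigD1 (o5 i)) //= eqxx mul1r big1 ?addr0 // => n /negPf ni.
by rewrite eq_sym ni mul0r.
Qed.

Lemma jet_bi_cov k l :
  (d k (jet_bi (o5 0) l) = d k jet_kappa * (o5 1 == l)%:R +
     jet_kappa x0 * d k (jet_hor 1 l) - \sum_n d k (jet_cov n 0) * jet_bi n l x0) *
  (d k (jet_bi (o5 1) l) = - (d k jet_kappa * (o5 0 == l)%:R +
     jet_kappa x0 * d k (jet_hor 0 l)) - \sum_n d k (jet_cov n 1) * jet_bi n l x0).
Proof.
have prodD i : (i < 2)%N -> 'D_(row k T) (fun x => jet_kappa x * jet_hor i l x) x0 =
    d k jet_kappa * (o5 i == l)%:R + jet_kappa x0 * d k (jet_hor i l).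
  move=> i2.
  have dk : derivable (jet_kappa : _ -> R) x0 (row k T) by exact: diff_derivable.
  have dh : derivable (jet_hor i l : _ -> R) x0 (row k T) by exact: diff_derivable.
  rewrite (deriveM dk dh).
  by rewrite hor_center // /GRing.scale /= addrC [_%:R * _]mulrC.
have sumD i : (i < 2)%N -> 'D_(row k T) (fun x => \sum_n jet_cov n i x * jet_bi n l x) x0 =
    \sum_n d k (jet_cov n i) * jet_bi n l x0 + d k (jet_bi (o5 i) l).
  move=> i2; rewrite derive_sumM; [|by move=> n; exact: d_cov|by move=> n; exact: d_bi].
  rewrite big_split /=; congr (_ + _).
  under eq_bigr do rewrite cov_center //.
  by rewrite (bigD1 (o5 i)) //= eqxx mul1r big1 ?addr0 // => n /negPf ->; rewrite mul0r.
split.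
  rewrite -(prodD 1%N isT); apply/eqP; rewrite eq_sym subr_eq addrC -sumD //; apply/eqP.
  by apply: near_eq_derive; apply: (open_near_eq oV Vx0) => x Vx; rewrite (cov_bi l Vx).1.
rewrite -(prodD 0%N isT); apply/eqP; rewrite eq_sym subr_eq addrC -sumD // eq_sym; apply/eqP.
rewrite -deriveN; last by apply/diff_derivable/differentiableM.
by apply: near_eq_derive; apply: (open_near_eq oV Vx0) => x Vx; rewrite (cov_bi l Vx).2.
Qed.

Lemma jet_hor_cov k i j : (i < 2)%N -> (j < 2)%N ->
  d k (jet_hor i (o5 j)) = - d k (jet_cov (o5 i) j).
Proof.
move=> i2 j2; apply/eqP; rewrite -addr_eq0; apply/eqP.
have : 'D_(row k T) (fun x => \sum_n jet_hor i n x * jet_cov n j x) x0 = 0.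
  rewrite (near_eq_derive (g := cst ((o2 i == o2 j)%:R : R))) ?derive_cst //.
  by apply: (open_near_eq oV Vx0) => x; exact: hor_cov.
rewrite derive_sumM; [|by move=> n; exact: d_hor|by move=> n; exact: d_cov].
rewrite big_split /= => h; apply: (etrans _ h); congr (_ + _).
  under eq_bigr do rewrite cov_center //.
  by rewrite (bigD1 (o5 j)) //= eqxx mulr1 big1 ?addr0 // => n /negPf ->; rewrite mulr0.
under eq_bigr do rewrite hor_center //.
rewrite (bigD1 (o5 i)) //= eqxx mul1r big1 ?addr0 // => n /negPf ni.
by rewrite eq_sym ni mul0r.
Qed.

(** As the frame is constant, [jet_cov] is a directional derivative of a coordinate of the
    projection, and the claim is the symmetry of its second derivatives. *)
Lemma jet_cov_sym k l i : d k (jet_cov l i) = d l (jet_cov k i).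
Proof.
pose u y : R := local_map pi p b y 0 (o2 i).
have su : smooth_on V u by apply: smooth_coord => //; exact: spi.2.
have cE m x : V x -> jet_cov m i x = 'D_(row m T) u x.
  move=> Vx; have du := smooth_differentiable (spi.2 p b) Vx.
  rewrite /jet_cov -(deriveEjacobian (row m T) du).
  by rewrite (@derive_coord _ _ _ _ (local_map pi p b)) //; exact: diff_derivable.
have E1 m n : d n (jet_cov m i) = 'D_(row n T) ('D_(row m T) u) x0.
  by apply: near_eq_derive; apply: (open_near_eq oV Vx0) => x; exact: cE.
by rewrite !E1; apply: (schwarz _ _ oV (su 2%N) Vx0).
Qed.

Hypothesis hsch : forall A, schouten Pi Pi p A = 0.

Let TU' : T^T *m U = 1%:M.
Proof. by rewrite -[LHS]trmxK trmx_mul trmxK UT trmx1. Qed.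

Lemma grad_insert (f : 'rV[R]_5 -> R) z : differentiable f x0 ->
  Pi p (col_mx (grad f x0) z : 'M[R]_(1 + 1, 5)) =
  \sum_k 'D_(row k T) f x0 * Pi p (mxrows [:: row k U; z]).
Proof.
move=> df; have -> : col_mx (grad f x0) z = mxrows [:: grad f x0; z] :> 'M[R]_(1 + 1, 5).
  apply/row_matrixP => l; case: (@split_ordP 1 1 l) => a ->.
    by rewrite (@rowKu _ 1 1) row_mxrows ord1 row_id.
  by rewrite (@rowKd _ 1 1) row_mxrows ord1 row_id.
have mP := (hPi.1 p).1.
rewrite {1}(frame_expand (grad f x0) TU') mxrows2_sum //; apply: eq_bigr => k _; congr (_ * _).
rewrite [in RHS](row_sum_delta (row k T)) derive_sum_dir // mxE; apply: eq_bigr => c _.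
by rewrite !mxE mulrC.
Qed.

(** The bracket of [Pi] with itself is twice [mv_comp Pi Pi]; its sum over permutations folds to a
    cyclic one by [sum_S3_alt], and each gradient is expanded in the coframe. *)
Lemma jet_jacobi l m n :
  \sum_k d k (jet_bi l m) * jet_bi k n x0 + \sum_k d k (jet_bi m n) * jet_bi k l x0 +
  \sum_k d k (jet_bi n l) * jet_bi k m x0 = 0.
Proof.
have mP := (hPi.1 p).1.
pose G (C : 'M[R]_(3, 5)) := Pi p (col_mx
  (grad (fun x => mv_loc Pi p x (mxrows [:: row (o3 0) C; row (o3 1) C])) x0) (row (o3 2) C)
    : 'M[R]_(1 + 1, 5)).
have df (u v : 'rV[R]_5) : differentiable (fun x => mv_loc Pi p x (mxrows [:: u; v]) : R) x0.
  exact: mv_loc_differentiable.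
have GE u v w : G (mxrows [:: u; v; w]) =
    \sum_k 'D_(row k T) (fun x => mv_loc Pi p x (mxrows [:: u; v])) x0 *
      Pi p (mxrows [:: row k U; w]).
  by rewrite /G !row_mxrows3 grad_insert.
have GN u v w : G (mxrows [:: v; u; w]) = - G (mxrows [:: u; v; w]).
  rewrite !GE -sumrN; apply: eq_bigr => k _; rewrite -mulNr; congr (_ * _).
  apply: derive_eq_opp => [|x]; first exact: df.
  exact: mxrows_swap (multilinear_mv_loc _ _ hPi) (alternating_mv_loc _ _ hPi).
have : mv_comp Pi Pi p (mxrows [:: row l U; row m U; row n U]) = 0.
  have := hsch (mxrows [:: row l U; row m U; row n U]).
  by rewrite /schouten -mulr2n => /eqP; rewrite mulrn_eq0 /= => /eqP.
rewrite /mv_comp (eq_bigr (fun s : 'S_3 => (-1) ^+ s *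
  G (row_perm s (mxrows [:: row l U; row m U; row n U])))); last first.
  by move=> s _; rewrite /= usubmx_rows3 dsubmx_row3.
rewrite (sum_S3_alt _ GN) !row_mxrows3 !GE mulrA mulVf ?mul1r; last by rewrite pnatr_eq0.
move=> h; apply: (etrans _ h); congr (_ + _ + _);
  by apply: eq_bigr => k _; rewrite /jet_bi mv_loc_center.
Qed.

Let kappa := kappa_of pi omega (mv_part g 2 Pi).
Let beta := beta_of OmegaV (mv_part g 0 Pi).
Let w0 := omega b 1%:M.

Lemma kappa_center : kappa p = w0 * jet_kappa x0.
Proof. by rewrite /jet_kappa mv_loc_center; exact: kappa_at. Qed.

(** By [kappa_local], [kappa] is [jet_kappa] times the coefficient of omega pulled back from the
    base, which is constant along the fiber. *)
Lemma kappa_vert_derive a : 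
  'D_(row a K) (fun x => form_loc (form0 kappa) p x (0 : 'M[R]_(0, 5)) : R) x0 =
  w0 * 'D_(row a K) (jet_kappa : _ -> R) x0.
Proof.
pose f y : R := form_loc omega b y 1%:M.
have du : differentiable (local_map pi p b) x0 := smooth_differentiable (spi.2 p b) Vx0.
have dw : differentiable f (local_map pi p b x0).
  apply: (smooth_differentiable (homega.2 b 1%:M)); exact: local_map_dom Vx0.
rewrite (near_eq_derive (g := ((f \o local_map pi p b) * (jet_kappa : _ -> R)))); last first.
  by apply: (open_near_eq oV Vx0) => x Vx; exact: kappa_local.
have dfu : derivable (f \o local_map pi p b) x0 (row a K).
  by apply: diff_derivable; exact: differentiable_comp.
have dk : derivable (jet_kappa : _ -> R) x0 (row a K) by exact: diff_derivable.
rewrite (deriveM dfu dk) (derive_comp_coord _ du dw) (deriveEjacobian _ du).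
(* The direction is vertical, so the pulled back factor has zero derivative. *)
have -> : row a K *m 'J (local_map pi p b) x0 = 0 by rewrite -row_mul KD row0.
rewrite [X in _ *: _ + _ *: X]big1 => [|j _]; last by rewrite mxE mul0r.
rewrite scaler0 addr0 /GRing.scale /=; congr (_ * _).
have -> : local_map pi p b x0 = chart b b.
  by rewrite /local_map /= (chartK (mem_cdom p)).
by rewrite /f form_loc_center.
Qed.

Let pp i j := jet_bi (o5 i) (o5 j) x0.
Let dp k i j := d (o5 k) (jet_bi (o5 i) (o5 j)).
Let om i j l := jet_vol (o5 i) (o5 j) (o5 l) x0.
Let dom k i j l := d (o5 k) (jet_vol (o5 i) (o5 j) (o5 l)).
Let dbe k l := d (o5 k) (fun x => form_loc beta p x (row (o5 l) T)).

Lemma beta_jet l : beta p (row (o5 l) T) =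
  2^-1 * sumn5 (fun i => sumn5 (fun j => pp i j * om i j l)).
Proof.
rewrite -form_loc_center (beta_local hpi hH hPi fV bV _ (pV Vx0) UT).
by rewrite sum5 !sum5.
Qed.

Lemma dbeta_jet k l : dbe k l =
  2^-1 * sumn5 (fun i => sumn5 (fun j => dp k i j * om i j l + pp i j * dom k i j l)).
Proof.
(* The double sum is indexed by pairs so that [derive_sumM] applies once. *)
rewrite /dbe (near_eq_derive (g := 2^-1 *: (fun x => \sum_(ij : 'I_5 * 'I_5)
   jet_bi ij.1 ij.2 x * jet_vol ij.1 ij.2 (o5 l) x))); last first.
  apply: (open_near_eq oV Vx0) => x Vx.
  by rewrite (beta_local hpi hH hPi fV bV _ (pV Vx) UT) pair_big.
have dM : differentiable (fun x => \sum_(ij : 'I_5 * 'I_5)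
   jet_bi ij.1 ij.2 x * jet_vol ij.1 ij.2 (o5 l) x) x0.
  have sB i j : smooth_on V (jet_bi i j : _ -> R).
    by apply: sub_smooth (hPi.2 p _) => x; exact: pV.
  have sV i j m : smooth_on V (jet_vol i j m : _ -> R).
    by apply: sub_smooth (fV.2 p _) => x; exact: pV.
  apply: (smooth_differentiable _ Vx0); apply: smooth_sum => // ij _.
  by apply: smoothM.
rewrite deriveZ; last exact: diff_derivable.
rewrite derive_sumM; [|by move=> ij; exact: d_bi|by move=> ij; exact: d_vol].
exact: congr1 (sum5_pair (fun i j => d (o5 k) (jet_bi i j) * jet_vol i j (o5 l) x0 +
  jet_bi i j x0 * d (o5 k) (jet_vol i j (o5 l)))).
Qed.

Let kp := jet_kappa x0.
Let dk k := d (o5 k) jet_kappa.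
Let Bn k i l := d (o5 k) (jet_hor i (o5 l)).
Let Sn k l i := d (o5 k) (jet_cov (o5 l) i).

Let ppE i j : pp i j = Pi p (mxrows [:: row (o5 i) U; row (o5 j) U]).
Proof. exact: mv_loc_center. Qed.

Let omE i j l : om i j l = OmegaV p (mxrows [:: row (o5 i) T; row (o5 j) T; row (o5 l) T]).
Proof. exact: form_loc_center. Qed.

Let pN i j : pp j i = - pp i j.
Proof. by rewrite !ppE; exact: mxrows_swap (hPi.1 p).1 (hPi.1 p).2. Qed.

Let omN1 i j l : om j i l = - om i j l.
Proof. by rewrite !omE; exact: mxrows3_swap01 (fV.1 p).1 (fV.1 p).2. Qed.

Let omN2 i j l : om i l j = - om i j l.
Proof. by rewrite !omE; exact: mxrows3_swap12 (fV.1 p).1 (fV.1 p).2. Qed.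

Let dpN k i j : dp k j i = - dp k i j.
Proof.
rewrite /dp; apply: derive_eq_opp => [|x]; first exact: d_bi.
exact: mxrows_swap (multilinear_mv_loc _ _ hPi) (alternating_mv_loc _ _ hPi).
Qed.

Let domN1 k i j l : dom k j i l = - dom k i j l.
Proof.
rewrite /dom; apply: derive_eq_opp => [|x]; first exact: d_vol.
exact: mxrows3_swap01 (multilinear_form_loc _ _ fV) (alternating_form_loc _ _ fV).
Qed.

Let domN2 k i j l : dom k i l j = - dom k i j l.
Proof.
rewrite /dom; apply: derive_eq_opp => [|x]; first exact: d_vol.
exact: mxrows3_swap12 (multilinear_form_loc _ _ fV) (alternating_form_loc _ _ fV).
Qed.

Let omh i j l : (i < 2)%N -> om i j l = 0.
Proof.
move=> i2; rewrite omE.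
exact: (volume_frame_hor DhNK hN (fV.1 p).1 (vertical_at hpi hH bV p)).
Qed.

Let pm i a : (i < 2)%N -> (1 < a < 5)%N -> pp i a = 0.
Proof.
move=> i2 a5; rewrite ppE.
exact: (bivector_coframe_mixed DhNK KD KN (hPi.1 p).1 (coupling_at hpi hH hcoupling p)).
Qed.

Let p01 : pp 0 1 = kp.
Proof.
rewrite ppE /kp /jet_kappa mv_loc_center; exact: (bivector_coframe_hor (dmap pi p) N (Pi p)).
Qed.

Let Ssym k l i : Sn k l i = Sn l k i.
Proof. exact: jet_cov_sym. Qed.

Let BS k i j : (i < 2)%N -> (j < 2)%N -> Bn k i j = - Sn k i j.
Proof. exact: jet_hor_cov. Qed.

Let domh i k l m : (i < 2)%N -> dom k i l m = - sumn5 (fun n => Bn k i n * om n l m).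
Proof. by move=> i2; rewrite /dom jet_vol_hor // sum5. Qed.

Let o5_eq i l : (i < 5)%N -> (o5 i == o5 l) = (i == if (l < 5)%N then l else 0%N).
Proof. by move=> i5; rewrite -val_eqE /= /o5 /inord !val_insubd i5. Qed.

Let dp0 k l : dp k 0 l = dk k * (l == 1)%N%:R + kp * Bn k 1 l - sumn5 (fun n => Sn k n 0 * pp n l).
Proof.
rewrite /dp (jet_bi_cov _ _).1 sum5 o5_eq //; congr (_ * _%:R + _ - _).
by case: ltnP => [_|l5]; [rewrite eq_sym|case: l l5 => [|[|l]]].
Qed.

Let dp1 k l : dp k 1 l =
  - (dk k * ((l == 0) || (4 < l))%N%:R + kp * Bn k 0 l) - sumn5 (fun n => Sn k n 1 * pp n l).
Proof.
rewrite /dp (jet_bi_cov _ _).2 sum5 o5_eq //; congr (- (_ * _%:R + _) - _).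
by case: l => [|[|[|[|[|l]]]]].
Qed.

Let jac l m n : sumn5 (fun k => dp k l m * pp k n) + sumn5 (fun k => dp k m n * pp k l) +
  sumn5 (fun k => dp k n l * pp k m) = 0.
Proof. by have := jet_jacobi (o5 l) (o5 m) (o5 n); rewrite !sum5. Qed.

Let be l := beta p (row (o5 l) T).

Let jet1 : (dbe 2 3 - dbe 3 2) * be 4 + (dbe 3 4 - dbe 4 3) * be 2 +
  (dbe 4 2 - dbe 2 4) * be 3 = 0.
Proof.
rewrite !dbeta_jet /be !beta_jet.
exact: (jacobi_vertical pN dpN omN1 omN2 domN1 domN2 (fun j l => @omh 0 j l isT) (fun j l => @omh 1 j l isT)
  p01 (fun a => @pm 0 a isT) (fun a => @pm 1 a isT) (fun k l m => @domh 0 k l m isT)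
  (fun k l m => @domh 1 k l m isT) jac).
Qed.

Let jet2 i a : (i < 2)%N -> (1 < a < 5)%N -> kp * (om 2 3 4 * (dbe i a - dbe a i) -
  (dom 4 3 2 i - dom 3 4 2 i + dom 2 4 3 i - dom i 4 3 2) * be a) = 0.
Proof.
rewrite !dbeta_jet /be !beta_jet.
exact: (jacobi_mixed pN dpN omN1 omN2 domN1 domN2 (fun j l => @omh 0 j l isT) (fun j l => @omh 1 j l isT)
  p01 (fun a => @pm 0 a isT) (fun a => @pm 1 a isT) Ssym (fun k l m => @domh 0 k l m isT)
  (fun k l m => @domh 1 k l m isT) dp0 dp1 jac).
Qed.

Let jet3 a c : (1 < a < 5)%N -> (1 < c < 5)%N -> dk a * be c - dk c * be a +
  kp ^+ 2 * (dom 1 0 a c - dom 0 1 a c + dom a 1 0 c - dom c 1 0 a) = 0.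
Proof.
rewrite /be !beta_jet.
exact: (jacobi_horizontal pN dpN omN1 omN2 domN2 (fun j l => @omh 0 j l isT) (fun j l => @omh 1 j l isT)
  p01 (fun a => @pm 0 a isT) (fun a => @pm 1 a isT) Ssym BS (fun k l m => @domh 0 k l m isT)
  (fun k l m => @domh 1 k l m isT) dp0 dp1 jac).
Qed.

Let g_at : g p = 1%:M - dmap pi p *m hl p. Proof. exact: (hor_liftE hpi hH p).2. Qed.
Let gNK : g p = N *m K. Proof. by rewrite g_at -DhNK addrC addKr. Qed.
Let gDh : 1%:M - g p = dmap pi p *m hl p. Proof. by rewrite gNK -DhNK addrK. Qed.
Let fbeta : is_form beta. Proof. exact: (is_form_beta hpi hH hPi fV bV). Qed.
Let mF2 : multilinear (ext_d beta p). Proof. exact: multilinear_ext_d. Qed.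
Let aF2 : Defs.alternating (ext_d beta p). Proof. exact: alternating_ext_d. Qed.
Let mbeta : multilinear (beta p). Proof. exact: (fbeta.1 p).1. Qed.
Let rT_h i : (i < 2)%N -> row (o5 i) T = row (o2 i) (hl p). Proof. exact: row_frame_hor. Qed.
Let rT_v i : (i < 3)%N -> row (o5 i.+2) T = row (o3 i) K. Proof. exact: row_frame_vert. Qed.

Let ext_beta i j : ext_d beta p (mxrows [:: row (o5 i) T; row (o5 j) T]) = dbe i j - dbe j i.
Proof. by rewrite ext_d1E. Qed.

Let vertical_part (u : 'rV[R]_5) : u *m g p = \sum_(a < 3) (u *m N) 0 a *: row a K.
Proof. by rewrite gNK mulmxA mulmx_sum_row. Qed.

Let horizontal_part (u : 'rV[R]_5) :
  u *m (1%:M - g p) = \sum_(i < 2) (u *m dmap pi p) 0 i *: row i (hl p).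
Proof. by rewrite gDh mulmxA mulmx_sum_row. Qed.

Let beta_vertical u : beta p u = \sum_(a < 3) (u *m N) 0 a * beta p (row a K).
Proof.
rewrite -(multilinear1_sum _ _ _ mbeta) -vertical_part.
by rewrite -[LHS](beta_bidegree hpi hH Pi bV) /form_part part0.
Qed.

(** Only the vertical parts of the arguments matter, so this is a 3-form on the vertical space;
    [wedge21_alt] reduces it to the basis [K], where it is [jet1]. *)
Lemma triple_eq1 A :
  @Defs.wedge R 5 2 1 (bigraded_d g 0 0 beta p) (beta p) A = 0.
Proof.
have F2E C : bigraded_d g 0 0 beta p C = ext_d beta p (C *m g p).
  by rewrite /bigraded_d /form_part part0.
rewrite wedge21E; last first.
  by move=> u v; rewrite !F2E !mul_mxrows; exact: mxrows_swap.
rewrite !F2E !mul_mxrows /= !vertical_part !(multilinear2_2 _ _ _ _ _ _ mF2 aF2) !beta_vertical.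
apply: (@wedge21_alt R (fun i a => (row (o3 i) A *m N) 0 a)
  (fun a e => ext_d beta p (mxrows [:: row a K; row e K])) (fun a => beta p (row a K))) => [a e|].
  exact: mxrows_swap.
rewrite -!rT_v // !ext_beta; exact: jet1.
Qed.

(** * The equation that involves theta *)

Section VerticalVolume.
Variable QV : tfield M 3.
Hypotheses (hQ : is_QV g OmegaV QV).

Let mQ : multilinear (QV p). Proof. by case: hQ => [[mv _] _ _]; case: (mv p). Qed.
Let aQ : Defs.alternating (QV p). Proof. by case: hQ => [[mv _] _ _]; case: (mv p). Qed.
Let q := QV p N^T.

Lemma QV_vertical X : QV p (X *m (g p)^T) = QV p X.
Proof. by case: hQ => [_ bQ _]; rewrite -[RHS]bQ /mv_part part0. Qed.

Lemma QV_frame : q * OmegaV p K = -1.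
Proof.
case: hQ => [_ _ cQ]; have := cQ p 0.
rewrite (contract_volume DhNK KD (fV.1 p).1 (fV.1 p).2 0 mQ aQ).
  by move=> /(congr1 -%R); rewrite opprK.
by move=> X; rewrite -g_at QV_vertical.
Qed.

Let mF4 : multilinear (ext_d OmegaV p). Proof. exact: multilinear_ext_d. Qed.
Let aF4 : Defs.alternating (ext_d OmegaV p). Proof. exact: alternating_ext_d. Qed.
Let Xd i := dom 4 3 2 i - dom 3 4 2 i + dom 2 4 3 i - dom i 4 3 2.

Let volume_d i : (i < 2)%N ->
  ext_d OmegaV p (mxrows [:: row (o3 2) K; row (o3 1) K; row (o3 0) K; row (o2 i) (hl p)]) = Xd i.
Proof. by move=> i2; rewrite -!rT_v // -rT_h // ext_d3E. Qed.

Let Kg : K *m g p = K. Proof. by rewrite gNK mulmxA KN mul1mx. Qed.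
Let Kh : K *m (1%:M - g p) = 0. Proof. by rewrite mulmxBr mulmx1 Kg subrr. Qed.

(** Contraction with [QV] inserts the rows of [K] in reverse order. As these fill the three vertical
    slots, the bidegree of the derivative leaves only the horizontal part of [u]. *)
Lemma theta_frame u : theta_of g OmegaV QV p u =
  - (q * \sum_(i < 2) (u *m dmap pi p) 0 i * Xd i).
Proof.
rewrite /theta_of (@contract_block R 5 3 2 1 N K (dmap pi p) (hl p) _ _ u mQ aQ).
- rewrite rev_rows3_last /bigraded_d /form_part part_last //;
    try by rewrite -row_mul ?Kg ?Kh ?row0.
  rewrite horizontal_part multilinear4_last //; congr (- (_ * _)); apply: eq_bigr => i _.
  by rewrite -(volume_d (ltn_ord i)) o2_val.
- exact: multilinear_part.
- exact: alternating_part.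
- by rewrite addrC.
- exact: KD.
- by move=> X; rewrite -mulmxA -trmx_mul -gNK QV_vertical.
Qed.

(** The 2-form is the antisymmetrisation of the expression in [key], bilinear in the horizontal part
    of [u] and the vertical part of [v]. On frame vectors this expression is a multiple of [jet2],
    the factor [QV p N^T] removing the volume. *)
Lemma triple_eq2 A :
  kappa p * (bigraded_d g 0 1 beta p A -
    @Defs.wedge R 5 1 1 (theta_of g OmegaV QV p) (beta p) A) = 0.
Proof.
have key u v : kappa p * (ext_d beta p (mxrows [:: u *m (1%:M - g p); v *m g p]) -
    theta_of g OmegaV QV p u * beta p v) = 0.
  rewrite theta_frame horizontal_part vertical_part (multilinear2_2 _ _ _ _ _ _ mF2 aF2) beta_vertical.
  apply: split_bilinear => i a; have i2 := ltn_ord i; have a3 := ltn_ord a.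
  rewrite -{1}(o2_val i) -(o3_val a) -rT_h // -rT_v // ext_beta.
  have J2 := jet2 i2 (a3 : (1 < a.+2 < 5)%N).
  rewrite omE volume_frame_vert in J2.
  rewrite kappa_center; exact: cancel_volume QV_frame J2.
rewrite /bigraded_d /form_part part1_2 wedge11E.
rewrite (mxrows_swap (row (o2 1) A *m (1%:M - g p)) _ mF2 aF2).
exact: antisym_cancel (key _ _) (key _ _).
Qed.

End VerticalVolume.

(** * The equation that involves rho *)

Section HorizontalArea.
Variable QH : tfield M 2.
Hypotheses (hQ : is_QH pi omega g QH).

Let mQ : multilinear (QH p). Proof. by case: hQ => [[mv _] _ _]; case: (mv p). Qed.
Let aQ : Defs.alternating (QH p). Proof. by case: hQ => [[mv _] _ _]; case: (mv p). Qed.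
Let q := QH p (dmap pi p)^T.

Lemma QH_horizontal X : QH p (X *m (1%:M - g p)^T) = QH p X.
Proof. by case: hQ => [_ bQ _]; rewrite -[RHS]bQ /mv_part partk. Qed.

Let Qh X : QH p (X *m (hl p)^T *m (dmap pi p)^T) = QH p X.
Proof. by rewrite -mulmxA -trmx_mul -gDh QH_horizontal. Qed.

Lemma QH_area : q * w0 = -1.
Proof.
case: hQ => [_ _ cQ]; have := cQ p 0.
rewrite /pullback (contract_pullback (hor_liftE hpi hH p).1 DhNK hN
  (homega.1 b).1 (homega.1 b).2 0 mQ aQ) => [/(congr1 -%R)|//].
by rewrite opprK.
Qed.

Let mF4 : multilinear (ext_d OmegaV p). Proof. exact: multilinear_ext_d. Qed.
Let aF4 : Defs.alternating (ext_d OmegaV p). Proof. exact: alternating_ext_d. Qed.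

Let hg : hl p *m g p = 0. Proof. by rewrite gNK mulmxA hN mul0mx. Qed.
Let hh : hl p *m (1%:M - g p) = hl p. Proof. by rewrite mulmxBr mulmx1 hg subr0. Qed.

Lemma rho_frame A : rho_of g OmegaV QH p A = q * \sum_(a < 3) \sum_(c < 3)
  (row (o2 0) A *m N) 0 a * (row (o2 1) A *m N) 0 c *
  (dom 1 0 a.+2 c.+2 - dom 0 1 a.+2 c.+2 + dom a.+2 1 0 c.+2 - dom c.+2 1 0 a.+2).
Proof.
rewrite /rho_of (@contract_block R 5 2 3 2 (dmap pi p) (hl p) N K _ _ A mQ aQ).
- rewrite rev_rows2_last /bigraded_d /form_part part_first2 //;
    try by rewrite -row_mul ?hg ?hh ?row0.
  rewrite !vertical_part multilinear4_2 //; congr (_ * _).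
  apply: eq_bigr => i _; apply: eq_bigr => j _; congr (_ * _).
  have i3 := ltn_ord i; have j3 := ltn_ord j.
  by rewrite -{1}(o3_val i) -{1}(o3_val j) -!rT_v // -!rT_h // ext_d3E.
- exact: multilinear_part.
- exact: alternating_part.
- exact: DhNK.
- exact: hN.
- exact: Qh.
Qed.

Let dkappa v : bigraded_d g 0 0 (form0 kappa) p v = \sum_(a < 3) (v *m N) 0 a * (w0 * dk a.+2).
Proof.
rewrite /bigraded_d /form_part part0 ext_d0E vertical_part derive_sum_dir.
  by apply: eq_bigr => a _; rewrite kappa_vert_derive -(o3_val a) -rT_v ?o3_val.
have sk := smooth_kappa hpi homega hH hPi p.
have px0 : cimg p x0 by exists p => //; exact: mem_cdom.
exact: (smooth_differentiable sk px0).
Qed.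

(** Both terms depend only on the vertical parts of the two arguments. On the basis [K] the claim is
    [jet3] scaled by the area coefficient [w0], one factor of whose square is cancelled by [QH]. *)
Lemma triple_eq3 A :
  @Defs.wedge R 5 1 1 (bigraded_d g 0 0 (form0 kappa) p) (beta p) A -
    kappa p ^+ 2 * rho_of g OmegaV QH p A = 0.
Proof.
rewrite wedge11E !dkappa rho_frame !beta_vertical kappa_center.
apply: area_cancel QH_area _ => a c; have a3 := ltn_ord a; have c3 := ltn_ord c.
have J3 := jet3 (a3 : (1 < a.+2 < 5)%N) (c3 : (1 < c.+2 < 5)%N).
by rewrite /be (rT_v a3) (rT_v c3) !o3_val in J3.
Qed.

End HorizontalArea.

End Jets.

Theorem theorem4p3 (R : realType) (M : manifold R 5) (B : manifold R 2)
  (pi : M -> B) (hpi : fiber_bundle pi)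
  (Omega : tfield M 5) (hOmega : volume_form Omega)
  (omega : tfield B 2) (homega : volume_form omega)
  (H : M -> 'M[R]_5) (hH : horizontal_subbundle pi H)
  (Pi : tfield M 2) (hPi : poisson Pi)
  (hcoupling : almost_coupling (connection_along pi H) Pi)
  (OmegaV : tfield M 3)
  (hOmegaV : is_vertical_volume pi Omega omega (connection_along pi H) OmegaV)
  (QV : tfield M 3) (hQV : is_QV (connection_along pi H) OmegaV QV)
  (QH : tfield M 2) (hQH : is_QH pi omega (connection_along pi H) QH)
  (psi : tfield B 2) (hpsi : is_psi omega psi) :
  let gamma := connection_along pi H in
  let Pi20 := mv_part gamma 2 Pi in
  let Pi02 := mv_part gamma 0 Pi in
  let kappa := kappa_of pi omega Pi20 in
  let beta := beta_of OmegaV Pi02 in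
  poisson_triple pi Omega omega gamma kappa beta /\
  forall (p : M) (A : 'M[R]_(2, 5)),
    Pi p A = kappa p * hor pi gamma psi p A + P_of QV beta p A.
Proof.
move=> gamma Pi20 Pi02 kappa beta.
have fo := homega.1; have [mPi sch] := hPi; have [fV bV _] := hOmegaV.
have hD p := (hor_liftE hpi hH p).1.
split.
  split.
  - exact: connection_ehresmann.
  - exact: smooth_kappa.
  - exact: (is_form_beta hpi hH mPi fV bV).
  - exact: (beta_bidegree hpi hH Pi bV).
  exists OmegaV, QH, QV; split=> //; split=> p A.
  - have [N [K [DhNK hN KD KN]]] := adapted_basis (hD p).
    exact: (triple_eq1 hpi hH mPi hcoupling fV bV DhNK hN KD KN (sch p)).
  - have [N [K [DhNK hN KD KN]]] := adapted_basis (hD p).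
    exact: (triple_eq2 hpi fo hH mPi hcoupling fV bV DhNK hN KD KN (sch p) hQV).
  - have [N [K [DhNK hN KD KN]]] := adapted_basis (hD p).
    exact: (triple_eq3 hpi fo hH mPi hcoupling fV bV DhNK hN KD KN (sch p) hQH).
move=> p A.
have [N [K [DhNK hN KD KN]]] := adapted_basis (hD p).
have [mvpsi cpsi] := hpsi; have [mpsi apsi] := mvpsi.1 (pi p).
have [[mvQ _] bQ _] := hQV; have [mQ aQ] := mvQ p.
(* The reversal of order in the contraction turns the normalisation -1 of [psi] into +1. *)
have pw : psi (pi p) 1%:M * omega (pi p) 1%:M = 1.
  have := cpsi (pi p) 0.
  by rewrite (contract_area (fo.1 _).1 (fo.1 _).2 0 mpsi apsi) => /oppr_inj.
rewrite (coupling_formula DhNK hN KD KN (mPi.1 p).1 (mPi.1 p).2 (coupling_at hpi hH hcoupling p)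
  (fV.1 p).1 (fV.1 p).2 (vertical_at hpi hH bV p) A mpsi apsi mQ aQ _
  (QV_frame hpi hH fV DhNK KD hQV) pw).
  congr (_ + _).
    by congr (_ * _); exact/esym/(kappa_at hpi fo hH mPi).
  rewrite /P_of /insert_covec; congr (- QV p (@col_mx _ 1 2 5 _ A)); apply/rowP => i.
  rewrite [LHS]mxE [RHS]mxE; exact/esym/(beta_at hpi hH).
move=> X; by rewrite -(hor_liftE hpi hH p).2; exact: QV_vertical hQV X.
Qed.
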